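(* Let $X$ be a complex Banach space and let $f\in \mathrm{C}_{\mathrm{ub}}^{k-1,1}(\mathbb{R}_+;X)$ for some $k\in\mathbb{N}$. Then for all $t>0$ and all $n\in\mathbb{N}$ with $n\ge k-\frac12$, $$\left\|\sum_{j=1}^{n+1}\frac{b_{n,j}}{t}\,\hat f\left(\frac{\lambda_{n,j}}{t}\right)-f(t)\right\|_X\le C(k)\,t^k\,(n+1)^{-k+\frac12}\,L(f^{(k-1)}),$$ where $$C(k)=\frac{\sqrt2}{(2k-1)^{1/4}}\sqrt{\frac{8k}{(2k+1)^{3/2}}+\frac{13^k}{10^k}\sqrt{\frac{5^{2k}}{6\cdot13^{2k}}+\frac{360}{13(2k-1)}}}.$$ In particular, $\sum_{j=1}^{n+1}\frac{b_{n,j}}{t}\hat f\left(\frac{\lambda_{n,j}}{t}\right)$ converges to $f(t)$ as $n\to\infty$ with rate $\mathcal{O}(n^{-k+\frac12})$, locally uniformly in $t$.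
   Context: $\mathbb{N}=\{1,2,3,\dots\}$ and $\mathbb{R}_+=[0,\infty)$. $\mathrm{C}_{\mathrm{ub}}(\mathbb{R}_+;X)=\mathrm{C}_{\mathrm{ub}}^0(\mathbb{R}_+;X)$ is the space of bounded uniformly continuous functions $\mathbb{R}_+\to X$ with the supremum norm; $\mathrm{C}_{\mathrm{ub}}^k(\mathbb{R}_+;X)$ is the subspace of $k$-times differentiable functions whose derivatives up to order $k$ belong to $\mathrm{C}_{\mathrm{ub}}(\mathbb{R}_+;X)$; $\mathrm{C}_{\mathrm{ub}}^{k,1}(\mathbb{R}_+;X)$ is the space of all $f\in \mathrm{C}_{\mathrm{ub}}^k(\mathbb{R}_+;X)$ for which $f^{(k)}$ is globally Lipschitz continuous. For $f:\mathbb{R}_+\to X$, $$L(f):=\limsup_{t\downarrow0}\frac1t\|f(t+\cdot)-f\|_\infty\in[0,\infty].$$ The Laplace transform is $\hat f(\lambda)=\int_0^\infty e^{-\lambda t}f(t)\,dt$ for $\operatorname{Re}\lambda>0$. For $n\in\mathbb{N}$, $r_n=P_n/Q_n$ is the $n$-th subdiagonal Padé approximation to the exponential function: $P_n,Q_n$ are the unique polynomials of degree $n$ and $n+1$, respectively, with $P_n(0)=Q_n(0)=1$ and $|r_n(z)-e^z|\le C|z|^{2n+2}$ for $z$ in a neighbourhood of $0$. Explicitly $$P_n(z)=\sum_{j=0}^{n}\frac{(2n+1-j)!\,n!}{(2n+1)!\,j!\,(n-j)!}z^j,\qquad Q_n(z)=\sum_{j=0}^{n+1}\frac{(2n+1-j)!\,(n+1)!}{(2n+1)!\,j!\,(n+1-j)!}(-z)^j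 .$$ The roots $\lambda_{n,1},\dots,\lambda_{n,n+1}$ of $Q_n$ are pairwise distinct and lie in the open right half-plane, and $b_{n,j}\in\mathbb{C}$ are the coefficients of the partial fraction decomposition $r_n(z)=\sum_{j=1}^{n+1}\frac{b_{n,j}}{\lambda_{n,j}-z}$. *)

(* Defs.v *)
From Stdlib Require Import Reals Factorial.
From Coquelicot Require Import Coquelicot.
Open Scope R_scope.

Definition Cexp (z : C) : C := (exp (Re z) * cos (Im z), exp (Re z) * sin (Im z)).

(** * Restriction of scalars

    Coquelicot's derivatives and Riemann integrals of functions [R -> V] ask
    for a real normed module [V]; [realify X] is the complex Banach space [X]
    with the same addition, uniform structure and norm, and with scalars
    restricted to the reals. *)

Section Realify.

Variable X : CompleteNormedModule C_AbsRing.

Lemma realify_scal_assoc (x y : R) (u : X) :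
  scal (RtoC x) (scal (RtoC y) u) = scal (RtoC (mult x y)) u.
Proof.
rewrite scal_assoc; f_equal; symmetry; exact (RtoC_mult x y).
Qed.

Lemma realify_scal_one (u : X) : scal (RtoC (one : R_Ring)) u = u.
Proof. exact (scal_one u). Qed.

Lemma realify_scal_distr_l (x : R) (u v : X) :
  scal (RtoC x) (plus u v) = plus (scal (RtoC x) u) (scal (RtoC x) v).
Proof. exact (scal_distr_l _ u v). Qed.

Lemma realify_scal_distr_r (x y : R) (u : X) :
  scal (RtoC (plus x y)) u = plus (scal (RtoC x) u) (scal (RtoC y) u).
Proof.
rewrite <- scal_distr_r; f_equal; exact (RtoC_plus x y).
Qed.

Definition realify_ModuleSpace_mixin :
    ModuleSpace.mixin_of R_Ring (NormedModule.AbelianGroup _ X) :=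
  ModuleSpace.Mixin R_Ring (NormedModule.AbelianGroup _ X)
    (fun (r : R) (u : X) => scal (RtoC r) u)
    realify_scal_assoc realify_scal_one
    realify_scal_distr_l realify_scal_distr_r.

Definition realify_NormedModuleAux : NormedModuleAux R_AbsRing :=
  NormedModuleAux.Pack R_AbsRing X
    (NormedModuleAux.Class R_AbsRing X
       (ModuleSpace.Class R_Ring X _ realify_ModuleSpace_mixin)
       (UniformSpace.class (NormedModule.UniformSpace _ X)))
    X.

Lemma realify_norm_scal (r : R) (u : X) :
  norm (scal (RtoC r) u) <= abs r * norm u.
Proof.
replace (abs r) with (abs (RtoC r : C_AbsRing)) by exact (Cmod_R r).
apply (norm_scal (V := X)).
Qed.

Definition realify_NormedModule_mixin :
    NormedModule.mixin_of R_AbsRing realify_NormedModuleAux :=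
  NormedModule.Mixin R_AbsRing realify_NormedModuleAux
    (fun u : X => norm u) (norm_factor (V := X))
    norm_triangle realify_norm_scal norm_compat1 norm_compat2 norm_eq_zero.

Definition realify : CompleteNormedModule R_AbsRing :=
  CompleteNormedModule.Pack R_AbsRing X
    (CompleteNormedModule.Class R_AbsRing X
       (NormedModule.Class R_AbsRing X _ realify_NormedModule_mixin)
       (CompleteSpace.mixin _
          (CompleteSpace.class (CompleteNormedModule.CompleteSpace _ X))))
    X.

End Realify.

(** * Functions on [[0, oo)]

    A function on [[0, oo)] is a total function on [R] of which only the values
    at nonnegative arguments are ever used. *)

Section HalfLine.

Context {X : CompleteNormedModule C_AbsRing}.

(** The filter is that of the neighbourhoods of [t] in [[0, oo)], so that this
    is the one-sided derivative at [t = 0]. *)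
Definition is_derive_hl (f : R -> X) (t : R) (l : X) : Prop :=
  filterdiff (V := realify X) f (within (Rle 0) (locally t))
    (fun h : R => scal (h : R_AbsRing) (l : realify X)).

Definition ex_derive_hl (f : R -> X) (t : R) : Prop :=
  exists l : X, is_derive_hl f t l.

Definition Derive_hl (f : R -> X) (t : R) : X :=
  iota (T := CompleteNormedModule.CompleteSpace _ X) (is_derive_hl f t).

Fixpoint Derive_hl_n (f : R -> X) (m : nat) : R -> X :=
  match m with
  | O => f
  | S m => Derive_hl (Derive_hl_n f m)
  end.

Definition bounded_hl (f : R -> X) : Prop :=
  exists M : R, forall t : R, 0 <= t -> norm (f t) <= M.

Definition uniformly_continuous_hl (f : R -> X) : Prop :=
  forall eps : posreal, exists delta : posreal,
  forall s t : R, 0 <= s -> 0 <= t -> Rabs (s - t) < delta ->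
  norm (minus (f s) (f t)) < eps.

Definition Lipschitz_hl (f : R -> X) : Prop :=
  exists M : R, forall s t : R, 0 <= s -> 0 <= t ->
  norm (minus (f s) (f t)) <= M * Rabs (s - t).

Definition Cub (m : nat) (f : R -> X) : Prop :=
  (forall i : nat, (i < m)%nat ->
     forall t : R, 0 <= t -> ex_derive_hl (Derive_hl_n f i) t) /\
  (forall i : nat, (i <= m)%nat ->
     bounded_hl (Derive_hl_n f i) /\ uniformly_continuous_hl (Derive_hl_n f i)).

Definition Cub1 (m : nat) (f : R -> X) : Prop :=
  Cub m f /\ Lipschitz_hl (Derive_hl_n f m).

Definition sup_norm_hl (f : R -> X) : Rbar :=
  Lub_Rbar (fun r : R => exists s : R, 0 <= s /\ r = norm (f s)).

Definition Rbar_limsup_at_0_right (phi : R -> Rbar) : Rbar :=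
  Rbar_glb (fun y : Rbar => exists delta : R, 0 < delta /\
    y = Rbar_lub (fun z : Rbar => exists t : R, 0 < t < delta /\ z = phi t)).

Definition Lconst (f : R -> X) : Rbar :=
  Rbar_limsup_at_0_right (fun t : R =>
    Rbar_mult (/ t) (sup_norm_hl (fun s : R => minus (f (t + s)) (f s)))).

(** The improper Riemann integral over [[0, oo)]; its value is meaningful only
    when the integral converges, as it does for [f] bounded and continuous on
    [[0, oo)] and [0 < Re lambda]. *)
Definition Laplace (f : R -> X) (lambda : C) : X :=
  RInt_gen (V := realify X)
    (fun s : R => scal (Cexp (- (lambda * s))%C) (f s))
    (at_point 0) (Rbar_locally p_infty).

Definition Laplace_inv_approx (lambda b : nat -> nat -> C) (f : R -> X)
    (n : nat) (t : R) : X :=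
  sum_n_m (fun j : nat => scal (b n j / t)%C (Laplace f (lambda n j / t)%C))
    1 (n + 1).

End HalfLine.

(** * The subdiagonal Padé approximations of the exponential *)

Definition padeP (n : nat) (z : C) : C :=
  sum_n (fun j : nat =>
    (RtoC (INR (fact (2 * n + 1 - j)) * INR (fact n) /
           (INR (fact (2 * n + 1)) * INR (fact j) * INR (fact (n - j))))
     * z ^ j)%C) n.

Definition padeQ (n : nat) (z : C) : C :=
  sum_n (fun j : nat =>
    (RtoC (INR (fact (2 * n + 1 - j)) * INR (fact (n + 1)) /
           (INR (fact (2 * n + 1)) * INR (fact j) * INR (fact (n + 1 - j))))
     * (- z) ^ j)%C) (n + 1).

Definition pade (n : nat) (z : C) : C := (padeP n z / padeQ n z)%C.

(** [l 1], ..., [l (n + 1)] are the roots of [padeQ n], each listed once. *)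
Definition padeQ_roots (n : nat) (l : nat -> C) : Prop :=
  (forall i j : nat, (1 <= i <= n + 1)%nat -> (1 <= j <= n + 1)%nat ->
     l i = l j -> i = j) /\
  (forall z : C, padeQ n z = 0 <->
     exists j : nat, (1 <= j <= n + 1)%nat /\ z = l j).

Definition pade_partial_fractions (n : nat) (l b : nat -> C) : Prop :=
  forall z : C, padeQ n z <> 0 ->
  pade n z = sum_n_m (fun j : nat => (b j / (l j - z))%C) 1 (n + 1).

Definition Cbound (k : nat) : R :=
  sqrt 2 / Rpower (2 * INR k - 1) (1 / 4) *
  sqrt (8 * INR k / Rpower (2 * INR k + 1) (3 / 2) +
        13 ^ k / 10 ^ k *
        sqrt (5 ^ (2 * k) / (6 * 13 ^ (2 * k)) + 360 / (13 * (2 * INR k - 1)))).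

(* Main.v *)
Require Import Defs.
From Stdlib Require Import Reals Factorial Lra Lia Classical.
From Coquelicot Require Import Coquelicot.
From mathcomp Require Import ssreflect.
From mathcomp Require all_boot all_order all_algebra ring lra zify.
From mathcomp Require Rstruct.
Open Scope R_scope.

(** The error as an integral against an explicit kernel, and the size of the kernel.

    Put [g s = sum_j b_j exp (- l_j s)].  By the partial fraction decomposition
    the approximation at [t] is the integral of [f (t s)] against [g], so that
    the error is the integral of [f (t s)] against [g - delta_1], where [delta_1]
    is the unit mass at [1].  Let [H_k] be the [k]-fold primitive of
    [g - delta_1] that vanishes at [0]; it decays at infinity.  After [k]
    integrations by parts the error is [(- t) ^ k] times the integral of
    [f^(k) (t s)] against [H_k] ([concomitant_parts], [kernel_error]).  Hence it
    is at most [t ^ k L] times the integral of [|H_k|], and the theorem follows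
    from the bound [2 (n + 1) ^ (1 / 2 - k)] for that integral ([kernel_L1]),
    because [2 <= Cbound k] for [1 <= k] ([Cbound_ge_2]).  A Lipschitz function
    with values in [X] need not be differentiable anywhere, so the integrations
    by parts are done for averages of [f] over short intervals, whose [k]-th
    derivatives are difference quotients of [f^(k - 1)] and are bounded by
    nearly [L] ([Cub1_smoothing], [approx_error]).

    The bound on [H_k] is obtained without Fourier analysis.  Let [q_i] be the
    coefficient of [(- z) ^ i] in [padeQ n].  The combination [u] of the
    primitives [H_(n + 1 + k - i)] with the weights [q_i], for [0 <= i <= n + 1],
    is a polynomial on [[0, 1]], namely the derivative of order [n + 1 - k] of
    [s ^ (n + 1) (s - 1) ^ n / (2 n + 1)!], and it is zero beyond [1]
    ([ker_before_ode], [ker_after_ode]); this is the contact of order [2 n + 2]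
    between [padeP n] and [exp * padeQ n] at the origin.  So [q_(n + 1) H_k] is
    the output of a linear system with input [u] and transfer function
    [q_(n + 1) p ^ (n + 1) / padeQ n (- p)].  On the imaginary axis
    [|padeQ|^2 - |padeP|^2] is the square of [q_(n + 1) |p| ^ (n + 1)], which
    makes this transfer function at most one in modulus.

    The same fact holds in the time domain, with a decay rate.  The system is the
    discontinuous Galerkin discretization of the transport equation on [[0, 1]]:
    its state is a polynomial [x] of degree at most [n] in [xi], moved by
    [x_s = - x_xi + j r], where [j] is the jump between the inflow [u] and
    [x (0)], and [r] represents evaluation at [0] on the polynomials of degree at
    most [n].  Testing the equation with [(1 - xi) x] gives a quadratic form whose
    derivative is [u ^ 2 - j ^ 2 - int x ^ 2] exactly, once a multiple of the
    square of the leading coefficient of [x] is added to [int (1 - xi) x ^ 2]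
    ([storage_form_shift]); and this form is at most [2 int x ^ 2]
    ([storage_form_upper]).  Therefore the integral of [exp (s / 2) j ^ 2] is at
    most that of [exp (s / 2) u ^ 2] ([energy_estimate], [kernel_energy]).  The
    weight turns the bound in the mean square into one in the mean, it gives the
    decay of the primitives ([ker_after_decay]), and, applied to a single
    exponential, it shows that the roots of [padeQ n] have real part at least
    [1 / 4] ([root_Re]), so that the Laplace integrals converge.

    What is left is the mean square of [u].  Integration by parts makes the mean
    squares of the successive derivatives of [s ^ (n + 1) (1 - s) ^ n] a
    log-convex sequence ([kerpoly_log_convex]), so that the wanted power of
    [n + 1] has to be checked only at its two ends, a Legendre polynomial and
    the polynomial itself ([int01_derivn_kerpoly_le]). *)

(** * Coefficients and quadratic forms *)

(** Keeps the decision procedure for the standard reals at hand where [lra] is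
    the one for ordered fields. *)
Ltac rlra := lra.

(** [(1 + 1 / N) ^ N <= e <= 3]. *)
Lemma pow_succ_le_3 (N : nat) : (1 <= N)%nat -> (INR N + 1) ^ N <= 3 * INR N ^ N.
Proof.
intros HN.
assert (H0 : 0 < INR N) by (apply lt_0_INR; lia).
replace (INR N + 1) with (INR N * (1 + / INR N)) by (field; lra).
rewrite Rpow_mult_distr Rmult_comm.
apply Rmult_le_compat_r; [apply pow_le; lra|].
apply Rle_trans with (exp (/ INR N) ^ N).
- apply pow_incr; split; [apply Rplus_le_le_0_compat; [lra|left; apply Rinv_0_lt_compat; lra]|].
  apply exp_ineq1_le.
- rewrite -Rpower_pow; [|apply exp_pos].
  unfold Rpower; rewrite ln_exp Rinv_r; [apply exp_le_3|lra].
Qed.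

Definition coefP (n j : nat) : R :=
  INR (fact (2 * n + 1 - j)) * INR (fact n) /
  (INR (fact (2 * n + 1)) * INR (fact j) * INR (fact (n - j))).

(** The sign is put into the powers: these are the positive weights of
    [(- z) ^ i] in [padeQ n z]. *)
Definition coefQ (n i : nat) : R :=
  INR (fact (2 * n + 1 - i)) * INR (fact (n + 1)) /
  (INR (fact (2 * n + 1)) * INR (fact i) * INR (fact (n + 1 - i))).

Definition bilin (m : nat -> nat -> R) (n : nat) (a b : nat -> R) : R :=
  sum_n (fun i => sum_n (fun l => m i l * (a i * b l)) n) n.

Lemma IZR_2_INR : IZR 2 = INR 2. Proof. simpl; lra. Qed.
Lemma IZR_3_INR : IZR 3 = INR 3. Proof. simpl; lra. Qed.

Module PolyEnergy.
Import all_boot all_order all_algebra ring lra zify Rstruct.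
Import Order.TTheory GRing.Theory Num.Theory.
Local Open Scope ring_scope.

(** * Integration of polynomials over the unit interval *)

Definition int01 (p : {poly R}) : R := RInt (fun x : R => p.[x]) 0 1.

Lemma is_derive_horner (p : {poly R}) (x : R) :
  is_derive (fun y : R => p.[y]) x p^`().[x].
Proof.
elim/poly_ind: p => [|p c IH].
  apply: (@is_derive_ext R_AbsRing R_NormedModule (fun _ => (0 : R))).
    by move=> t; rewrite horner0.
  rewrite deriv0 horner0; exact: is_derive_const.
apply: (@is_derive_ext R_AbsRing R_NormedModule (fun y : R => Rplus (Rmult p.[y] y) c)).
  by move=> t; rewrite hornerMXaddC.
rewrite derivD derivM derivC derivX mulr1 addr0 hornerD hornerMX.
have -> : p^`().[x] * x + p.[x] = Rplus (Rplus (Rmult p^`().[x] x) (Rmult p.[x] 1)) 0.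
  by rewrite Rplus_0_r Rmult_1_r.
apply: (is_derive_plus (V := R_NormedModule)); last exact: is_derive_const.
apply: (is_derive_mult (fun y => p.[y]) (fun y => y)) => //.
  exact: is_derive_id.
by move=> n m; exact: Rmult_comm.
Qed.

Lemma continuous_horner (p : {poly R}) (x : R) :
  continuous (fun y : R => p.[y]) x.
Proof. by apply: ex_derive_continuous; exists p^`().[x]; exact: is_derive_horner. Qed.

Lemma ex_int01 (p : {poly R}) : ex_RInt (fun x : R => p.[x]) 0 1.
Proof. by apply: ex_RInt_continuous => z _; exact: continuous_horner. Qed.

Lemma is_int01 (p : {poly R}) : is_RInt (fun x : R => p.[x]) 0 1 (int01 p).
Proof. exact/RInt_correct/ex_int01. Qed.

Lemma int01D (p q : {poly R}) : int01 (p + q) = int01 p + int01 q.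
Proof.
apply: is_RInt_unique; apply: (is_RInt_ext (fun x => plus p.[x] q.[x])).
  by move=> x _; rewrite hornerD.
by apply: is_RInt_plus; exact: is_int01.
Qed.

Lemma int01Z (a : R) (p : {poly R}) : int01 (a *: p) = a * int01 p.
Proof.
apply: is_RInt_unique; apply: (is_RInt_ext (fun x => scal a p.[x])).
  by move=> x _; rewrite hornerZ.
by apply: (is_RInt_scal (V := R_NormedModule)); exact: is_int01.
Qed.

Lemma int01N (p : {poly R}) : int01 (- p) = - int01 p.
Proof. by rewrite -scaleN1r int01Z mulN1r. Qed.

Lemma int01B (p q : {poly R}) : int01 (p - q) = int01 p - int01 q.
Proof. by rewrite int01D int01N. Qed.

Lemma int01_deriv (p : {poly R}) : int01 p^`() = p.[1] - p.[0].
Proof.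
apply: is_RInt_unique.
apply: (is_RInt_derive (fun x => p.[x])) => x _; first exact: is_derive_horner.
exact: continuous_horner.
Qed.

Lemma le_int01 (p q : {poly R}) :
  (forall x, 0 <= x -> x <= 1 -> p.[x] <= q.[x]) -> int01 p <= int01 q.
Proof.
move=> H; apply/RleP; apply: RInt_le; [by rlra|exact: ex_int01|exact: ex_int01|].
by move=> x [x0 x1]; apply/RleP; apply: H; apply/RleP; exact: Rlt_le.
Qed.

Lemma int01_0 : int01 0 = 0.
Proof. by rewrite -(scale0r 0) int01Z mul0r. Qed.

Lemma int01_ge0 (p : {poly R}) :
  (forall x, 0 <= x -> x <= 1 -> 0 <= p.[x]) -> 0 <= int01 p.
Proof. by move=> H; rewrite -int01_0; apply: le_int01 => x *; rewrite horner0; exact: H. Qed.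

Lemma int01_const (c : R) : int01 c%:P = c.
Proof.
by have := int01_deriv (c *: 'X); rewrite derivZ derivX alg_polyC !hornerE subr0.
Qed.

Lemma int01_parts (p q : {poly R}) : q.[0] = 0 -> q.[1] = 0 ->
  int01 (p * q^`()) = - int01 (p^`() * q).
Proof.
move=> q0 q1; apply/eqP; rewrite -addr_eq0 -int01D addrC -derivM int01_deriv !hornerM q0 q1.
by rewrite !mulr0 subr0.
Qed.

Definition rho : {poly R} := 'X * (1 - 'X).

Lemma horner_rho (x : R) : rho.[x] = x * (1 - x).
Proof. by rewrite /rho !hornerE. Qed.

(** A derivative costs one factor [rho], hence one order of vanishing at each end
    of the interval. *)
Lemma deriv_rho_mul (n : nat) (r : {poly R}) :
  exists r', (rho ^+ n.+1 * r)^`() = rho ^+ n * r'.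
Proof.
exists (n.+1%:R * rho^`() * r + rho * r^`()).
rewrite derivM deriv_exp /= exprS -mulr_natl.
by move: rho^`() rho (rho ^+ n) => d p pn; ring.
Qed.

(** [rho ^+ n * r] vanishes to order [n] at both ends, so none of the [n]
    integrations by parts leaves a boundary term. *)
Lemma int01_parts_iter (n : nat) (p r : {poly R}) :
  int01 (p * (rho ^+ n * r)^`(n)) = (-1) ^+ n * int01 (p^`(n) * (rho ^+ n * r)).
Proof.
elim: n r => [|n IH] r; first by rewrite !derivn0 expr0 !mul1r.
have [r' E] := deriv_rho_mul n r.
rewrite derivSn E IH -E derivnS int01_parts; first by rewrite [(-1) ^+ n.+1]exprS -mulrA mulN1r mulrN.
  by rewrite hornerM horner_exp horner_rho mul0r expr0n /= mul0r.
by rewrite hornerM horner_exp horner_rho subrr mulr0 expr0n mul0r.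
Qed.

(** The integral of [(p + t q) ^ 2] is nonnegative for every [t]; take for [t] the
    minimizer, or a large value when the quadratic term vanishes. *)
Lemma int01_CS (p q : {poly R}) : int01 (p * q) ^+ 2 <= int01 (p ^+ 2) * int01 (q ^+ 2).
Proof.
have sq_ge0 (s : {poly R}) : 0 <= int01 (s ^+ 2).
  by apply: int01_ge0 => x _ _; rewrite horner_exp sqr_ge0.
have H (t : R) : 0 <= int01 (p ^+ 2) + 2 * t * int01 (p * q) + t ^+ 2 * int01 (q ^+ 2).
  have := sq_ge0 (p + t *: q).
  rewrite (_ : (p + t *: q) ^+ 2 = p ^+ 2 + (2 * t) *: (p * q) + t ^+ 2 *: q ^+ 2).
    by rewrite !int01D !int01Z.
  by rewrite -!mul_polyC !polyCM !polyC_natr; ring.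
have A0 := sq_ge0 p; have C0 := sq_ge0 q.
set A := int01 (p ^+ 2) in H A0 *; set C := int01 (q ^+ 2) in H C0 *.
set B := int01 (p * q) in H *.
have [C1|C1] := eqVneq C 0.
  have [->|Bn0] := eqVneq B 0; first by rewrite expr0n mulr_ge0.
  (* at this [t] the left side is [- 1] *)
  have := H (- (A + 1) / (2 * B)).
  rewrite C1 mulr0 addr0.
  have -> : 2 * (- (A + 1) / (2 * B)) * B = - (A + 1) by field.
  lra.
have Cp : 0 < C by rewrite lt_def C1.
have := H (- B / C).
have -> : A + 2 * (- B / C) * B + (- B / C) ^+ 2 * C = (A * C - B ^+ 2) / C by field.
by rewrite pmulr_lge0 ?invr_gt0 // subr_ge0.
Qed.

(** The recurrence comes from integrating the derivative of
    [(1 - 2 X) rho ^ (n + 1)] and from [(1 - 2 X) ^ 2 = 1 - 4 rho]. *)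
Lemma int01_rho (n : nat) : int01 (rho ^+ n) = (n`!)%:R ^+ 2 / ((2 * n).+1)`!%:R.
Proof.
elim: n => [|n IH]; first by rewrite expr0 int01_const fact0 muln0 factS fact0 muln1 expr1n divr1.
have D : int01 ((1 - 2 *: 'X) * rho ^+ n.+1)^`() = 0.
  rewrite int01_deriv !hornerM !horner_exp !horner_rho subrr mulr0 mul0r !expr0n.
  by rewrite !mulr0 subrr.
have rho' : rho^`() = 1 - 2 *: 'X.
  rewrite /rho derivM derivB derivX derivC -mul_polyC polyC_natr; ring.
have E : ((1 - 2 *: 'X) * rho ^+ n.+1)^`() =
   n.+1%:R *: rho ^+ n - (2 * (2 * n + 3))%:R *: rho ^+ n.+1.
  rewrite derivM deriv_exp rho' derivB derivZ derivX -polyC1 derivC polyC1 exprS /=.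
  rewrite -!mul_polyC !polyC_natr -[_ *+ n.+1]mulr_natl natrM natrD natrM -natr1.
  have -> : rho = 'X * (1 - 'X) by [].
  move: (('X * (1 - 'X)) ^+ n) => r; move: ('X : {poly R}) => x; ring.
have : n.+1%:R * int01 (rho ^+ n) = (2 * (2 * n + 3))%:R * int01 (rho ^+ n.+1).
  by apply/eqP; rewrite -subr_eq0 -!int01Z -int01B -E D.
move=> E2.
have x0 : 0 <= n%:R :> R by [].
have E3 : int01 (rho ^+ n.+1) = n.+1%:R / (2 * (2 * n + 3))%:R * int01 (rho ^+ n).
  have nz : (2 * (2 * n + 3))%:R != 0 :> R by rewrite pnatr_eq0; lia.
  by rewrite mulrAC E2 mulrC mulKf.
rewrite E3 IH (_ : (2 * n.+1).+1 = (2 * n).+3); last by lia.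
rewrite !factS !natrM -!natr1 !natrM !natrD.
have F1 : ((2 * n)`!)%:R != 0 :> R by rewrite pnatr_eq0 -lt0n fact_gt0.
move: (n%:R) x0 ((2 * n)`!%:R) F1 (n`!%:R) => x x0 F F1 G.
field.
by rewrite F1 !lt0r_neq0 //=; lra.
Qed.

(** * The polynomial representing evaluation at the left end point *)

Lemma derivn_exp_mul (m n : nat) (p r : {poly R}) :
  exists r', (p ^+ (m + n) * r)^`(n) = p ^+ m * r'.
Proof.
elim: n r => [|n IH] r; first by exists r; rewrite addn0 derivn0.
rewrite derivSn.
have -> : (p ^+ (m + n.+1) * r)^`() =
    p ^+ (m + n) * ((m + n).+1%:R * p^`() * r + p * r^`()).
  rewrite addnS derivM deriv_exp exprS -mulr_natl /=.
  by move: p^`() (p ^+ (m + n)) => d pn; ring.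
exact: IH.
Qed.

Lemma coef_1subX_exp (N i : nat) :
  ((1 - 'X : {poly R}) ^+ N)`_i = (-1) ^+ i * 'C(N, i)%:R.
Proof.
elim: N i => [|N IH] i.
  by rewrite expr0 coef1 bin0n; case: i => [|i]; rewrite ?mulr1 ?mulr0.
rewrite exprS mulrBl mul1r coefB coefXM !IH.
case: i => [|i] /=; first by rewrite !bin0 subr0.
by rewrite binS natrD exprS; ring.
Qed.

Section Lift.
Variable n : nat.

(** Its derivative of order [n + 1] is, up to a factor, a Radau polynomial divided by
    its linear factor [X]. *)
Definition radau_wt : {poly R} := rho ^+ n * (1 - 'X).

(** The representative of evaluation at [0] for the scalar product of the
    polynomials of degree at most [n], see [int01_eval0_rep]; it spreads the jump
    at the inflow over the interval. *)
Definition eval0_rep : {poly R} := - (n`!%:R)^-1 *: radau_wt^`(n.+1).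

Lemma factR_neq0 (m : nat) : m`!%:R != 0 :> R.
Proof. by rewrite pnatr_eq0 -lt0n fact_gt0. Qed.

Lemma radau_wtE : radau_wt = 'X^n * (1 - 'X) ^+ n.+1.
Proof. by rewrite /radau_wt /rho exprMn -mulrA -exprSr. Qed.

Lemma coef_radau_wt (m : nat) : radau_wt`_(n + m) = (-1) ^+ m * 'C(n.+1, m)%:R.
Proof. by rewrite radau_wtE coefXnM ltnNge leq_addr /= addKn coef_1subX_exp. Qed.

Lemma size_radau_wt : (size radau_wt <= (2 * n).+2)%N.
Proof.
rewrite radau_wtE; apply: leq_trans (size_polyMleq _ _) _; rewrite size_polyXn /=.
have := size_poly_exp_leq (1 - 'X : {poly R}) n.+1.
have -> : size (1 - 'X : {poly R}) = 2%N.
  by rewrite -opprB size_polyN size_XsubC.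
rewrite /= mul1n => H; apply: leq_trans (_ : n + n.+2 <= _)%N; last by lia.
by rewrite leq_add2l.
Qed.

Lemma derivn_radau_wt_at0 : radau_wt^`(n).[0] = n`!%:R.
Proof.
rewrite horner_coef0 coef_derivn addn0 -{1}(addn0 n) coef_radau_wt bin0 mulr1 ffactnn.
by rewrite expr0.
Qed.

Lemma derivn_radau_wt_at1 : radau_wt^`(n).[1] = 0.
Proof.
have [r E] := derivn_exp_mul 1 n (1 - 'X) ('X^n).
by rewrite radau_wtE mulrC E hornerM expr1 !hornerE subrr mul0r.
Qed.

(** One integration by parts takes out the value at [0], since the derivative of
    order [n] of [radau_wt] is [n!] there and vanishes at [1]; the other [n] have no
    boundary terms.  The remainder vanishes for degree at most [n], and the degree
    [n + 1] is needed for the multiplier [1 - X]. *)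
Lemma int01_eval0_rep (phi : {poly R}) :
  int01 (eval0_rep * phi) = phi.[0] + (-1) ^+ n / n`!%:R * int01 (phi^`(n.+1) * radau_wt).
Proof.
rewrite /eval0_rep -scalerAl int01Z derivnS.
have E : int01 (radau_wt^`(n)^`() * phi) = - n`!%:R * phi.[0] - int01 (phi^`() * radau_wt^`(n)).
  have := int01_deriv (radau_wt^`(n) * phi).
  rewrite derivM int01D !hornerM derivn_radau_wt_at0 derivn_radau_wt_at1 [radau_wt^`(n) * _]mulrC.
  by lra.
rewrite E /radau_wt int01_parts_iter -derivSn -/radau_wt.
by field; exact: factR_neq0.
Qed.

Lemma coef_eval0_rep (m : nat) : eval0_rep`_m =
  - (n`!%:R)^-1 * ((-1) ^+ m.+1 * 'C(n.+1, m.+1)%:R * ((n.+1 + m) ^_ n.+1)%:R).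
Proof.
by rewrite coefZ coef_derivn {1}addSnnS coef_radau_wt -[_ *+ (_ ^_ _)]mulr_natr.
Qed.

Lemma size_eval0_rep : (size eval0_rep <= n.+1)%N.
Proof.
rewrite /eval0_rep; apply: leq_trans (size_scale_leq _ _) _.
apply/leq_sizeP => j Hj; rewrite coef_derivn.
by have /leq_sizeP -> := size_radau_wt; rewrite ?mul0rn //; lia.
Qed.

Lemma derivn_eval0_rep_gt (m : nat) : (n < m)%N -> eval0_rep^`(m) = 0.
Proof.
move=> nm; apply/polyP => i; rewrite coef_derivn coef0.
by have /leq_sizeP -> := size_eval0_rep; rewrite ?mul0rn //; lia.
Qed.

Lemma derivn_eval0_rep_n : eval0_rep^`(n) = ((-1) ^+ n * ((2 * n).+1)`!%:R / n`!%:R)%:P.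
Proof.
apply/polyP => i; rewrite coef_derivn coefC; case: i => [|i] /=; last first.
  by have /leq_sizeP -> := size_eval0_rep; rewrite ?mul0rn //; lia.
rewrite addn0 coef_eval0_rep binn ffactnn.
have E : ((n.+1 + n) ^_ n.+1)%:R = ((2 * n).+1)`!%:R / n`!%:R :> R.
  apply: (mulIf (factR_neq0 n)); rewrite mulfVK ?factR_neq0 // -natrM.
  by have := ffact_fact (leq_addr n n.+1); rewrite addKn => ->; congr (_`!%:R); lia.
rewrite E -mulr_natr exprS; field; exact: factR_neq0.
Qed.

(** [coefQ] in the field structure of [R]. *)
Definition qcoef (i : nat) :=
  ((2 * n + 1 - i)`!%:R * (n + 1)`!%:R : (R : fieldType)) /
  ((2 * n + 1)`!%:R * i`!%:R * (n + 1 - i)`!%:R).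

Lemma qcoef_last : qcoef n.+1 = n`!%:R / ((2 * n).+1)`!%:R.
Proof.
rewrite /qcoef (_ : n + 1 - n.+1 = 0)%N; last by lia.
rewrite (_ : 2 * n + 1 - n.+1 = n)%N; last by lia.
rewrite !addn1 fact0 mulr1.
by rewrite -mulf_div divff ?mulr1 ?factR_neq0.
Qed.

(** This ties the discretized transport equation to [padeQ]: the Taylor
    coefficients of the representative at [0] are the coefficients of [padeQ n]
    in reverse order. *)
Lemma qcoef_eval0_rep (m : nat) : (m <= n)%N ->
  qcoef n.+1 * (-1) ^+ m * m`!%:R * eval0_rep`_m = qcoef (n - m).
Proof.
move=> mn; rewrite coef_eval0_rep qcoef_last /qcoef.
have -> : (2 * n + 1 - (n - m) = n.+1 + m)%N by lia.
have -> : (n + 1 - (n - m) = m.+1)%N by lia.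
have E1 : ((n.+1 + m) ^_ n.+1)%:R = (n.+1 + m)`!%:R / m`!%:R :> R.
  apply: (mulIf (factR_neq0 m)); rewrite mulfVK ?factR_neq0 // -natrM.
  by have := ffact_fact (leq_addr m n.+1); rewrite addKn => ->.
have E2 : 'C(n.+1, m.+1)%:R = n.+1`!%:R / (m.+1`!%:R * (n - m)`!%:R) :> R.
  have nz : (m.+1`!%:R * (n - m)`!%:R) != 0 :> R by rewrite mulf_neq0 ?factR_neq0.
  apply: (mulIf nz); rewrite mulfVK // -!natrM.
  by have := @bin_fact n.+1 m.+1 mn; rewrite subSS => ->.
rewrite E1 E2 !addn1 exprS.
have S : (-1) ^+ m * (-1) ^+ m = 1 :> R by rewrite -expr2 sqrr_sign.
have e0 : (-1) ^+ m != 0 :> R by rewrite signr_eq0.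
move: ((-1) ^+ m) S e0 => e S e0; apply/eqP; rewrite -subr_eq0; apply/eqP.
set G := (X in _ - X).
rewrite -[G]mul1r -S /G.
by field; rewrite e0 !factR_neq0.
Qed.

End Lift.

(** * The storage form and its dissipation identity *)

Lemma derivn_add (m k : nat) (p : {poly R}) : p^`(k)^`(m) = p^`(m + k).
Proof. by rewrite /derivn iterD. Qed.

Lemma horner_1subX (x : R) : (1 - 'X : {poly R}).[x] = 1 - x.
Proof. by rewrite hornerD hornerN hornerX -polyC1 hornerC. Qed.

Section Storage.
Variable n : nat.

(** The state that belongs to the derivative of order [i] of a solution [psi] of
    [sum_i q_i psi^(i) = u]; with these vectors the scalar equation of order [n + 1]
    becomes the transport equation, see [state_poly_shift]. *)
Definition state_basis (i : nat) : {poly R} :=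
  (qcoef n n.+1 * (-1) ^+ (n - i)) *: (eval0_rep n)^`(n - i).

Definition state_poly (a : nat -> R) : {poly R} := \sum_(i < n.+1) a i *: state_basis i.

Lemma deriv_state_basis0 : (state_basis 0)^`() = 0.
Proof. by rewrite /state_basis subn0 derivZ -derivnS derivn_eval0_rep_gt // scaler0. Qed.

Lemma deriv_state_basisS (i : nat) : (i < n)%N -> (state_basis i.+1)^`() = - state_basis i.
Proof.
move=> Hi; rewrite /state_basis derivZ -derivnS (_ : (n - i.+1).+1 = n - i)%N; last by lia.
rewrite (_ : (n - i) = (n - i.+1).+1)%N; last by lia.
by rewrite exprS mulrCA mulN1r scaleNr opprK.
Qed.

Lemma state_basis_last : state_basis n = qcoef n n.+1 *: eval0_rep n.
Proof. by rewrite /state_basis subnn expr0 mulr1 derivn0. Qed.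

(** The transport equation: if [a] lists the derivatives of [psi], its shift lists
    those of the derivative of [psi]. *)
Lemma state_poly_shift (a : nat -> R) :
  state_poly (fun i => a i.+1) = (qcoef n n.+1 * a n.+1) *: eval0_rep n - (state_poly a)^`().
Proof.
rewrite /state_poly big_ord_recr /= state_basis_last raddf_sum /= [in RHS]big_ord_recl /=.
rewrite derivZ deriv_state_basis0 scaler0 add0r addrC scalerA mulrC; congr (_ + _).
rewrite -sumrN; apply: eq_bigr => i _.
by rewrite derivZ deriv_state_basisS // scalerN opprK.
Qed.

(** Together with the last term [q_(n + 1) a_(n + 1)], the jump, this makes up the
    inflow. *)
Lemma state_poly_at0 (a : nat -> R) : (state_poly a).[0] = \sum_(i < n.+1) qcoef n i * a i.
Proof.
rewrite /state_poly horner_sum; apply: eq_bigr => i _.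
rewrite hornerZ /state_basis hornerZ horner_coef0 coef_derivn addn0 ffactnn mulrC.
congr (_ * _); have Hi : (n - i <= n)%N by lia.
have <- : (n - (n - i) = i)%N by have := ltn_ord i; lia.
rewrite -(qcoef_eval0_rep _ _ Hi) (_ : n - (n - (n - i)) = n - i)%N; last by lia.
by rewrite -mulrA mulr_natl.
Qed.

Lemma derivn_state_poly (a : nat -> R) : (state_poly a)^`(n) = ((-1) ^+ n * a n)%:P.
Proof.
rewrite /state_poly big_ord_recr /= derivnD raddf_sum /= big1 ?add0r.
  rewrite derivnZ state_basis_last derivnZ derivn_eval0_rep_n qcoef_last -!mul_polyC -!polyCM.
  congr (_%:P); have := factR_neq0 n; have := factR_neq0 ((2 * n).+1).
  by move: (n`!%:R : R) (((2 * n).+1)`!%:R : R) => x y y0 x0; field; rewrite x0 y0.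
move=> i _; rewrite derivnZ /state_basis derivnZ derivn_add.
by rewrite derivn_eval0_rep_gt ?scaler0 //; have := ltn_ord i; lia.
Qed.

Lemma derivn_1subX_mul (m : nat) (p : {poly R}) :
  ((1 - 'X) * p)^`(m.+1) = (1 - 'X) * p^`(m.+1) - m.+1%:R *: p^`(m).
Proof.
elim: m => [|m IH].
  rewrite !derivn1 derivn0 derivM derivB derivX -polyC1 derivC scale1r.
  by rewrite polyC1 sub0r mulN1r addrC.
rewrite derivnS IH derivB derivM derivB derivX -polyC1 derivC derivZ -!derivnS.
by rewrite polyC1 sub0r mulN1r -!mul_polyC !polyC_natr -[m.+2%:R]natr1; ring.
Qed.

(** The weight is the one for which the square of [a n], the leading coefficient of
    the state up to a factor, absorbs the defect of the multiplier, see
    [int01_eval0_rep_1subX_state_poly]. *)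
Definition lead_penalty := qcoef n n.+1 * n.+1%:R / n`!%:R * int01 (radau_wt n).

(** The first term is the energy of the state weighted by the distance that is left
    to the outflow. *)
Definition storage_form (a b : nat -> R) :=
  int01 ((1 - 'X) * state_poly a * state_poly b) + lead_penalty * (a n * b n).

(** [(1 - X) * state_poly a] has degree [n + 1], one too many for the reproducing
    property; the defect is proportional to [a n]. *)
Lemma int01_eval0_rep_1subX_state_poly (a : nat -> R) :
  int01 (eval0_rep n * ((1 - 'X) * state_poly a)) =
  (state_poly a).[0] - n.+1%:R / n`!%:R * int01 (radau_wt n) * a n.
Proof.
rewrite int01_eval0_rep derivn_1subX_mul derivnS derivn_state_poly derivC mulr0 sub0r mulNr int01N.
rewrite -scalerAl int01Z mul_polyC int01Z hornerM horner_1subX subr0 mul1r.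
have S : (-1) ^+ n * (-1) ^+ n = 1 :> R by rewrite -expr2 sqrr_sign.
have := factR_neq0 n.
move: (n`!%:R : R) ((-1) ^+ n) S (n.+1%:R : R) => f e S m f0.
have -> : m / f * int01 (radau_wt n) * a n = (e * e) * (m / f * int01 (radau_wt n) * a n).
  by rewrite S mul1r.
by field.
Qed.

(** With [x] the state and [j] the jump, the transport equation gives the derivative
    [x (0) ^ 2 - int x ^ 2 + 2 j x (0)] for the energy with the weight [1 - X], up to
    the defect of the representative.  That defect is [a n * a n.+1] times a constant,
    which is the derivative of a square, and it is moved into the form.  The inflow
    is [x (0) + j]. *)
Lemma storage_form_shift (a : nat -> R) :
  2 * storage_form a (fun i => a i.+1) =
  (\sum_(i < n.+2) qcoef n i * a i) ^+ 2 - (qcoef n n.+1 * a n.+1) ^+ 2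
  - int01 (state_poly a ^+ 2).
Proof.
rewrite big_ord_recr /= -state_poly_at0 /storage_form state_poly_shift mulrBr int01B /lead_penalty.
set j := qcoef n n.+1 * a n.+1; set x := state_poly a.
have -> : (1 - 'X) * x * (j *: eval0_rep n) = j *: (eval0_rep n * ((1 - 'X) * x)).
  by rewrite -!mul_polyC; ring.
rewrite int01Z int01_eval0_rep_1subX_state_poly -/x.
have D : 2 * int01 ((1 - 'X) * x * x^`()) = - x.[0] ^+ 2 + int01 (x ^+ 2).
  have := int01_deriv ((1 - 'X) * x ^+ 2).
  have -> : ((1 - 'X) * x ^+ 2)^`() = 2 *: ((1 - 'X) * x * x^`()) - x ^+ 2.
    rewrite derivM derivB derivX -polyC1 derivC polyC1 expr2 derivM -mul_polyC polyC_natr.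
    by move: x^`() => d; ring.
  rewrite int01B int01Z !hornerM !horner_1subX subrr mul0r subr0 mul1r => E; lra.
rewrite mulrDr mulrBr D /j.
have := factR_neq0 n.
move: (n`!%:R : R) (qcoef n n.+1) (n.+1%:R : R) (int01 (radau_wt n)) => f q m w f0.
by field.
Qed.

Lemma int01_radau_wt_gt0 : 0 < int01 (radau_wt n).
Proof.
apply: lt_le_trans (_ : int01 (rho ^+ n.+1) <= _).
  rewrite int01_rho divr_gt0 ?exprn_gt0 // ltr0n fact_gt0 //.
apply: le_int01 => x x0 x1; rewrite /radau_wt exprSr !hornerM horner_1subX horner_exp horner_rho; apply: ler_wpM2l.
  by rewrite exprn_ge0 // mulr_ge0 // subr_ge0.
rewrite hornerX ler_piMl //; lra.
Qed.

Lemma lead_penalty_gt0 : 0 < lead_penalty.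
Proof.
rewrite /lead_penalty qcoef_last !mulr_gt0 ?invr_gt0 ?ltr0n ?fact_gt0 //; exact: int01_radau_wt_gt0.
Qed.

Lemma storage_form_lower (a : nat -> R) : lead_penalty * a n ^+ 2 <= storage_form a a.
Proof.
rewrite /storage_form -expr2 lerDr; apply: int01_ge0 => x x0 x1.
by rewrite -mulrA -expr2 hornerM horner_exp horner_1subX mulr_ge0 ?sqr_ge0 ?subr_ge0.
Qed.

(** Up to a factor, [(rho ^+ m)^`(m)] is the Legendre polynomial of degree [m] of the
    interval. *)
Lemma int01_Legendre (m : nat) : int01 ((rho ^+ m)^`(m) ^+ 2) = (2 * m)`!%:R * int01 (rho ^+ m).
Proof.
rewrite expr2 -{2}[rho ^+ m]mulr1 int01_parts_iter mulr1 derivn_add addnn -mul2n.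
have -> : (rho ^+ m)^`(2 * m) = ((-1) ^+ m * (2 * m)`!%:R)%:P.
  have E : rho ^+ m = 'X^m * (1 - 'X) ^+ m by rewrite exprMn.
  have S : (size (rho ^+ m) <= (2 * m).+1)%N.
    apply: leq_trans (size_poly_exp_leq _ _) _.
    have -> : size rho = 3%N.
      rewrite /rho mulrC size_mulX; first by rewrite -opprB size_polyN size_XsubC.
      by rewrite -opprB oppr_eq0 polyXsubC_eq0.
    by rewrite /=.
  apply/polyP => i; rewrite coef_derivn coefC; case: i => [|i] /=; last first.
    by have /leq_sizeP -> := S; rewrite ?mul0rn //; lia.
  rewrite addn0 ffactnn E mul2n -addnn coefXnM ltnNge leq_addr /= addKn.
  by rewrite coef_1subX_exp binn mulr1 mulr_natr.
by rewrite mul_polyC int01Z mulrA mulrA -expr2 sqrr_sign mul1r.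
Qed.

(** The scalar product with the Legendre polynomial of degree [n] picks the leading
    coefficient of the state, so that the Cauchy-Schwarz inequality bounds it. *)
Lemma lead_penalty_upper (a : nat -> R) : lead_penalty * a n ^+ 2 <= int01 (state_poly a ^+ 2).
Proof.
set E := int01 _.
have r0 : 0 < int01 (rho ^+ n).
  by rewrite int01_rho divr_gt0 ?exprn_gt0 // ltr0n fact_gt0.
have E0 : 0 <= E by apply: int01_ge0 => x _ _; rewrite horner_exp sqr_ge0.
have C : a n ^+ 2 * int01 (rho ^+ n) <= (2 * n)`!%:R * E.
  have := int01_CS (state_poly a) ((rho ^+ n)^`(n)).
  rewrite int01_Legendre -{1}[rho ^+ n]mulr1 int01_parts_iter mulr1 derivn_state_poly mul_polyC int01Z.
  rewrite -/E !mulrA -expr2 sqrr_sign mul1r exprMn [int01 _ ^+ 2]expr2 mulrA.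
  by rewrite ler_pM2r // [E * _]mulrC.
have W : int01 (radau_wt n) <= int01 (rho ^+ n).
  apply: le_int01 => x x0 x1; rewrite /radau_wt hornerM horner_exp horner_rho horner_1subX.
  rewrite ler_piMr ?exprn_ge0 ?mulr_ge0 ?subr_ge0 //; lra.
rewrite /lead_penalty qcoef_last.
apply: le_trans (_ : n`!%:R / ((2 * n).+1)`!%:R * n.+1%:R / n`!%:R * (a n ^+ 2 * int01 (rho ^+ n)) <= _).
  rewrite -mulrA [int01 (radau_wt n) * _]mulrC; apply: ler_wpM2l.
    by rewrite !mulr_ge0 ?invr_ge0.
  by apply: ler_wpM2l => //; exact: sqr_ge0.
apply: le_trans (_ : n`!%:R / ((2 * n).+1)`!%:R * n.+1%:R / n`!%:R * ((2 * n)`!%:R * E) <= _).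
  by apply: ler_wpM2l C; rewrite !mulr_ge0 ?invr_ge0.
have -> : n`!%:R / ((2 * n).+1)`!%:R * n.+1%:R / n`!%:R * ((2 * n)`!%:R * E) =
   (n.+1%:R / (2 * n).+1%:R) * E.
  rewrite factS natrM; have := factR_neq0 n; have := factR_neq0 (2 * n).
  have : (2 * n).+1%:R != 0 :> R by rewrite pnatr_eq0.
  move: ((2 * n).+1%:R : R) ((2 * n)`!%:R : R) (n`!%:R : R) (n.+1%:R : R).
  by move=> x y z t x0 y0 z0; field; rewrite x0 y0 z0.
rewrite ler_piMl // ler_pdivrMr ?ltr0n // mul1r ler_nat; lia.
Qed.

Lemma storage_form_upper (a : nat -> R) : storage_form a a <= 2 * int01 (state_poly a ^+ 2).
Proof.
have := lead_penalty_upper a; rewrite /storage_form -expr2 => H.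
have : int01 ((1 - 'X) * state_poly a * state_poly a) <= int01 (state_poly a ^+ 2).
  apply: le_int01 => x x0 x1; rewrite -mulrA -expr2 hornerM horner_exp horner_1subX.
  by rewrite ler_piMl ?sqr_ge0 //; lra.
lra.
Qed.

(** The matrix of [storage_form], which lets finite sums of reals stand for it. *)
Definition storage_mx (i l : nat) :=
  int01 ((1 - 'X) * state_basis i * state_basis l) + lead_penalty * ((i == n)%:R * (l == n)%:R).

Lemma storage_mx_sym (i l : nat) : storage_mx i l = storage_mx l i.
Proof. by rewrite /storage_mx mulrAC [(i == n)%:R * _]mulrC. Qed.

Lemma int01_sum (m : nat) (F : 'I_m -> {poly R}) : int01 (\sum_(i < m) F i) = \sum_(i < m) int01 (F i).
Proof. exact: (big_morph int01 int01D int01_0). Qed.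

Lemma storage_form_mx (a b : nat -> R) :
  storage_form a b = \sum_(i < n.+1) \sum_(l < n.+1) storage_mx i l * (a i * b l).
Proof.
have -> : \sum_(i < n.+1) \sum_(l < n.+1) storage_mx i l * (a i * b l) =
  (\sum_(i < n.+1) \sum_(l < n.+1) int01 ((1 - 'X) * ((a i *: state_basis i) * (b l *: state_basis l))))
  + (\sum_(i < n.+1) \sum_(l < n.+1) lead_penalty * (((i == n :> nat)%:R * a i) * ((l == n :> nat)%:R * b l))).
  rewrite -big_split; apply: eq_bigr => i _; rewrite -big_split; apply: eq_bigr => l _ /=.
  rewrite /storage_mx mulrDl; congr (_ + _); last by ring.
  move: (state_basis i) (state_basis l) (a i) (b l) => p q u v.
  rewrite -scalerAl -!scalerAr !int01Z -[_ * p * q]mulrA; ring.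
rewrite /storage_form -[_ * state_poly a * _]mulrA /state_poly big_distrlr mulr_sumr int01_sum; congr (_ + _).
  by apply: eq_bigr => i _; rewrite mulr_sumr int01_sum.
have D (c : nat -> R) : \sum_(i < n.+1) (i == n :> nat)%:R * c i = c n.
  rewrite big_ord_recr /= eqxx mul1r big1 ?add0r // => i _.
  by rewrite ltn_eqF ?mul0r.
under eq_bigr => i _ do rewrite -mulr_sumr -mulr_sumr D.
by rewrite -mulr_sumr -mulr_suml D.
Qed.

End Storage.

(** * The norms of the derivatives of [rho ^+ n * X] *)

(** Once a log-convex sequence increases, it goes on increasing; so a value above [B]
    after [b 0] would force [b n] above [B] as well. *)
Lemma log_convex_le (b : nat -> R) (n : nat) (B : R) :
  (forall m, 0 <= b m) ->
  (forall m, (m.+2 <= n)%N -> b m.+1 ^+ 2 <= b m * b m.+2) ->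
  b 0%N <= B -> b n <= B -> forall m, (m <= n)%N -> b m <= B.
Proof.
move=> b0 lc B0 Bn.
have inc m : b m < b m.+1 -> forall j, (m + j < n)%N -> b (m + j)%N < b (m + j).+1.
  move=> Hm; elim=> [|j IH] H; first by rewrite addn0.
  rewrite addnS in H *; have {}IH := IH (ltnW H).
  have := lc _ H; move: (b0 (m + j)%N) IH.
  move: (b (m + j)%N) (b (m + j).+1) (b (m + j).+2) => x y z x0 xy yz.
  rewrite ltNge; apply/negP => zy.
  have : x * z <= x * y by apply: ler_wpM2l.
  have : x * y < y ^+ 2 by rewrite expr2 ltr_pM2r //; exact: le_lt_trans xy.
  by move=> H1 H2; have := lt_le_trans (le_lt_trans H2 H1) yz; rewrite ltxx.
elim=> [//|m IH] mn; rewrite leNgt; apply/negP => Hm.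
have {}IH := IH (ltnW mn).
have H j : (m.+1 + j <= n)%N -> B < b (m.+1 + j)%N.
  elim: j => [|j IHj] H; first by rewrite addn0.
  rewrite addnS; apply: lt_trans (IHj _) _; first by lia.
  by rewrite addSnnS; apply: inc; [exact: le_lt_trans Hm|lia].
by have := H (n - m.+1)%N; rewrite subnKC // leqnn => /(_ isT); rewrite ltNge Bn.
Qed.

Section KernelPoly.
Variable n : nat.

(** [X ^ (n + 1) (1 - X) ^ n]. *)
Definition kerpoly : {poly R} := rho ^+ n * 'X.

Lemma derivn_kerpoly_vanish (m : nat) (x : R) : (m < n)%N -> rho.[x] = 0 -> (kerpoly^`(m)).[x] = 0.
Proof.
move=> mn rx; have [r E] := derivn_exp_mul (n - m) m rho 'X.
rewrite subnK in E; last exact: ltnW.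
rewrite /kerpoly E hornerM horner_exp rx expr0n subn_eq0 leqNgt mn mul0r //.
Qed.

(** The integral of [p' ^ 2] is minus that of [p p''] when [p] vanishes at both ends;
    conclude by the Cauchy-Schwarz inequality. *)
Lemma kerpoly_log_convex (m : nat) : (m < n)%N ->
  int01 (kerpoly^`(m.+1) ^+ 2) ^+ 2 <= int01 (kerpoly^`(m) ^+ 2) * int01 (kerpoly^`(m.+2) ^+ 2).
Proof.
move=> mn.
have -> : int01 (kerpoly^`(m.+1) ^+ 2) = - int01 (kerpoly^`(m.+2) * kerpoly^`(m)).
  rewrite expr2 {2}[kerpoly^`(m.+1)]derivnS int01_parts; first by rewrite -derivnS.
    by apply: derivn_kerpoly_vanish => //; rewrite horner_rho mul0r.
  by apply: derivn_kerpoly_vanish => //; rewrite horner_rho subrr mulr0.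
by rewrite sqrrN mulrC; exact: int01_CS.
Qed.

(** From [X = (1 - rho') / 2] follows
    [kerpoly = (rho ^ n - (rho ^ (n + 1))' / (n + 1)) / 2]: the derivative of order [n]
    is half the difference of two consecutive Legendre polynomials. *)
Lemma int01_derivn_kerpoly : int01 (kerpoly^`(n) ^+ 2) <= n`!%:R ^+ 2 / (2 * n).+1%:R.
Proof.
have K : kerpoly = 2^-1 *: (rho ^+ n - n.+1%:R^-1 *: (rho ^+ n.+1)^`()).
  rewrite deriv_exp /= -scaler_nat.
  have -> : rho^`() = 1 - 2 *: 'X.
    by rewrite /rho derivM derivB derivX -polyC1 derivC -mul_polyC polyC_natr polyC1; ring.
  rewrite scalerA mulVf ?scale1r ?pnatr_eq0 // /kerpoly.
  move: (rho ^+ n) => r; rewrite mulrBl mul1r opprB addrCA subrr addr0.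
  by rewrite -scalerAl scalerA mulVf ?scale1r ?pnatr_eq0 // mulrC.
have -> : kerpoly^`(n) = 2^-1 *: ((rho ^+ n)^`(n) - n.+1%:R^-1 *: (rho ^+ n.+1)^`(n.+1)).
  by rewrite K derivnZ derivnB derivnZ -derivSn.
set p := (rho ^+ n)^`(n); set q := n.+1%:R^-1 *: _.
apply: le_trans (_ : int01 (2^-1 *: (p ^+ 2 + q ^+ 2)) <= _).
  apply: le_int01 => x _ _; move: p q => {}p {}q; rewrite !(hornerZ, horner_exp, hornerD, hornerN).
  move: p.[x] q.[x] => u v; rewrite -subr_ge0.
  have -> : 2^-1 * (u ^+ 2 + v ^+ 2) - (2^-1 * (u - v)) ^+ 2 = (2^-1 * (u + v)) ^+ 2.
    by field.
  exact: sqr_ge0.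
rewrite int01Z int01D /p /q exprZn int01Z !int01_Legendre !int01_rho.
rewrite (_ : 2 * n.+1 = (2 * n).+2)%N; last by lia.
rewrite !factS !natrM.
have f0 := factR_neq0 (2 * n).
have a0 : (2 * n).+1%:R != 0 :> R by rewrite pnatr_eq0.
have b0 : (2 * n).+2%:R != 0 :> R by rewrite pnatr_eq0.
have c0 : (2 * n).+3%:R != 0 :> R by rewrite pnatr_eq0.
have d0 : n.+1%:R != 0 :> R by rewrite pnatr_eq0.
have -> : 2^-1 * ((2 * n)`!%:R * (n`!%:R ^+ 2 / ((2 * n).+1%:R * (2 * n)`!%:R)) +
  n.+1%:R^-1 ^+ 2 * ((2 * n).+2%:R * ((2 * n).+1%:R * (2 * n)`!%:R) * ((n.+1%:R * n`!%:R) ^+ 2 / ((2 * n).+3%:R * ((2 * n).+2%:R * ((2 * n).+1%:R * (2 * n)`!%:R)))))) =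
  n`!%:R ^+ 2 * (2^-1 * ((2 * n).+1%:R^-1 + (2 * n).+3%:R^-1)) :> R.
  move: ((2 * n)`!%:R : R) ((2 * n).+1%:R : R) ((2 * n).+2%:R : R) ((2 * n).+3%:R : R) (n.+1%:R : R) (n`!%:R : R) f0 a0 b0 c0 d0.
  by move=> f a b c d g f0 a0 b0 c0 d0; field; rewrite f0 a0 b0 c0 d0.
apply: ler_wpM2l; first exact: sqr_ge0.
have : (2 * n).+3%:R^-1 <= (2 * n).+1%:R^-1 :> R.
  by rewrite lef_pV2 ?posrE ?ltr0n // ler_nat; lia.
by move: ((2 * n).+3%:R^-1 : R) ((2 * n).+1%:R^-1 : R) => u v; lra.
Qed.

(** From [n] to [n + 1] the left side grows by at most
    [(2 n + 3) / (2 n + 1) * 9 (n + 1) ^ 2], by [pow_succ_le_3], and the right side by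
    [16 (n + 1) ^ 2]. *)
Lemma pow_le_fact : (0 < n)%N ->
  (2 * n).+1%:R * n.+1%:R ^+ (2 * n) <= 16 ^+ n * n`!%:R ^+ 2 :> R.
Proof.
elim: n => [//|m IH] _.
have [->|m0] := posnP m; first by rewrite -!natrX -!natrM ler_nat.
have {}IH := IH m0.
have /RleP : Rle (pow (Rplus (INR m.+1) (IZR 1)) m.+1) (Rmult (IZR 3) (pow (INR m.+1) m.+1)).
  exact: pow_succ_le_3 (PeanoNat.Nat.lt_0_succ m).
rewrite !RpowE !INRE RplusE RmultE natr1 => H.
have H2 : m.+2%:R ^+ (2 * m.+1) <= 9 * (m.+1%:R ^+ 2 * m.+1%:R ^+ (2 * m)) :> R.
  rewrite -exprD (_ : 2 + 2 * m = m.+1 * 2)%N ?(mulnC 2) ?exprM; last by lia.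
  have -> : 9 * (m.+1%:R ^+ m.+1) ^+ 2 = (3 * m.+1%:R ^+ m.+1) ^+ 2 :> R by ring.
  by rewrite lerXn2r ?nnegrE ?mulr_ge0 ?exprn_ge0.
have -> : (2 * m.+1).+1%:R = 2 * m%:R + 3 :> R.
  have -> : ((2 * m.+1).+1 = 2 * m + 3)%N by lia.
  by rewrite natrD natrM.
have E : (2 * m).+1%:R = 2 * m%:R + 1 :> R by rewrite -natr1 natrM.
rewrite E in IH.
have m1 : 1 <= m%:R :> R by rewrite ler1n.
apply: le_trans (_ : (2 * m%:R + 3) * (9 * (m.+1%:R ^+ 2 * m.+1%:R ^+ (2 * m))) <= _).
  by apply: ler_wpM2l H2; lra.
apply: le_trans (_ : 16 * m.+1%:R ^+ 2 * ((2 * m%:R + 1) * m.+1%:R ^+ (2 * m)) <= _).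
  rewrite mulrCA mulrA [leRHS]mulrACA.
  by rewrite ler_wpM2r ?mulr_ge0 ?exprn_ge0 //; lra.
rewrite factS natrM exprMn [16 ^+ m.+1]exprS.
rewrite [leRHS]mulrACA.
by rewrite ler_wpM2l ?mulr_ge0 ?exprn_ge0.
Qed.

Lemma int01_kerpoly_sq : int01 (kerpoly ^+ 2) <= (16 ^+ n)^-1.
Proof.
rewrite -[leRHS]int01_const; apply: le_int01 => x x0 x1.
rewrite hornerC /kerpoly horner_exp hornerM horner_exp hornerX horner_rho.
rewrite exprMn -exprM mulnC exprM -exprVn.
apply: le_trans (_ : ((x * (1 - x)) ^+ 2) ^+ n <= _).
  apply: ler_piMr; [exact/exprn_ge0/sqr_ge0|exact: exprn_ile1].
rewrite lerXn2r ?nnegrE ?sqr_ge0 ?invr_ge0 //.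
have -> : 16^-1 = (4^-1) ^+ 2 :> R by rewrite exprVn; congr (_^-1); ring.
rewrite lerXn2r ?nnegrE ?invr_ge0 ?mulr_ge0 ?subr_ge0 //.
have := sqr_ge0 (x - 2^-1); rewrite expr2 => H; lra.
Qed.

(** The sequence in [m] is log-convex because the powers of [n + 1] form a geometric
    sequence.  The end [m = n] is [int01_derivn_kerpoly]; at [m = 0] the bound
    [rho <= 1 / 4] is enough. *)
Lemma int01_derivn_kerpoly_le (m : nat) : (0 < n)%N -> (m <= n)%N ->
  n.+1%:R ^+ (2 * (n - m)).+1 * int01 (kerpoly^`(m) ^+ 2) <= 2 / 3 * n`!%:R ^+ 2.
Proof.
move=> n0 mn.
have N0 : 0 < n.+1%:R :> R by rewrite ltr0n.
have nn : 1 <= n%:R :> R by rewrite ler1n.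
have E1 : n.+1%:R = n%:R + 1 :> R by rewrite -natr1.
have E2 : (2 * n).+1%:R = 2 * n%:R + 1 :> R by rewrite -natr1 natrM.
pose b m := n.+1%:R ^+ (2 * n).+1 / n.+1%:R ^+ (2 * m) * int01 (kerpoly^`(m) ^+ 2).
have be j : (j <= n)%N -> b j = n.+1%:R ^+ (2 * (n - j)).+1 * int01 (kerpoly^`(j) ^+ 2).
  move=> jn; congr (_ * _).
  have -> : ((2 * n).+1 = (2 * (n - j)).+1 + 2 * j)%N by lia.
  by rewrite exprD mulfK // expf_neq0 // lt0r_neq0.
rewrite -be //.
apply: (@log_convex_le b n) => // [j|j jn||].
- rewrite /b !mulr_ge0 ?invr_ge0 ?exprn_ge0 //.
  by apply: int01_ge0 => x _ _; rewrite horner_exp sqr_ge0.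
- rewrite !be ?exprMn -?exprM; try by lia.
  apply: le_trans (_ : n.+1%:R ^+ ((2 * (n - j.+1)).+1 * 2) * (int01 (kerpoly^`(j) ^+ 2) * int01 (kerpoly^`(j.+2) ^+ 2)) <= _).
    by rewrite ler_wpM2l ?exprn_ge0 // kerpoly_log_convex //; lia.
  rewrite [leRHS]mulrACA -exprD.
  by rewrite (_ : (2 * (n - j)).+1 + (2 * (n - j.+2)).+1 = (2 * (n - j.+1)).+1 * 2)%N //; lia.
- rewrite be // subn0 derivn0.
  apply: le_trans (_ : n.+1%:R ^+ (2 * n).+1 * (16 ^+ n)^-1 <= _).
    by rewrite ler_wpM2l ?exprn_ge0 // int01_kerpoly_sq.
  rewrite ler_pdivrMr ?exprn_gt0 // exprS.
  have := pow_le_fact n0; rewrite E2 E1.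
  have P0 : 0 <= (n%:R + 1) ^+ (2 * n) :> R by rewrite exprn_ge0 //; lra.
  rewrite (mulrC (16 ^+ n)) -(mulrA (2 / 3)).
  move: ((n%:R + 1) ^+ (2 * n) : R) P0 (n`!%:R ^+ 2 * 16 ^+ n : R) => P P0 F H.
  have : 0 <= (n%:R - 1) * P by apply: mulr_ge0 => //; lra.
  lra.
rewrite be // subnn muln0 expr1.
apply: le_trans (_ : n.+1%:R * (n`!%:R ^+ 2 / (2 * n).+1%:R) <= _).
  by rewrite ler_wpM2l // int01_derivn_kerpoly.
rewrite mulrCA [leRHS]mulrC; apply: ler_wpM2l; first exact: sqr_ge0.
rewrite ler_pdivrMr ?ltr0n // E2 E1; lra.
Qed.

End KernelPoly.

(** * The polynomial facts in terms of finite sums of reals *)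

Lemma sum_n_big (f : nat -> R) (n : nat) : sum_n f n = \sum_(i < n.+1) f i.
Proof.
elim: n => [|n IH]; first by rewrite sum_O big_ord_recr big_ord0 /= add0r.
by rewrite sum_Sn big_ord_recr /= IH.
Qed.

Lemma coefQE (n i : nat) : coefQ n i = qcoef n i.
Proof. by rewrite /coefQ /qcoef RdivE !RmultE !INRE !factE. Qed.

Lemma bilinE (n : nat) (a b : nat -> R) : bilin (storage_mx n) n a b = storage_form n a b.
Proof.
rewrite storage_form_mx /bilin sum_n_big; apply: eq_bigr => i _.
by rewrite sum_n_big.
Qed.

Lemma kerpolyE (n : nat) (s : R) : (kerpoly n).[s] = Rmult (pow (Rmult s (Rminus (IZR 1) s)) n) s.
Proof. by rewrite /kerpoly hornerM horner_exp horner_rho hornerX RpowE. Qed.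

(** A polynomial of degree at most [n] with [n + 1] zeros vanishes. *)
Lemma poly_coef_zero (n : nat) (c : nat -> R) :
  (forall k : nat, \sum_(i < n.+1) c i * k%:R ^+ i = 0) ->
  forall i, (i <= n)%N -> c i = 0.
Proof.
move=> H i Hi; set p := \poly_(i < n.+1) c i.
suff p0 : p = 0 by have := coef_poly n.+1 c i; rewrite -/p p0 coef0 ltnS Hi.
apply/eqP; apply/negPn/negP => pn0.
pose rs : seq R := [seq k%:R | k <- iota 0 n.+1].
have := max_poly_roots pn0 (rs := rs).
have -> : all (root p) rs.
  apply/allP => x /mapP [k _ ->]; rewrite /root horner_poly; apply/eqP; exact: H.
have -> : uniq rs.
  by rewrite map_inj_uniq ?iota_uniq // => x y /eqP; rewrite eqr_nat => /eqP.
rewrite size_map size_iota => /(_ isT isT); rewrite ltnNge => /negP; apply.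
exact: size_poly.
Qed.

Local Open Scope R_scope.

(** The dissipation inequality in the form in which it is used below: for a list [a] of
    derivatives, [2 * bilin m n a (shift of a)] is the derivative of [bilin m n a a]. *)
Lemma storage (n : nat) :
  exists (m : nat -> nat -> R) (kappa : R),
  0 < kappa /\ (forall i l, m i l = m l i) /\
  (forall a, kappa * a n ^ 2 <= bilin m n a a) /\
  (forall a, 2 * bilin m n a (fun i => a (S i)) <=
    sum_n (fun i => coefQ n i * a i) (S n) ^ 2 - (coefQ n (S n) * a (S n)) ^ 2
    - bilin m n a a / 2).
Proof.
exists (storage_mx n), (lead_penalty n); split; last split; last split.
- exact/RltP/lead_penalty_gt0.
- exact: storage_mx_sym.
- by move=> a; rewrite bilinE RpowE; apply/RleP; exact: storage_form_lower.
- move=> a; rewrite !bilinE; apply/RleP.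
  have -> : sum_n (fun i => coefQ n i * a i) (S n) = (\sum_(i < n.+2) qcoef n i * a i)%R.
    by rewrite sum_n_big; apply: eq_bigr => i _; rewrite coefQE.
  rewrite coefQE RdivE !RpowE !RmultE !RminusE IZR_2_INR INRE.
  by have := storage_form_shift n a; have := storage_form_upper n a; lra.
Qed.

Lemma kernel_poly_norms (n : nat) : (1 <= n)%coq_nat ->
  exists h : nat -> R -> R,
  (forall s, h O s = (s * (1 - s)) ^ n * s) /\
  (forall m s, is_derive (h m) s (h (S m) s)) /\
  (forall m, (m <= n)%coq_nat ->
     INR (S n) ^ (Nat.add (Nat.mul 2 (Nat.sub n m)) 1) * RInt (fun s => h m s ^ 2) 0 1
     <= 2 / 3 * INR (fact n) ^ 2).
Proof.
move=> n1; exists (fun m s => ((kerpoly n)^`(m)).[s]%R); split; last split.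
- by move=> s; rewrite derivn0 kerpolyE.
- by move=> m s; rewrite derivnS; exact: is_derive_horner.
- move=> m mn; apply/RleP.
  have -> : RInt (fun s => ((kerpoly n)^`(m)).[s]%R ^ 2) 0 1 = int01 ((kerpoly n)^`(m) ^+ 2)%R.
    by apply: RInt_ext => s _; rewrite horner_exp RpowE.
  rewrite plusE multE minusE IZR_2_INR IZR_3_INR RdivE !RpowE !RmultE !INRE factE addn1.
  by apply: int01_derivn_kerpoly_le; apply/ssrnat.leP.
Qed.

Lemma real_poly_zero (n : nat) (c : nat -> R) :
  (forall y, 0 <= y -> sum_n (fun i => c i * y ^ i) n = 0) ->
  forall i, (i <= n)%coq_nat -> c i = 0.
Proof.
move=> H i /ssrnat.leP Hi; apply: (@poly_coef_zero n c) => // k.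
rewrite -[RHS](H (INR k) (pos_INR k)) sum_n_big.
by apply: eq_bigr => j _; rewrite RpowE INRE.
Qed.

End PolyEnergy.

(** * Finite sums over the modes, and the partial fraction decomposition *)

(** [ring] does not see through the carriers of the algebraic structures. *)
Ltac cring := match goal with |- @eq _ ?a ?b => change (@eq C a b) end; ring.


Lemma Csum_O (f : nat -> C) : sum_n f 0 = f O.
Proof. exact (sum_O f). Qed.

Lemma Csum_S (f : nat -> C) (n : nat) : sum_n f (S n) = (sum_n f n + f (S n))%C.
Proof. exact (sum_Sn f n). Qed.

Lemma Csum_mult_l (c : C) (f : nat -> C) (n : nat) :
  sum_n (fun i => (c * f i)%C) n = (c * sum_n f n)%C.
Proof.
induction n as [|n IH]; [now rewrite !Csum_O|].
rewrite !Csum_S IH; cring.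
Qed.

Lemma Csum_plus (f g : nat -> C) (n : nat) :
  sum_n (fun i => (f i + g i)%C) n = (sum_n f n + sum_n g n)%C.
Proof.
induction n as [|n IH]; [now rewrite !Csum_O|].
rewrite !Csum_S IH; cring.
Qed.

Lemma Csum_ext (f g : nat -> C) (n : nat) :
  (forall i, (i <= n)%nat -> f i = g i) -> sum_n f n = sum_n g n.
Proof. exact (sum_n_ext_loc f g n). Qed.

Lemma Csum_swap (f : nat -> nat -> C) (n m : nat) :
  sum_n (fun i => sum_n (fun k => f i k) m) n =
  sum_n (fun k => sum_n (fun i => f i k) n) m.
Proof. exact (sum_n_switch f n m). Qed.

Lemma Csum_RtoC (f : nat -> R) (n : nat) :
  sum_n (fun i => RtoC (f i)) n = RtoC (sum_n f n).
Proof.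
induction n as [|n IH]; [now rewrite Csum_O sum_O|].
rewrite Csum_S IH sum_Sn; unfold plus; simpl; now rewrite RtoC_plus.
Qed.

Lemma Re_Csum (f : nat -> C) (n : nat) : Re (sum_n f n) = sum_n (fun i => Re (f i)) n.
Proof.
induction n as [|n IH]; [now rewrite Csum_O sum_O|].
rewrite Csum_S sum_Sn -IH; reflexivity.
Qed.

Lemma Im_Csum (f : nat -> C) (n : nat) : Im (sum_n f n) = sum_n (fun i => Im (f i)) n.
Proof.
induction n as [|n IH]; [now rewrite Csum_O sum_O|].
rewrite Csum_S sum_Sn -IH; reflexivity.
Qed.

Lemma Cmodes_0 (f : nat -> C) : sum_n_m f 1 0 = RtoC 0.
Proof. apply (sum_n_m_zero f); lia. Qed.

Lemma Cmodes_S (f : nat -> C) (N : nat) :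
  sum_n_m f 1 (S N) = (sum_n_m f 1 N + f (S N))%C.
Proof. apply (sum_n_Sm f); lia. Qed.

Lemma Cmodes_ext (f g : nat -> C) (N : nat) :
  (forall j, (1 <= j <= N)%nat -> f j = g j) -> sum_n_m f 1 N = sum_n_m g 1 N.
Proof. intros H; apply sum_n_m_ext_loc; intros; apply H; lia. Qed.

Lemma Cmodes_mult_l (c : C) (f : nat -> C) (N : nat) :
  sum_n_m (fun j => (c * f j)%C) 1 N = (c * sum_n_m f 1 N)%C.
Proof.
induction N as [|N IH]; [rewrite !Cmodes_0; cring|].
rewrite !Cmodes_S IH; cring.
Qed.

Lemma Cmodes_plus (f g : nat -> C) (N : nat) :
  sum_n_m (fun j => (f j + g j)%C) 1 N = (sum_n_m f 1 N + sum_n_m g 1 N)%C.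
Proof.
induction N as [|N IH]; [rewrite !Cmodes_0; cring|].
rewrite !Cmodes_S IH; cring.
Qed.

Lemma Cmodes_sum (f : nat -> nat -> C) (N n : nat) :
  sum_n_m (fun j => sum_n (fun i => f j i) n) 1 N =
  sum_n (fun i => sum_n_m (fun j => f j i) 1 N) n.
Proof.
induction n as [|n IH].
  rewrite Csum_O; apply Cmodes_ext; intros; now rewrite Csum_O.
rewrite Csum_S -IH -Cmodes_plus; apply Cmodes_ext; intros; now rewrite Csum_S.
Qed.

Lemma padeQ_coef (n : nat) (z : C) :
  padeQ n z = sum_n (fun i => (RtoC (coefQ n i) * (- z) ^ i)%C) (S n).
Proof. replace (S n) with (n + 1)%nat by lia; reflexivity. Qed.

Lemma padeP_coef (n : nat) (z : C) :
  padeP n z = sum_n (fun i => (RtoC (coefP n i) * z ^ i)%C) n.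
Proof. reflexivity. Qed.

Lemma coefQ_pos (n i : nat) : 0 < coefQ n i.
Proof.
unfold coefQ; apply Rdiv_lt_0_compat; repeat apply Rmult_lt_0_compat; apply INR_fact_lt_0.
Qed.

Lemma RtoC_pow (x : R) (i : nat) : (RtoC x ^ i)%C = RtoC (x ^ i).
Proof. induction i as [|i IH]; simpl; [reflexivity|]. now rewrite IH RtoC_mult. Qed.

(** All terms [q_i y ^ i] are nonnegative, and [q_0] is positive. *)
Lemma padeQ_neg_real (n : nat) (y : R) : 0 <= y -> padeQ n (RtoC (- y)) <> 0%C.
Proof.
intros Hy; rewrite padeQ_coef.
rewrite (Csum_ext _ (fun i => RtoC (coefQ n i * y ^ i))).
  rewrite Csum_RtoC; intros E; apply RtoC_inj in E.
  assert (H : forall N, 0 < sum_n (fun i => coefQ n i * y ^ i) N).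
    induction N as [|N IH].
      rewrite sum_O; simpl; generalize (coefQ_pos n 0); lra.
    rewrite sum_Sn; apply Rplus_lt_le_0_compat; [exact IH|].
    apply Rmult_le_pos; [left; apply coefQ_pos|now apply pow_le].
  generalize (H (S n)); lra.
intros i _; rewrite -RtoC_opp Ropp_involutive RtoC_pow RtoC_mult; reflexivity.
Qed.

(** For [x r = y ^ r] this is the divided difference [(y ^ i - (- l) ^ i) / (y + l)],
    see [ddiff_pow].  It is linear in the sequence [x], so that an identity between
    polynomials in [y] carries over to other sequences in the place of the powers. *)
Fixpoint ddiff (l : C) (x : nat -> C) (i : nat) : C :=
  match i with
  | O => 0%C
  | S i => (- l * ddiff l x i + x i)%C
  end.

Definition Kdelta (r i : nat) : C := if Nat.eqb i r then 1%C else 0%C.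

Lemma Csum_Kdelta (x : nat -> C) (n i : nat) : (i <= n)%nat ->
  sum_n (fun r => (x r * Kdelta r i)%C) n = x i.
Proof.
unfold Kdelta; induction n as [|n IH]; intros Hi.
  rewrite Csum_O; replace i with O by lia; simpl; cring.
rewrite Csum_S; destruct (Nat.eqb_spec i (S n)) as [->|Hn].
  rewrite (Csum_ext _ (fun r => (0 * x r)%C)).
    rewrite Csum_mult_l; cring.
  intros r Hr; destruct (Nat.eqb_spec (S n) r); [lia|cring].
rewrite IH; [cring|lia].
Qed.

Lemma ddiff_linear (l : C) (x : nat -> C) (n i : nat) : (i <= S n)%nat ->
  ddiff l x i = sum_n (fun r => (x r * ddiff l (Kdelta r) i)%C) n.
Proof.
induction i as [|i IH]; intros Hi; simpl.
  rewrite (Csum_ext _ (fun r => (0 * x r)%C)); [rewrite Csum_mult_l; cring|].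
  intros; cring.
rewrite IH; [|lia]; rewrite -Csum_mult_l -(Csum_Kdelta x n i); [|lia].
rewrite -Csum_plus; apply Csum_ext; intros; cring.
Qed.

Lemma ddiff_pow (l y : C) (i : nat) :
  ((l + y) * ddiff l (fun r => y ^ r) i = y ^ i - (- l) ^ i)%C.
Proof.
induction i as [|i IH]; simpl; [cring|].
replace ((l + y) * (- l * ddiff l (fun r => y ^ r) i + y ^ i))%C with
  (- l * ((l + y) * ddiff l (fun r => y ^ r) i) + (l + y) * y ^ i)%C by cring.
rewrite IH; cring.
Qed.

Section PartialFractions.
Variables (n : nat) (l b : nat -> C).
Hypothesis roots : padeQ_roots n l.
Hypothesis fractions : pade_partial_fractions n l b.

Lemma root_padeQ (j : nat) : (1 <= j <= n + 1)%nat -> padeQ n (l j) = 0%C.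
Proof. intros Hj; apply (proj2 roots); now exists j. Qed.

(** With the powers of [y] for [x] this is [sum_j b_j padeQ (- y) / (l_j + y)], the
    numerator [padeP n (- y)]. *)
Definition fracsum (x : nat -> C) : C :=
  sum_n_m (fun j => (b j * sum_n (fun i => RtoC (coefQ n i) * ddiff (l j) x i)%C (S n))%C)
    1 (n + 1).

Lemma fracsum_linear (x : nat -> C) :
  fracsum x = sum_n (fun r => (x r * fracsum (Kdelta r))%C) n.
Proof.
unfold fracsum.
rewrite (Csum_ext _ (fun r => sum_n_m (fun j => (x r * (b j *
  sum_n (fun i => RtoC (coefQ n i) * ddiff (l j) (Kdelta r) i)%C (S n)))%C) 1 (n + 1))).
  2: intros; now rewrite Cmodes_mult_l.
rewrite -Cmodes_sum; apply Cmodes_ext; intros j _.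
rewrite (Csum_ext _ (fun r => (b j * (x r * sum_n (fun i => RtoC (coefQ n i) * ddiff (l j) (Kdelta r) i)%C (S n)))%C) n).
  2: intros; cring.
rewrite Csum_mult_l; f_equal.
rewrite (Csum_ext _ (fun i => sum_n (fun r => (x r * (RtoC (coefQ n i) * ddiff (l j) (Kdelta r) i))%C) n) (S n)).
  rewrite Csum_swap; apply Csum_ext; intros; now rewrite -Csum_mult_l.
intros i Hi; rewrite (ddiff_linear _ x n i Hi) -Csum_mult_l; apply Csum_ext; intros; cring.
Qed.

(** As [padeQ n (l j) = 0], the quotient [padeQ n (- y) / (l j + y)] is a divided
    difference of [padeQ n]. *)
Lemma fracsum_pow (y : R) : 0 <= y ->
  fracsum (fun r => (RtoC y ^ r)%C) = padeP n (RtoC (- y)).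
Proof.
intros Hy; generalize (padeQ_neg_real n y Hy); intros HQ.
assert (E : padeP n (RtoC (- y)) = (pade n (RtoC (- y)) * padeQ n (RtoC (- y)))%C).
  unfold pade; field; exact HQ.
rewrite E (fractions _ HQ) Cmult_comm -Cmodes_mult_l; unfold fracsum.
apply Cmodes_ext; intros j Hj.
assert (Hl : (l j - RtoC (- y))%C <> 0%C).
  intros H0; apply HQ; replace (RtoC (- y)) with (l j); [now apply root_padeQ|].
  replace (l j) with ((l j - RtoC (- y)) + RtoC (- y))%C by cring; rewrite H0; cring.
rewrite padeQ_coef RtoC_opp in Hl |- *.
replace (- - RtoC y)%C with (RtoC y) by cring.
assert (D : (sum_n (fun i => RtoC (coefQ n i) * RtoC y ^ i)%C (S n) =
  (l j - - RtoC y) * sum_n (fun i => RtoC (coefQ n i) * ddiff (l j) (fun r => RtoC y ^ r) i)%C (S n))%C).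
  rewrite -Csum_mult_l.
  replace (sum_n (fun i => RtoC (coefQ n i) * RtoC y ^ i)%C (S n)) with
    (sum_n (fun i => RtoC (coefQ n i) * RtoC y ^ i)%C (S n) + (- (1)) * padeQ n (l j))%C.
    rewrite padeQ_coef -Csum_mult_l -Csum_plus; apply Csum_ext; intros i _.
    replace ((l j - - RtoC y) * (RtoC (coefQ n i) * ddiff (l j) (fun r => RtoC y ^ r) i))%C with
      (RtoC (coefQ n i) * ((l j + RtoC y) * ddiff (l j) (fun r => RtoC y ^ r) i))%C by cring.
    rewrite ddiff_pow; cring.
  rewrite root_padeQ //; cring.
rewrite D; field; exact Hl.
Qed.

(** The decomposition into partial fractions is known at all [- y] with [0 <= y], since
    [padeQ n] has no root there; so the coefficients can be compared. *)
Lemma fracsum_Kdelta (r : nat) : (r <= n)%nat ->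
  fracsum (Kdelta r) = RtoC ((-1) ^ r * coefP n r).
Proof.
intros Hr.
assert (E : forall y, 0 <= y ->
  sum_n (fun i => (RtoC (y ^ i) * (fracsum (Kdelta i) - RtoC ((-1) ^ i * coefP n i)))%C) n = RtoC 0).
  intros y Hy; generalize (fracsum_pow y Hy); rewrite fracsum_linear padeP_coef => H.
  rewrite (Csum_ext _ (fun i => (RtoC y ^ i * fracsum (Kdelta i) + (- (1)) * (RtoC (coefP n i) * RtoC (- y) ^ i))%C)).
    rewrite Csum_plus H Csum_mult_l; cring.
  intros i _; rewrite !RtoC_pow.
  replace (RtoC (coefP n i) * RtoC ((- y) ^ i))%C with (RtoC (y ^ i) * RtoC ((-1) ^ i * coefP n i))%C.
    cring.
  rewrite -!RtoC_mult; f_equal.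
  replace (- y) with ((-1) * y) by ring; rewrite Rpow_mult_distr; ring.
assert (ER : Re (fracsum (Kdelta r) - RtoC ((-1) ^ r * coefP n r))%C = 0).
  apply (PolyEnergy.real_poly_zero n (fun i => Re (fracsum (Kdelta i) - RtoC ((-1) ^ i * coefP n i))%C)); [|exact Hr].
  intros y Hy; generalize (f_equal Re (E y Hy)); rewrite Re_Csum; simpl; intros H.
  etransitivity; [|exact H]; apply sum_n_ext; intros i; simpl; ring.
assert (EI : Im (fracsum (Kdelta r) - RtoC ((-1) ^ r * coefP n r))%C = 0).
  apply (PolyEnergy.real_poly_zero n (fun i => Im (fracsum (Kdelta i) - RtoC ((-1) ^ i * coefP n i))%C)); [|exact Hr].
  intros y Hy; generalize (f_equal Im (E y Hy)); rewrite Im_Csum; simpl; intros H.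
  etransitivity; [|exact H]; apply sum_n_ext; intros i; simpl; ring.
simpl in ER, EI; apply injective_projections; simpl; [|unfold Im in EI]; unfold Re in ER; lra.
Qed.

Lemma fracsum_coefP (x : nat -> R) :
  fracsum (fun r => RtoC (x r)) = RtoC (sum_n (fun r => (-1) ^ r * coefP n r * x r) n).
Proof.
rewrite fracsum_linear -Csum_RtoC; apply Csum_ext; intros r Hr.
rewrite fracsum_Kdelta // -RtoC_mult; f_equal; ring.
Qed.
End PartialFractions.

(** * Location of the roots and the energy estimate *)

Ltac rring := match goal with |- @eq _ ?a ?b => change (@eq R a b) end; ring.

Lemma Rsum_mult_l (x : R) (f : nat -> R) (n : nat) :
  sum_n (fun i => x * f i) n = x * sum_n f n.
Proof. exact (sum_n_mult_l (K := R_Ring) x f n). Qed.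

Lemma Rsum_plus (f g : nat -> R) (n : nat) :
  sum_n (fun i => f i + g i) n = sum_n f n + sum_n g n.
Proof. exact (sum_n_plus (G := R_AbelianGroup) f g n). Qed.

Lemma bilin_comb (m : nat -> nat -> R) (n : nat) (a c d : nat -> R) (x y : R) :
  bilin m n a (fun i => x * c i + y * d i) = x * bilin m n a c + y * bilin m n a d.
Proof.
unfold bilin; rewrite -!Rsum_mult_l -Rsum_plus.
apply sum_n_ext; intros i; rewrite -!Rsum_mult_l -Rsum_plus.
apply sum_n_ext; intros l; rring.
Qed.

Lemma bilin_sym (m : nat -> nat -> R) (n : nat) (a b : nat -> R) :
  (forall i l, m i l = m l i) -> bilin m n a b = bilin m n b a.
Proof.
intros Hm; unfold bilin.
rewrite (sum_n_switch (G := R_AbelianGroup)).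
apply sum_n_ext; intros i; apply sum_n_ext; intros l; rewrite (Hm l i); rring.
Qed.

Lemma bilin_ext (m : nat -> nat -> R) (n : nat) (a b c d : nat -> R) :
  (forall i, (i <= n)%nat -> a i = c i) -> (forall i, (i <= n)%nat -> b i = d i) ->
  bilin m n a b = bilin m n c d.
Proof.
intros H1 H2; unfold bilin; apply sum_n_ext_loc; intros i Hi.
apply sum_n_ext_loc; intros l Hl; now rewrite H1 // H2.
Qed.

(** By symmetry both factors contribute the same. *)
Lemma is_derive_bilin (m : nat -> nat -> R) (n : nat) (psi : nat -> R -> R) (s : R) :
  (forall i l, m i l = m l i) ->
  (forall i, (i <= n)%nat -> is_derive (psi i) s (psi (S i) s)) ->
  is_derive (fun s => bilin m n (fun i => psi i s) (fun i => psi i s)) s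
    (2 * bilin m n (fun i => psi i s) (fun i => psi (S i) s)).
Proof.
intros Hm Hd.
replace (2 * bilin m n (fun i => psi i s) (fun i => psi (S i) s)) with
  (bilin m n (fun i => psi (S i) s) (fun i => psi i s) +
   bilin m n (fun i => psi i s) (fun i => psi (S i) s)).
  2: rewrite (bilin_sym m n (fun i => psi (S i) s)) //; ring.
unfold bilin.
rewrite -Rsum_plus.
apply (is_derive_sum_n (V := R_NormedModule)
  (fun i s => sum_n (fun l => m i l * (psi i s * psi l s)) n)); intros i Hi.
change (is_derive (fun s => sum_n (fun l => m i l * (psi i s * psi l s)) n) s
  (sum_n (fun l => m i l * (psi (S i) s * psi l s)) n +
   sum_n (fun l => m i l * (psi i s * psi (S l) s)) n)).
rewrite -Rsum_plus.
apply (is_derive_sum_n (V := R_NormedModule) (fun l s => m i l * (psi i s * psi l s)));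
  intros l Hl.
evar_last.
  apply (is_derive_scal (fun s => psi i s * psi l s)).
  apply (is_derive_mult (psi i) (psi l)); [now apply Hd|now apply Hd|].
  intros; apply Rmult_comm.
unfold plus, mult; simpl; unfold mult; simpl; ring.
Qed.

Section Roots.
Variables (n : nat) (l : C).
Hypothesis root : padeQ n l = 0%C.

Lemma root_nonzero : l <> 0%C.
Proof.
intros H; apply (padeQ_neg_real n 0); [lra|].
transitivity (padeQ n l); [now rewrite H Ropp_0|exact root].
Qed.

Lemma Cpow_nonzero (z : C) (i : nat) : z <> 0%C -> (z ^ i)%C <> 0%C.
Proof.
intros Hz; induction i as [|i IH]; simpl.
  intros H; apply (f_equal Re) in H; simpl in H; lra.
now apply Cmult_neq_0.
Qed.

(** For [a i = (- l) ^ i] the inflow is [padeQ n l = 0] and the shift of [a] is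
    [- l * a].  So the derivative of the storage is [- 2 Re l] times the storage, while
    the dissipation makes it at most [- 1 / 2] times the storage, which is positive. *)
Lemma root_Re : 1 / 4 <= Re l.
Proof.
destruct (PolyEnergy.storage n) as (m & kappa & Hk & Hm & Hlow & Hst).
set (al := fun i => Re ((- l) ^ i)%C); set (be := fun i => Im ((- l) ^ i)%C).
assert (Hal : forall i, al (S i) = (- Re l) * al i + Im l * be i).
  intros i; unfold al, be; simpl; unfold Re, Im; ring.
assert (Hbe : forall i, be (S i) = (- Re l) * be i + (- Im l) * al i).
  intros i; unfold al, be; simpl; unfold Re, Im; ring.
assert (HQ : sum_n (fun i => (RtoC (coefQ n i) * (- l) ^ i)%C) (S n) = RtoC 0).
  now rewrite -padeQ_coef.
assert (Ua : sum_n (fun i => coefQ n i * al i) (S n) = 0).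
  generalize (f_equal Re HQ); rewrite Re_Csum; intros H.
  etransitivity; [|exact H]; apply sum_n_ext; intros i; unfold al, Re; simpl; rring.
assert (Ub : sum_n (fun i => coefQ n i * be i) (S n) = 0).
  generalize (f_equal Im HQ); rewrite Im_Csum; intros H.
  etransitivity; [|exact H]; apply sum_n_ext; intros i; unfold be, Re, Im; simpl; rring.
generalize (Hst al) (Hst be) (Hlow al) (Hlow be).
rewrite Ua Ub.
rewrite (bilin_ext m n al (fun i => al (S i)) al (fun i => (- Re l) * al i + Im l * be i)) //.
rewrite (bilin_ext m n be (fun i => be (S i)) be (fun i => (- Re l) * be i + (- Im l) * al i)) //.
rewrite !bilin_comb (bilin_sym m n be al) //.
intros H1 H2 H3 H4.
assert (Hp : 0 < al n ^ 2 + be n ^ 2).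
  assert (Hn : ((- l) ^ n)%C <> 0%C).
    apply Cpow_nonzero; intros H; apply root_nonzero.
    replace l with (- - l)%C by ring; rewrite H; ring.
  apply Cmod_gt_0 in Hn; unfold Cmod in Hn.
  assert (E : fst ((- l) ^ n)%C ^ 2 + snd ((- l) ^ n)%C ^ 2 = al n ^ 2 + be n ^ 2) by reflexivity.
  rewrite -E; destruct (Rle_lt_dec (fst ((- l) ^ n)%C ^ 2 + snd ((- l) ^ n)%C ^ 2) 0) as [H|H]; [|exact H].
  replace (fst ((- l) ^ n)%C ^ 2 + snd ((- l) ^ n)%C ^ 2) with 0 in Hn.
    rewrite sqrt_0 in Hn; lra.
  generalize (pow2_ge_0 (fst ((- l) ^ n)%C)) (pow2_ge_0 (snd ((- l) ^ n)%C)); lra.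
assert (0 < bilin m n al al + bilin m n be be) by nra.
generalize (pow2_ge_0 (coefQ n (S n) * al (S n))) (pow2_ge_0 (coefQ n (S n) * be (S n))); intros.
nra.
Qed.
End Roots.

(** The derivative of [exp (s / 2) * B (s)], where [B] is the storage, is at most
    [exp (s / 2) * (u ^ 2 - j ^ 2)]: the rate [1 / 2] of the weight is compensated by the
    term [- B / 2] in the dissipation. *)
Lemma energy_estimate (n : nat) (m : nat -> nat -> R) (psi : nat -> R -> R) (a b : R) :
  (forall i l, m i l = m l i) ->
  (forall c, 2 * bilin m n c (fun i => c (S i)) <=
    sum_n (fun i => coefQ n i * c i) (S n) ^ 2 - (coefQ n (S n) * c (S n)) ^ 2
    - bilin m n c c / 2) ->
  a <= b ->
  (forall i s, (i <= n)%nat -> is_derive (psi i) s (psi (S i) s)) ->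
  (forall s, continuous (psi (S n)) s) ->
  exp (b / 2) * bilin m n (fun i => psi i b) (fun i => psi i b) +
  RInt (fun s => exp (s / 2) * (coefQ n (S n) * psi (S n) s) ^ 2) a b <=
  exp (a / 2) * bilin m n (fun i => psi i a) (fun i => psi i a) +
  RInt (fun s => exp (s / 2) * sum_n (fun i => coefQ n i * psi i s) (S n) ^ 2) a b.
Proof.
intros Hm Hst Hab Hd Hc.
assert (Hci : forall i s, (i <= S n)%nat -> continuous (psi i) s).
  intros i s Hi; destruct (Nat.eq_dec i (S n)) as [->|Hne]; [apply Hc|].
  apply (ex_derive_continuous (K := R_AbsRing) (V := R_NormedModule)); eexists; apply Hd; lia.
assert (Hce : forall s, continuous (fun s => exp (s / 2)) s).
  intros s; apply (ex_derive_continuous (K := R_AbsRing) (V := R_NormedModule)); auto_derive; auto.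
assert (Hsum : forall (f : nat -> R -> R) N s, (forall i, (i <= N)%nat -> continuous (f i) s) ->
   continuous (fun s => sum_n (fun i => f i s) N) s).
  intros f N s; induction N as [|N IH]; intros Hf.
    apply (continuous_ext (f O)); [intros; now rewrite sum_O|now apply Hf].
  apply (continuous_ext (fun s => plus (sum_n (fun i => f i s) N) (f (S N) s))).
    intros; now rewrite sum_Sn.
  apply (continuous_plus (V := R_NormedModule)); [apply IH; intros; apply Hf; lia|apply Hf; lia].
assert (Hmul : forall (f g : R -> R) s, continuous f s -> continuous g s -> continuous (fun s => f s * g s) s).
  intros f g s H1 H2; now apply (continuous_mult (K := R_AbsRing) f g).
assert (Hsq : forall (f : R -> R) s, continuous f s -> continuous (fun s => f s ^ 2) s).
  intros f s H1; apply (continuous_ext (fun s => f s * f s)); [intros; simpl; ring|now apply Hmul].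
set (E := fun s => bilin m n (fun i => psi i s) (fun i => psi i s)).
set (dE := fun s => 2 * bilin m n (fun i => psi i s) (fun i => psi (S i) s)).
assert (HdE : forall s, is_derive E s (dE s)).
  intros s; apply is_derive_bilin; auto.
assert (HdEc : forall s, continuous dE s).
  intros s; unfold dE; apply Hmul; [apply continuous_const|].
  unfold bilin; apply (Hsum (fun i s => sum_n (fun l => m i l * (psi i s * psi (S l) s)) n)); intros i Hi.
  apply (Hsum (fun l s => m i l * (psi i s * psi (S l) s))); intros l Hl.
  apply Hmul; [apply continuous_const|apply Hmul; apply Hci; lia].
set (dP := fun s => / 2 * exp (s / 2) * E s + exp (s / 2) * dE s).
assert (HP : is_RInt dP a b (exp (b / 2) * E b - exp (a / 2) * E a)).
  apply (is_RInt_derive (V := R_CompleteNormedModule) (fun s => exp (s / 2) * E s)).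
    intros s _; unfold dP.
    apply (is_derive_mult (fun s => exp (s / 2)) E); [|apply HdE|intros; apply Rmult_comm].
    auto_derive; [auto|]; unfold Rdiv; ring.
  intros s _; unfold dP.
  apply (continuous_plus (V := R_NormedModule)); [|now apply Hmul].
  apply Hmul; [apply Hmul; [apply continuous_const|apply Hce]|].
  apply (ex_derive_continuous (K := R_AbsRing) (V := R_NormedModule)); eexists; apply HdE.
assert (Hju : ex_RInt (fun s => exp (s / 2) * (coefQ n (S n) * psi (S n) s) ^ 2) a b).
  apply (ex_RInt_continuous (V := R_CompleteNormedModule)); intros s _; apply Hmul; [apply Hce|].
  apply Hsq; apply Hmul; [apply continuous_const|now apply Hci].
assert (Huu : ex_RInt (fun s => exp (s / 2) * sum_n (fun i => coefQ n i * psi i s) (S n) ^ 2) a b).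
  apply (ex_RInt_continuous (V := R_CompleteNormedModule)); intros s _; apply Hmul; [apply Hce|].
  apply Hsq; apply (Hsum (fun i s => coefQ n i * psi i s)); intros i Hi.
  apply Hmul; [apply continuous_const|now apply Hci].
assert (Hle : exp (b / 2) * E b - exp (a / 2) * E a <=
  RInt (fun s => exp (s / 2) * sum_n (fun i => coefQ n i * psi i s) (S n) ^ 2) a b -
  RInt (fun s => exp (s / 2) * (coefQ n (S n) * psi (S n) s) ^ 2) a b).
  apply (is_RInt_le dP (fun s => minus (exp (s / 2) * sum_n (fun i => coefQ n i * psi i s) (S n) ^ 2) (exp (s / 2) * (coefQ n (S n) * psi (S n) s) ^ 2)) a b); [exact Hab|exact HP| |].
    apply (is_RInt_minus (V := R_NormedModule)); now apply (RInt_correct (V := R_CompleteNormedModule)).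
  intros s _; change (dP s <= exp (s / 2) * sum_n (fun i => coefQ n i * psi i s) (S n) ^ 2 - exp (s / 2) * (coefQ n (S n) * psi (S n) s) ^ 2); unfold dP, dE, E.
  generalize (Hst (fun i => psi i s)) (exp_pos (s / 2)).
  set (B' := bilin _ _ _ _); set (B := bilin _ _ _ _); set (u := sum_n _ _).
  intros H1 H2.
  assert (H3 : exp (s / 2) * (2 * B' + B / 2) <= exp (s / 2) * (u ^ 2 - (coefQ n (S n) * psi (S n) s) ^ 2)).
    apply Rmult_le_compat_l; lra.
  lra.
unfold E in Hle; lra.
Qed.

(** * Exponential modes and their iterated primitives *)

Ltac rfield := match goal with |- @eq _ ?a ?b => change (@eq R a b) end; field.

(** The [m]-fold primitive of the unit mass at [0], on the positive side; the value
    for [m = 0] is that of the mass itself away from [0], which keeps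
    [is_derive_dpow] valid for all [m]. *)
Definition dpow (m : nat) (r : R) : R :=
  match m with O => 0 | S m => r ^ m / INR (fact m) end.

Lemma is_derive_dpow (m : nat) (r : R) : is_derive (dpow (S m)) r (dpow m r).
Proof.
destruct m as [|m]; unfold dpow.
  auto_derive; [auto|]; simpl; field.
apply (is_derive_ext (fun r => / INR (fact (S m)) * r ^ S m)).
  intros t; unfold Rdiv; rring.
replace (r ^ m / INR (fact m)) with (/ INR (fact (S m)) * (INR (S m) * r ^ m)).
  apply (is_derive_scal (fun r => r ^ S m)), is_derive_Reals, derivable_pt_lim_pow.
rewrite fact_simpl mult_INR; field; split; [apply INR_fact_neq_0|now apply not_0_INR].
Qed.

Lemma dpow_at_0 (m : nat) : dpow (S (S m)) 0 = 0.
Proof. unfold dpow; rewrite pow_ne_zero //; unfold Rdiv; ring. Qed.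

Definition is_deriveC (k : R -> C) (s : R) (d : C) : Prop :=
  is_derive (fun s => Re (k s)) s (Re d) /\ is_derive (fun s => Im (k s)) s (Im d).

Lemma is_deriveC_plus (f g : R -> C) (s : R) (df dg : C) :
  is_deriveC f s df -> is_deriveC g s dg ->
  is_deriveC (fun s => (f s + g s)%C) s (df + dg)%C.
Proof.
intros [H1 H2] [H3 H4]; split.
  exact (is_derive_plus (V := R_NormedModule) _ _ s _ _ H1 H3).
exact (is_derive_plus (V := R_NormedModule) _ _ s _ _ H2 H4).
Qed.

Lemma is_deriveC_RtoC (f : R -> R) (s d : R) :
  is_derive f s d -> is_deriveC (fun s => RtoC (f s)) s (RtoC d).
Proof. intros H; split; [exact H|exact (is_derive_const (V := R_NormedModule) 0 s)]. Qed.

Lemma is_deriveC_mult_l (c : C) (f : R -> C) (s : R) (d : C) :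
  is_deriveC f s d -> is_deriveC (fun s => (c * f s)%C) s (c * d)%C.
Proof.
intros [H1 H2]; split.
  apply (is_derive_minus (V := R_NormedModule) (fun s => Re c * Re (f s)) (fun s => Im c * Im (f s)));
    now apply (is_derive_scal (fun s => _ (f s))).
apply (is_derive_plus (V := R_NormedModule) (fun s => Re c * Im (f s)) (fun s => Im c * Re (f s)));
    now apply (is_derive_scal (fun s => _ (f s))).
Qed.

Lemma is_deriveC_ext (f g : R -> C) (s : R) (d : C) :
  (forall s, f s = g s) -> is_deriveC f s d -> is_deriveC g s d.
Proof.
intros E [H1 H2]; split.
  apply (is_derive_ext (fun s => Re (f s))); [intros; now rewrite E|exact H1].
apply (is_derive_ext (fun s => Im (f s))); [intros; now rewrite E|exact H2].
Qed.

Lemma is_deriveC_modes (f : nat -> R -> C) (d : nat -> C) (N : nat) (s : R) :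
  (forall j, is_deriveC (f j) s (d j)) ->
  is_deriveC (fun s => sum_n_m (fun j => f j s) 1 N) s (sum_n_m d 1 N).
Proof.
intros H; induction N as [|N IH].
  rewrite Cmodes_0; apply (is_deriveC_ext (fun _ => RtoC 0)); [intros; now rewrite Cmodes_0|].
  apply is_deriveC_RtoC; exact (is_derive_const (V := R_NormedModule) 0 s).
rewrite Cmodes_S; apply (is_deriveC_ext (fun s => (sum_n_m (fun j => f j s) 1 N + f (S N) s)%C)).
  intros; now rewrite Cmodes_S.
now apply is_deriveC_plus.
Qed.

(** The [m]-fold primitive of [exp (- l s)] that vanishes at [0]. *)
Fixpoint mode (l : C) (m : nat) (s : R) : C :=
  match m with
  | O => Cexp (- (l * s))%C
  | S m => ((mode l m s - RtoC (dpow (S m) s)) / - l)%C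
  end.

Lemma is_deriveC_mode0 (l : C) (s : R) : is_deriveC (mode l 0) s (- l * mode l 0 s)%C.
Proof.
unfold mode, Cexp; split; unfold Re, Im; simpl.
  auto_derive; [auto|]; unfold Rminus; ring.
auto_derive; [auto|]; unfold Rminus; ring.
Qed.

Lemma Copp_nonzero (l : C) : l <> 0%C -> (- l)%C <> 0%C.
Proof. intros Hl H; apply Hl; replace l with (- - l)%C by ring; rewrite H; ring. Qed.

Lemma is_deriveC_mode (l : C) (m : nat) (s : R) : l <> 0%C ->
  is_deriveC (mode l (S m)) s (mode l m s).
Proof.
intros Hl; assert (Hl' := Copp_nonzero l Hl); induction m as [|m IH].
  replace (mode l 0 s) with (/ - l * (- l * mode l 0 s + - (1) * RtoC (dpow 0 s)))%C.
    2: unfold dpow; field; exact Hl.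
  apply (is_deriveC_ext (fun s => (/ - l * (mode l 0 s + - (1) * RtoC (dpow 1 s)))%C)).
    intros; simpl; field; exact Hl.
  apply is_deriveC_mult_l, is_deriveC_plus; [apply is_deriveC_mode0|].
  apply is_deriveC_mult_l, is_deriveC_RtoC, is_derive_dpow.
replace (mode l (S m) s) with (/ - l * (mode l m s + - (1) * RtoC (dpow (S m) s)))%C.
  2: simpl; field; exact Hl.
apply (is_deriveC_ext (fun s => (/ - l * (mode l (S m) s + - (1) * RtoC (dpow (S (S m)) s)))%C)).
  intros; simpl; field; exact Hl.
apply is_deriveC_mult_l, is_deriveC_plus; [exact IH|].
apply is_deriveC_mult_l, is_deriveC_RtoC, is_derive_dpow.
Qed.

Lemma mode_at_0 (l : C) (m : nat) : l <> 0%C -> mode l (S m) 0 = 0%C.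
Proof.
intros Hl; assert (Hl' := Copp_nonzero l Hl); induction m as [|m IH].
  assert (E : mode l 0 0 = 1%C).
    unfold mode; replace (- (l * 0))%C with (RtoC 0) by ring.
    unfold Cexp; simpl; rewrite exp_0 cos_0 sin_0; unfold RtoC; f_equal; ring.
  change (mode l 1 0) with ((mode l 0 0 - RtoC (dpow 1 0)) / - l)%C.
  rewrite E; unfold dpow; simpl; replace (1 / 1) with 1 by field; field; exact Hl.
change (mode l (S (S m)) 0) with ((mode l (S m) 0 - RtoC (dpow (S (S m)) 0)) / - l)%C.
rewrite IH dpow_at_0; field; exact Hl.
Qed.

Lemma mode_pred (l : C) (m : nat) (s : R) : l <> 0%C ->
  mode l m s = (- l * mode l (S m) s + RtoC (dpow (S m) s))%C.
Proof. intros Hl; simpl; field; exact Hl. Qed.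

(** The exponential part of the primitive of order [N - i] is [(- l) ^ i] times that of
    order [N]; weighted by the coefficients of [padeQ] it disappears at a root, and
    only a divided difference of powers of [s] is left. *)
Lemma mode_ddiff (l : C) (N i : nat) (s : R) : l <> 0%C -> (i <= N)%nat ->
  mode l (N - i) s =
  ((- l) ^ i * mode l N s + ddiff l (fun r => RtoC (dpow (N - r) s)) i)%C.
Proof.
intros Hl; induction i as [|i IH]; intros Hi.
  rewrite Nat.sub_0_r; simpl; ring.
rewrite mode_pred //; replace (S (N - S i)) with (N - i)%nat by lia.
rewrite IH; [|lia]; simpl ddiff; simpl Cpow; ring.
Qed.

(** The inflow [u] on [[0, 1]] for the primitives up to the order [N]. *)
Definition inputP (n N : nat) (s : R) : R :=
  sum_n (fun r => (-1) ^ r * coefP n r * dpow (N - r) s) n.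

(** What the unit mass at [1] contributes after the time [1]. *)
Definition inputQ (n N : nat) (s : R) : R :=
  sum_n (fun i => coefQ n i * dpow (N - i) (s - 1)) (S n).

Lemma is_derive_inputP (n N : nat) (s : R) : (n <= N)%nat ->
  is_derive (inputP n (S N)) s (inputP n N s).
Proof.
intros HN; unfold inputP.
apply (is_derive_sum_n (V := R_NormedModule) (fun r s => (-1) ^ r * coefP n r * dpow (S N - r) s)).
intros r Hr; apply (is_derive_scal (dpow (S N - r))).
replace (S N - r)%nat with (S (N - r)) by lia; apply is_derive_dpow.
Qed.

Lemma is_derive_dpow_shift (m : nat) (s : R) :
  is_derive (fun s => dpow (S m) (s - 1)) s (dpow m (s - 1)).
Proof.
replace (dpow m (s - 1)) with (scal 1 (dpow m (s - 1))) by (unfold scal; simpl; unfold mult; simpl; ring).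
apply (is_derive_comp (dpow (S m)) (fun s => s - 1)); [apply is_derive_dpow|].
auto_derive; [auto|ring].
Qed.

Lemma is_derive_inputQ (n N : nat) (s : R) : (S n <= N)%nat ->
  is_derive (inputQ n (S N)) s (inputQ n N s).
Proof.
intros HN; unfold inputQ.
apply (is_derive_sum_n (V := R_NormedModule) (fun i s => coefQ n i * dpow (S N - i) (s - 1))).
intros r Hr; apply (is_derive_scal (fun s => dpow (S N - r) (s - 1))).
replace (S N - r)%nat with (S (N - r)) by lia; apply is_derive_dpow_shift.
Qed.

(** The binomial expansion of [(s - 1) ^ n]. *)
Lemma inputP_top (n : nat) (s : R) :
  inputP n (2 * n + 2) s = s ^ S n * (s - 1) ^ n / INR (fact (2 * n + 1)).
Proof.
replace (s - 1) with (-1 + s) by ring; rewrite binomial -sum_n_Reals.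
unfold Rdiv; rewrite Rmult_comm -Rmult_assoc -Rsum_mult_l; unfold inputP.
apply sum_n_ext_loc; intros r Hr.
replace (2 * n + 2 - r)%nat with (S (2 * n + 1 - r)) by lia.
unfold dpow, coefP, Binomial.C.
replace (s ^ (2 * n + 1 - r)) with (s ^ S n * s ^ (n - r)).
  2: rewrite -pow_add; f_equal; lia.
rfield; repeat split; apply INR_fact_neq_0.
Qed.

(** The binomial expansion of [s ^ (n + 1)] in powers of [s - 1]. *)
Lemma inputQ_top (n : nat) (s : R) :
  inputQ n (2 * n + 2) s = s ^ S n * (s - 1) ^ n / INR (fact (2 * n + 1)).
Proof.
replace (s ^ S n) with ((1 + (s - 1)) ^ S n) by (f_equal; ring).
rewrite binomial -sum_n_Reals (Rmult_comm _ ((s - 1) ^ n)).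
unfold Rdiv; rewrite Rmult_comm -Rmult_assoc -Rsum_mult_l; unfold inputQ.
apply sum_n_ext_loc; intros r Hr.
replace (2 * n + 2 - r)%nat with (S (2 * n + 1 - r)) by lia.
unfold dpow, coefQ, Binomial.C; rewrite (Nat.add_1_r n).
replace ((s - 1) ^ (2 * n + 1 - r)) with ((s - 1) ^ n * (s - 1) ^ (S n - r)).
  2: rewrite -pow_add; f_equal; lia.
rewrite pow1; rfield; repeat split; apply INR_fact_neq_0.
Qed.

Lemma derivatives_agree (f g : nat -> R -> R) (N M : nat) :
  (forall m s, (M <= m < N)%nat -> is_derive (f (S m)) s (f m s)) ->
  (forall m s, (M <= m < N)%nat -> is_derive (g (S m)) s (g m s)) ->
  (forall s, f N s = g N s) -> (M <= N)%nat ->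
  forall m, (M <= m <= N)%nat -> forall s, f m s = g m s.
Proof.
intros Hf Hg E HMN m Hm; replace m with (N - (N - m))%nat by lia.
assert (Hd : (N - m <= N - M)%nat) by lia; revert Hd; generalize (N - m)%nat as d.
induction d as [|d IH]; intros Hd s; [now rewrite Nat.sub_0_r|].
assert (H1 : (M <= N - S d < N)%nat) by lia.
rewrite -(is_derive_unique _ _ _ (Hf _ s H1)) -(is_derive_unique _ _ _ (Hg _ s H1)).
replace (S (N - S d)) with (N - d)%nat by lia; apply Derive_ext, IH; lia.
Qed.

(** The contact of [padeP n] and [exp * padeQ n] at the origin: both sides are
    derivatives of the same polynomial, so that the inflow stops at the time [1]. *)
Lemma inputP_inputQ (n N : nat) (s : R) : (S n <= N <= 2 * n + 2)%nat -> inputP n N s = inputQ n N s.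
Proof.
intros HN; apply (derivatives_agree (inputP n) (inputQ n) (2 * n + 2) (S n)); try lia.
- intros m t Hm; apply is_derive_inputP; lia.
- intros m t Hm; apply is_derive_inputQ; lia.
- intros t; now rewrite inputP_top inputQ_top.
Qed.

Lemma inputP_kernel_poly (n : nat) (h : nat -> R -> R) (m : nat) (s : R) :
  (forall s, h O s = (s * (1 - s)) ^ n * s) ->
  (forall m s, is_derive (h m) s (h (S m) s)) ->
  (m <= S n)%nat ->
  inputP n (2 * n + 2 - m) s = (-1) ^ n / INR (fact (2 * n + 1)) * h m s.
Proof.
intros H0 Hd Hm.
replace m with (2 * n + 2 - (2 * n + 2 - m))%nat at 2 by lia.
(* the primitive of order [j] corresponds to the derivative of order [2 n + 2 - j] of [h O] *)
apply (derivatives_agree (inputP n) (fun j s => (-1) ^ n / INR (fact (2 * n + 1)) * h (2 * n + 2 - j)%nat s) (2 * n + 2) (S n)); try lia.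
- intros j t Hj; apply is_derive_inputP; lia.
- intros j t Hj; apply (is_derive_scal (h (2 * n + 2 - S j)%nat)).
  replace (2 * n + 2 - j)%nat with (S (2 * n + 2 - S j)) by lia; apply Hd.
- intros t; rewrite inputP_top Nat.sub_diag H0.
  replace (t - 1) with ((-1) * (1 - t)) by ring; rewrite !Rpow_mult_distr; simpl; unfold Rdiv; ring.
Qed.

(** * The iterated kernels of the approximation *)

(** On [[0, 1]] this is the [m]-fold primitive of [g - delta_1]; the part of the
    primitive beyond [1] is [ker_after].  Both are smooth on the whole line. *)
Definition ker_before (n : nat) (l b : nat -> C) (m : nat) (s : R) : C :=
  sum_n_m (fun j => (b j * mode (l j) m s)%C) 1 (n + 1).

Definition ker_after (n : nat) (l b : nat -> C) (m : nat) (s : R) : C :=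
  (ker_before n l b m s - RtoC (dpow m (s - 1)))%C.

Section Kernel.
Variables (n : nat) (l b : nat -> C).
Hypothesis roots : padeQ_roots n l.
Hypothesis fractions : pade_partial_fractions n l b.

Lemma kernel_root_nonzero (j : nat) : (1 <= j <= n + 1)%nat -> l j <> 0%C.
Proof. intros Hj; apply (root_nonzero n); now apply root_padeQ. Qed.

Lemma is_deriveC_ker_before (m : nat) (s : R) : is_deriveC (ker_before n l b (S m)) s (ker_before n l b m s).
Proof.
unfold ker_before.
(* a sequence of nonzero numbers that agrees with [l] at the roots *)
set (l' := fun j => if Nat.leb 1 j && Nat.leb j (n + 1) then l j else RtoC 1).
assert (Hl' : forall j, l' j <> 0%C).
  intros j; unfold l'; destruct (Nat.leb_spec 1 j); destruct (Nat.leb_spec j (n + 1)); simpl;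
    try (intros H1; apply RtoC_inj in H1; lra); apply kernel_root_nonzero; lia.
assert (E : forall j, (1 <= j <= n + 1)%nat -> l j = l' j).
  intros j Hj; unfold l'; destruct (Nat.leb_spec 1 j); destruct (Nat.leb_spec j (n + 1)); simpl; auto; lia.
rewrite (Cmodes_ext _ (fun j => (b j * mode (l' j) m s)%C)); [|intros j Hj; now rewrite E].
apply (is_deriveC_ext (fun s => sum_n_m (fun j => (b j * mode (l' j) (S m) s)%C) 1 (n + 1))).
  intros t; apply Cmodes_ext; intros j Hj; now rewrite E.
apply (is_deriveC_modes (fun j s => (b j * mode (l' j) (S m) s)%C)); intros j.
now apply is_deriveC_mult_l, is_deriveC_mode.
Qed.

Lemma is_deriveC_ker_before0 (s : R) : exists d, is_deriveC (ker_before n l b 0) s d.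
Proof.
eexists; unfold ker_before.
apply (is_deriveC_modes (fun j s => (b j * mode (l j) 0 s)%C)); intros j.
apply is_deriveC_mult_l, is_deriveC_mode0.
Qed.

Lemma is_deriveC_ker_after (m : nat) (s : R) : is_deriveC (ker_after n l b (S m)) s (ker_after n l b m s).
Proof.
replace (ker_after n l b m s) with (ker_before n l b m s + - (1) * RtoC (dpow m (s - 1)))%C by (unfold ker_after; ring).
apply (is_deriveC_ext (fun s => (ker_before n l b (S m) s + - (1) * RtoC (dpow (S m) (s - 1)))%C)).
  intros; unfold ker_after; ring.
apply is_deriveC_plus; [apply is_deriveC_ker_before|].
apply is_deriveC_mult_l, is_deriveC_RtoC, is_derive_dpow_shift.
Qed.

Lemma ker_before_at_0 (m : nat) : ker_before n l b (S m) 0 = 0%C.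
Proof.
unfold ker_before; rewrite (Cmodes_ext _ (fun j => (0 * b j)%C)).
  rewrite Cmodes_mult_l; ring.
intros j Hj; rewrite mode_at_0; [ring|now apply kernel_root_nonzero].
Qed.

Lemma ker_after_0 (s : R) : ker_after n l b 0 s = ker_before n l b 0 s.
Proof. unfold ker_after, dpow; ring. Qed.

Lemma ker_after_at_1 (m : nat) : ker_after n l b (S (S m)) 1 = ker_before n l b (S (S m)) 1.
Proof. unfold ker_after; rewrite Rminus_diag dpow_at_0; ring. Qed.

Lemma ker_after_1_at_1 : ker_after n l b 1 1 = (ker_before n l b 1 1 - 1)%C.
Proof. unfold ker_after, dpow; simpl; unfold Rdiv; rewrite Rinv_1 Rmult_1_r; reflexivity. Qed.

(** Mode by mode, the exponentials drop out at the roots of [padeQ n], and the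
    remaining divided differences add up to the coefficients of [padeP n]. *)
Lemma ker_before_ode (N : nat) (s : R) : (S n <= N)%nat ->
  sum_n (fun i => (RtoC (coefQ n i) * ker_before n l b (N - i) s)%C) (S n) = RtoC (inputP n N s).
Proof.
intros HN; unfold inputP.
rewrite (sum_n_ext _ (fun r => (-1) ^ r * coefP n r * (fun r => dpow (N - r) s) r)) //.
rewrite -(fracsum_coefP n l b) //; unfold ker_before, fracsum.
rewrite (Csum_ext _ (fun i => sum_n_m (fun j => (RtoC (coefQ n i) * (b j * mode (l j) (N - i) s))%C) 1 (n + 1))).
  2: intros; now rewrite Cmodes_mult_l.
rewrite -Cmodes_sum; apply Cmodes_ext; intros j Hj; rewrite -Csum_mult_l.
rewrite (Csum_ext _ (fun i => ((b j * mode (l j) N s) * (RtoC (coefQ n i) * (- l j) ^ i) +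
   b j * (RtoC (coefQ n i) * ddiff (l j) (fun r => RtoC (dpow (N - r) s)) i))%C)).
  rewrite Csum_plus Csum_mult_l -padeQ_coef (root_padeQ n l) //; cring.
intros i Hi; rewrite mode_ddiff; [ring|now apply kernel_root_nonzero|lia].
Qed.

Lemma ker_after_ode (N : nat) (s : R) : (S n <= N <= 2 * n + 2)%nat ->
  sum_n (fun i => (RtoC (coefQ n i) * ker_after n l b (N - i) s)%C) (S n) = RtoC 0.
Proof.
intros HN.
rewrite (Csum_ext _ (fun i => (RtoC (coefQ n i) * ker_before n l b (N - i) s + - (1) * RtoC (coefQ n i * dpow (N - i) (s - 1)))%C)).
  rewrite Csum_plus Csum_mult_l Csum_RtoC ker_before_ode; [|lia].
  change (sum_n _ (S n)) with (inputQ n N s); rewrite inputP_inputQ //; cring.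
intros i Hi; unfold ker_after; rewrite RtoC_mult; ring.
Qed.

Lemma continuous_ker_before (m : nat) (s : R) :
  continuous (fun s => Re (ker_before n l b m s)) s /\ continuous (fun s => Im (ker_before n l b m s)) s.
Proof.
assert (H : exists d, is_deriveC (ker_before n l b m) s d).
  destruct m; [apply is_deriveC_ker_before0|eexists; apply is_deriveC_ker_before].
destruct H as [d [H1 H2]]; split;
  apply (ex_derive_continuous (K := R_AbsRing) (V := R_NormedModule)); eexists; eassumption.
Qed.

Lemma continuous_ker_after (m : nat) (s : R) :
  continuous (fun s => Re (ker_after n l b m s)) s /\ continuous (fun s => Im (ker_after n l b m s)) s.
Proof.
destruct m as [|m].
  destruct (continuous_ker_before 0 s) as [H1 H2]; split.
    apply (continuous_ext (fun s => Re (ker_before n l b 0 s))); [intros; now rewrite ker_after_0|exact H1].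
  apply (continuous_ext (fun s => Im (ker_before n l b 0 s))); [intros; now rewrite ker_after_0|exact H2].
destruct (is_deriveC_ker_after m s) as [H1 H2]; split;
  apply (ex_derive_continuous (K := R_AbsRing) (V := R_NormedModule)); eexists; eassumption.
Qed.

Lemma Re_Im_ode (H : nat -> R -> C) (N : nat) (s : R) (u : R) :
  sum_n (fun i => (RtoC (coefQ n i) * H (N - i)%nat s)%C) (S n) = RtoC u ->
  sum_n (fun i => coefQ n i * Re (H (N - i)%nat s)) (S n) = u /\
  sum_n (fun i => coefQ n i * Im (H (N - i)%nat s)) (S n) = 0.
Proof.
intros E; split.
  generalize (f_equal Re E); rewrite Re_Csum; intros H0.
  etransitivity; [|exact H0]; apply sum_n_ext; intros i; unfold Re; simpl; rring.
generalize (f_equal Im E); rewrite Im_Csum; intros H0.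
etransitivity; [|exact H0]; apply sum_n_ext; intros i; unfold Re, Im; simpl; rring.
Qed.

Lemma bilin_zero (m : nat -> nat -> R) (a : nat -> R) :
  (forall i, (i <= n)%nat -> a i = 0) -> bilin m n a a = 0.
Proof.
intros H; rewrite (bilin_ext m n a a a (fun i => 0 * a i + 0 * a i)) //.
  rewrite bilin_comb; ring.
intros i Hi; rewrite H //; ring.
Qed.

Lemma RInt_zero_ext (f : R -> R) (a c : R) : (forall s, f s = 0) -> RInt f a c = 0.
Proof.
intros H; rewrite (RInt_ext _ (fun _ => 0)); [|intros; apply H].
rewrite RInt_const; unfold scal; simpl; unfold mult; simpl; ring.
Qed.

(** The energy estimate on [[0, 1]] and on [[1, T]], for the real and the imaginary
    parts.  The state is zero at the time [0], and it is continuous at [1] because only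
    primitives of order at least two enter.  The imaginary part has no inflow. *)
Lemma kernel_energy (k : nat) (T : R) : (1 <= k <= n)%nat -> 1 <= T ->
  RInt (fun s => exp (s / 2) * (coefQ n (S n) * Re (ker_before n l b k s)) ^ 2) 0 1 +
  RInt (fun s => exp (s / 2) * (coefQ n (S n) * Im (ker_before n l b k s)) ^ 2) 0 1 +
  RInt (fun s => exp (s / 2) * (coefQ n (S n) * Re (ker_after n l b k s)) ^ 2) 1 T +
  RInt (fun s => exp (s / 2) * (coefQ n (S n) * Im (ker_after n l b k s)) ^ 2) 1 T <=
  RInt (fun s => exp (s / 2) * inputP n (S n + k) s ^ 2) 0 1.
Proof.
intros Hk HT.
destruct (PolyEnergy.storage n) as (m & kappa & Hkap & Hm & Hlow & Hst).
set (N := (S n + k)%nat).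
assert (HN : (N - S n)%nat = k) by (unfold N; lia).
assert (D : forall (H : nat -> R -> C), (forall j s, is_deriveC (H (S j)) s (H j s)) ->
  forall i s, (i <= n)%nat -> is_deriveC (H (N - i)%nat) s (H (N - S i)%nat s)).
  intros H HD i s Hi; replace (N - i)%nat with (S (N - S i)) by (unfold N; lia); apply HD.
assert (DA := D _ is_deriveC_ker_before); assert (DB := D _ is_deriveC_ker_after).
assert (E1 := energy_estimate n m (fun i s => Re (ker_before n l b (N - i) s)) 0 1 Hm Hst Rle_0_1
  (fun i s Hi => proj1 (DA i s Hi)) (fun s => proj1 (continuous_ker_before _ s))).
assert (E2 := energy_estimate n m (fun i s => Im (ker_before n l b (N - i) s)) 0 1 Hm Hst Rle_0_1
  (fun i s Hi => proj2 (DA i s Hi)) (fun s => proj2 (continuous_ker_before _ s))).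
assert (E3 := energy_estimate n m (fun i s => Re (ker_after n l b (N - i) s)) 1 T Hm Hst HT
  (fun i s Hi => proj1 (DB i s Hi)) (fun s => proj1 (continuous_ker_after _ s))).
assert (E4 := energy_estimate n m (fun i s => Im (ker_after n l b (N - i) s)) 1 T Hm Hst HT
  (fun i s Hi => proj2 (DB i s Hi)) (fun s => proj2 (continuous_ker_after _ s))).
cbv beta in E1, E2, E3, E4; rewrite HN in E1, E2, E3, E4.
assert (Z : forall i, (i <= n)%nat -> ker_before n l b (N - i) 0 = 0%C).
  intros i Hi; replace (N - i)%nat with (S (N - S i)) by (unfold N; lia); apply ker_before_at_0.
rewrite (bilin_zero m (fun i => Re (ker_before n l b (N - i) 0))) in E1; [|intros i Hi; now rewrite Z].
rewrite (bilin_zero m (fun i => Im (ker_before n l b (N - i) 0))) in E2; [|intros i Hi; now rewrite Z].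
assert (J : forall i, (i <= n)%nat -> ker_after n l b (N - i) 1 = ker_before n l b (N - i) 1).
  intros i Hi; replace (N - i)%nat with (S (S (N - S (S i)))) by (unfold N; lia); apply ker_after_at_1.
rewrite (bilin_ext m n (fun i => Re (ker_after n l b (N - i) 1)) (fun i => Re (ker_after n l b (N - i) 1))
  (fun i => Re (ker_before n l b (N - i) 1)) (fun i => Re (ker_before n l b (N - i) 1))) in E3;
  [|intros i Hi; now rewrite J|intros i Hi; now rewrite J].
rewrite (bilin_ext m n (fun i => Im (ker_after n l b (N - i) 1)) (fun i => Im (ker_after n l b (N - i) 1))
  (fun i => Im (ker_before n l b (N - i) 1)) (fun i => Im (ker_before n l b (N - i) 1))) in E4;
  [|intros i Hi; now rewrite J|intros i Hi; now rewrite J].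
assert (UA := fun s => Re_Im_ode (ker_before n l b) N s _ (ker_before_ode N s ltac:(unfold N; lia))).
assert (UB := fun s => Re_Im_ode (ker_after n l b) N s _ (ker_after_ode N s ltac:(unfold N; lia))).
rewrite (RInt_ext (fun s => exp (s / 2) * sum_n (fun i => coefQ n i * Re (ker_before n l b (N - i) s)) (S n) ^ 2)
  (fun s => exp (s / 2) * inputP n N s ^ 2)) in E1;
  [|intros s _; now rewrite (proj1 (UA s))].
rewrite (RInt_zero_ext (fun s => exp (s / 2) * sum_n (fun i => coefQ n i * Im (ker_before n l b (N - i) s)) (S n) ^ 2)) in E2;
  [|intros s; rewrite (proj2 (UA s)); ring].
rewrite (RInt_zero_ext (fun s => exp (s / 2) * sum_n (fun i => coefQ n i * Re (ker_after n l b (N - i) s)) (S n) ^ 2)) in E3;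
  [|intros s; rewrite (proj1 (UB s)); ring].
rewrite (RInt_zero_ext (fun s => exp (s / 2) * sum_n (fun i => coefQ n i * Im (ker_after n l b (N - i) s)) (S n) ^ 2)) in E4;
  [|intros s; rewrite (proj2 (UB s)); ring].
assert (P : forall c, 0 <= exp (T / 2) * bilin m n c c).
  intros c; apply Rmult_le_pos; [left; apply exp_pos|].
  generalize (Hlow c) (pow2_ge_0 (c n)); nra.
generalize (P (fun i => Re (ker_after n l b (N - i) T))) (P (fun i => Im (ker_after n l b (N - i) T))).
lra.
Qed.

(** Beyond [1] there is no inflow, so that [exp (s / 2)] times the storage decreases; the
    storage controls the square of [psi^(n)], which is the primitive of order [m + 1]
    if the equation is written for the orders up to [n + 1 + m]. *)
Lemma ker_after_decay (m : nat) : (m <= n)%nat ->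
  exists M, forall s, 1 <= s ->
    Rabs (Re (ker_after n l b (S m) s)) <= M * exp (- s / 4) /\
    Rabs (Im (ker_after n l b (S m) s)) <= M * exp (- s / 4).
Proof.
intros Hmn.
destruct (PolyEnergy.storage n) as (mm & kappa & Hkap & Hm & Hlow & Hst).
set (N := (S n + m)%nat).
assert (HN : (N - n)%nat = S m) by (unfold N; lia).
assert (DB : forall i s, (i <= n)%nat -> is_deriveC (ker_after n l b (N - i)) s (ker_after n l b (N - S i) s)).
  intros i s Hi; replace (N - i)%nat with (S (N - S i)) by (unfold N; lia); apply is_deriveC_ker_after.
assert (UB := fun s => Re_Im_ode (ker_after n l b) N s _ (ker_after_ode N s ltac:(unfold N; lia))).
assert (G : forall p : nat -> R -> R,
  (forall i s, (i <= n)%nat -> is_derive (p i) s (p (S i) s)) ->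
  (forall s, continuous (p (S n)) s) ->
  (forall s, sum_n (fun i => coefQ n i * p i s) (S n) = 0) ->
  exists M, 0 <= M /\ forall s, 1 <= s -> Rabs (p n s) <= M * exp (- s / 4)).
  intros p Hp Hpc Hp0.
  set (B1 := bilin mm n (fun i => p i 1) (fun i => p i 1)).
  assert (HB1 : 0 <= B1) by (generalize (Hlow (fun i => p i 1)) (pow2_ge_0 (p n 1)); unfold B1; nra).
  set (K := exp (1 / 2) * B1 / kappa).
  assert (HK : 0 <= K).
    apply Rdiv_le_0_compat; [apply Rmult_le_pos; [left; apply exp_pos|exact HB1]|exact Hkap].
  exists (sqrt K); split; [apply sqrt_pos|]; intros s Hs.
  assert (E := energy_estimate n mm p 1 s Hm Hst Hs Hp Hpc).
  rewrite (RInt_zero_ext (fun s => exp (s / 2) * sum_n (fun i => coefQ n i * p i s) (S n) ^ 2)) in E;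
    [|intros r; rewrite Hp0; ring].
  assert (I0 : 0 <= RInt (fun s => exp (s / 2) * (coefQ n (S n) * p (S n) s) ^ 2) 1 s).
    apply RInt_ge_0; [exact Hs| |].
      apply (ex_RInt_continuous (V := R_CompleteNormedModule)); intros z _.
      apply (continuous_mult (K := R_AbsRing) (fun s => exp (s / 2)) (fun s => (coefQ n (S n) * p (S n) s) ^ 2)).
        apply (ex_derive_continuous (K := R_AbsRing) (V := R_NormedModule)); auto_derive; auto.
      apply (continuous_comp (p (S n)) (fun x => (coefQ n (S n) * x) ^ 2)); [apply Hpc|].
      apply (ex_derive_continuous (K := R_AbsRing) (V := R_NormedModule)); auto_derive; auto.
    intros z _; apply Rmult_le_pos; [left; apply exp_pos|apply pow2_ge_0].
  assert (E' : kappa * p n s ^ 2 <= exp (1 / 2) * B1 * exp (- s / 2)).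
    apply Rle_trans with (1 := Hlow (fun i => p i s)).
    apply Rmult_le_reg_l with (exp (s / 2)); [apply exp_pos|].
    replace (exp (s / 2) * (exp (1 / 2) * B1 * exp (- s / 2))) with (exp (1 / 2) * B1).
      unfold B1; lra.
    replace (- s / 2) with (- (s / 2)) by field; rewrite exp_Ropp; field.
    apply Rgt_not_eq, exp_pos.
  apply Rsqr_incr_0; [|apply Rabs_pos|apply Rmult_le_pos; [apply sqrt_pos|left; apply exp_pos]].
  rewrite -Rsqr_abs Rsqr_mult Rsqr_sqrt //.
  replace (Rsqr (exp (- s / 4))) with (exp (- s / 2)).
    2: unfold Rsqr; rewrite -exp_plus; f_equal; field.
  apply Rmult_le_reg_l with kappa; [exact Hkap|].
  unfold K, Rsqr; replace (kappa * (exp (1 / 2) * B1 / kappa * exp (- s / 2))) with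
    (exp (1 / 2) * B1 * exp (- s / 2)) by (field; lra).
  simpl in E'; lra.
destruct (G (fun i s => Re (ker_after n l b (N - i) s))) as [M1 [HM1 H1]].
  intros i s Hi; exact (proj1 (DB i s Hi)).
  intros s; exact (proj1 (continuous_ker_after _ s)).
  intros s; exact (proj1 (UB s)).
destruct (G (fun i s => Im (ker_after n l b (N - i) s))) as [M2 [HM2 H2]].
  intros i s Hi; exact (proj2 (DB i s Hi)).
  intros s; exact (proj2 (continuous_ker_after _ s)).
  intros s; exact (proj2 (UB s)).
exists (M1 + M2); intros s Hs; generalize (H1 s Hs) (H2 s Hs) (exp_pos (- s / 4)).
cbv beta; rewrite HN; intros; split; nra.
Qed.
End Kernel.

(** * The kernel in the mean *)

Lemma coefQ_last (n : nat) : coefQ n (S n) = INR (fact n) / INR (fact (2 * n + 1)).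
Proof.
unfold coefQ; rewrite (Nat.add_1_r n) Nat.sub_diag.
replace (2 * n + 1 - S n)%nat with n by lia; simpl (fact 0); simpl (INR 1).
field; repeat split; apply INR_fact_neq_0.
Qed.

Lemma Rpower_half_sq (x : R) (k : nat) : 0 < x -> (1 <= k)%nat ->
  Rpower x (- INR k + 1 / 2) * Rpower x (- INR k + 1 / 2) * x ^ (2 * k - 1) = 1.
Proof.
intros Hx Hk.
rewrite -Rpower_pow // -!Rpower_plus minus_INR; [|lia].
rewrite mult_INR; simpl (INR 2); simpl (INR 1).
replace (- INR k + 1 / 2 + (- INR k + 1 / 2) + ((1 + 1) * INR k - 1)) with 0 by field.
now apply Rpower_O.
Qed.

Lemma exp_half_le : exp (1 / 2) <= 7 / 4.
Proof.
apply Rsqr_incr_0; [|left; apply exp_pos|lra].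
unfold Rsqr; rewrite -exp_plus; replace (1 / 2 + 1 / 2) with 1 by field.
generalize exp_le_3; lra.
Qed.

(** The inequality between the arithmetic and the geometric mean of
    [theta exp (- s / 2)] and [exp (s / 2) |z| ^ 2 / theta]; it replaces the Cauchy-Schwarz
    inequality for the weight [exp (s / 2)]. *)
Lemma Cmod_AMGM (z : C) (s theta q : R) : 0 < theta -> 0 < q ->
  Cmod z <= / 2 * (theta * exp (- s / 2)) +
  / (2 * theta * q ^ 2) * (exp (s / 2) * (q * Re z) ^ 2 + exp (s / 2) * (q * Im z) ^ 2).
Proof.
intros Ht Hq.
assert (E : Cmod z * Cmod z = Re z ^ 2 + Im z ^ 2).
  unfold Cmod; rewrite sqrt_sqrt; [reflexivity|].
  generalize (pow2_ge_0 (fst z)) (pow2_ge_0 (snd z)); lra.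
replace (exp (s / 2) * (q * Re z) ^ 2 + exp (s / 2) * (q * Im z) ^ 2)
  with (q ^ 2 * exp (s / 2) * (Cmod z * Cmod z)) by (rewrite E; ring).
replace (- s / 2) with (- (s / 2)) by field; rewrite exp_Ropp.
generalize (exp_pos (s / 2)); set (e := exp (s / 2)); intros He; set (c := Cmod z).
assert (0 <= (theta / e - c) ^ 2 * (e / (2 * theta))).
  apply Rmult_le_pos; [apply pow2_ge_0|]; left; apply Rdiv_lt_0_compat; lra.
replace (/ (2 * theta * q ^ 2) * (q ^ 2 * e * (c * c))) with (e * (c * c) / (2 * theta)) by (field; lra).
replace ((theta / e - c) ^ 2 * (e / (2 * theta))) with
  (/ 2 * (theta * / e) + e * (c * c) / (2 * theta) - c) in H by (field; lra).
lra.
Qed.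

Lemma continuous_Cmod_comp (f : R -> C) (s : R) :
  continuous (fun s => Re (f s)) s -> continuous (fun s => Im (f s)) s ->
  continuous (fun s => Cmod (f s)) s.
Proof.
intros H1 H2; unfold Cmod.
apply (continuous_comp (fun s => fst (f s) ^ 2 + snd (f s) ^ 2) sqrt); [|apply continuous_sqrt].
apply (continuous_plus (V := R_NormedModule)).
  apply (continuous_comp (fun s => Re (f s)) (fun x => x ^ 2)); [exact H1|].
  apply (ex_derive_continuous (K := R_AbsRing) (V := R_NormedModule)); auto_derive; auto.
apply (continuous_comp (fun s => Im (f s)) (fun x => x ^ 2)); [exact H2|].
apply (ex_derive_continuous (K := R_AbsRing) (V := R_NormedModule)); auto_derive; auto.
Qed.

Lemma RInt_Cmod_le (f : R -> C) (a b theta q : R) : a <= b -> 0 < theta -> 0 < q ->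
  (forall s, continuous (fun s => Re (f s)) s) -> (forall s, continuous (fun s => Im (f s)) s) ->
  RInt (fun s => Cmod (f s)) a b <=
  theta * (exp (- a / 2) - exp (- b / 2)) + / (2 * theta * q ^ 2) *
   (RInt (fun s => exp (s / 2) * (q * Re (f s)) ^ 2) a b +
    RInt (fun s => exp (s / 2) * (q * Im (f s)) ^ 2) a b).
Proof.
intros Hab Ht Hq H1 H2.
assert (X : forall g : R -> R, (forall s, continuous g s) ->
  ex_RInt (fun s => exp (s / 2) * (q * g s) ^ 2) a b).
  intros g Hg; apply (ex_RInt_continuous (V := R_CompleteNormedModule)); intros s _.
  apply (continuous_mult (K := R_AbsRing) (fun s => exp (s / 2)) (fun s => (q * g s) ^ 2)).
    apply (ex_derive_continuous (K := R_AbsRing) (V := R_NormedModule)); auto_derive; auto.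
  apply (continuous_comp g (fun x => (q * x) ^ 2)); [apply Hg|].
  apply (ex_derive_continuous (K := R_AbsRing) (V := R_NormedModule)); auto_derive; auto.
assert (X1 := RInt_correct (V := R_CompleteNormedModule) _ _ _ (X _ H1)).
assert (X2 := RInt_correct (V := R_CompleteNormedModule) _ _ _ (X _ H2)).
assert (X0 : is_RInt (fun s => / 2 * (theta * exp (- s / 2))) a b (theta * (exp (- a / 2) - exp (- b / 2)))).
  replace (theta * (exp (- a / 2) - exp (- b / 2))) with
    (minus (- theta * exp (- b / 2)) (- theta * exp (- a / 2))).
    2: unfold minus, plus, opp; simpl; ring.
  apply (is_RInt_derive (V := R_CompleteNormedModule) (fun s => - theta * exp (- s / 2))).
    intros s _; auto_derive; [auto|]; unfold Rdiv; field.
  intros s _; apply (ex_derive_continuous (K := R_AbsRing) (V := R_NormedModule)); auto_derive; auto.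
apply (is_RInt_le (fun s => Cmod (f s)) (fun s => plus (/ 2 * (theta * exp (- s / 2)))
  (scal (/ (2 * theta * q ^ 2)) (plus (exp (s / 2) * (q * Re (f s)) ^ 2) (exp (s / 2) * (q * Im (f s)) ^ 2)))) a b).
- exact Hab.
- apply (RInt_correct (V := R_CompleteNormedModule)).
  apply (ex_RInt_continuous (V := R_CompleteNormedModule)); intros s _; now apply continuous_Cmod_comp.
- apply (is_RInt_plus (V := R_NormedModule)); [exact X0|].
  apply (is_RInt_scal (V := R_NormedModule)), (is_RInt_plus (V := R_NormedModule)); assumption.
- intros s _; exact (Cmod_AMGM (f s) s theta q Ht Hq).
Qed.

Section KernelL1.
Variables (n : nat) (l b : nat -> C).
Hypothesis roots : padeQ_roots n l.
Hypothesis fractions : pade_partial_fractions n l b.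

(** [7 / 6] is the product of [2 / 3] from [kernel_poly_norms] and of the bound [7 / 4] for
    the weight [exp (s / 2)] on [[0, 1]]. *)
Lemma input_norm (k : nat) : (1 <= k <= n)%nat ->
  INR (S n) ^ (2 * k - 1) * RInt (fun s => exp (s / 2) * inputP n (S n + k) s ^ 2) 0 1 <=
  7 / 6 * coefQ n (S n) ^ 2.
Proof.
intros Hk.
destruct (PolyEnergy.kernel_poly_norms n) as (h & H0 & Hd & Hn); [lia|].
assert (Hh : ex_RInt (fun s => h (S n - k)%nat s ^ 2) 0 1).
  apply (ex_RInt_continuous (V := R_CompleteNormedModule)); intros s _.
  apply (continuous_comp (h (S n - k)%nat) (fun x => x ^ 2));
    apply (ex_derive_continuous (K := R_AbsRing) (V := R_NormedModule)).
    eexists; apply Hd.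
  auto_derive; auto.
assert (Hle : RInt (fun s => exp (s / 2) * inputP n (S n + k) s ^ 2) 0 1 <=
  7 / 4 / INR (fact (2 * n + 1)) ^ 2 * RInt (fun s => h (S n - k)%nat s ^ 2) 0 1).
  assert (E : forall s, inputP n (S n + k) s = (-1) ^ n / INR (fact (2 * n + 1)) * h (S n - k)%nat s).
    intros s; rewrite -(inputP_kernel_poly n h) //; [|lia]; f_equal; lia.
  apply (is_RInt_le (fun s => exp (s / 2) * inputP n (S n + k) s ^ 2)
    (fun s => scal (7 / 4 / INR (fact (2 * n + 1)) ^ 2) (h (S n - k)%nat s ^ 2)) 0 1); [lra| | |].
  - apply (RInt_correct (V := R_CompleteNormedModule)).
    apply (ex_RInt_continuous (V := R_CompleteNormedModule)); intros s _.
    apply (continuous_mult (K := R_AbsRing) (fun s => exp (s / 2)) (fun s => inputP n (S n + k) s ^ 2)).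
      apply (ex_derive_continuous (K := R_AbsRing) (V := R_NormedModule)); auto_derive; auto.
    apply (continuous_comp (inputP n (S n + k)) (fun x => x ^ 2));
      apply (ex_derive_continuous (K := R_AbsRing) (V := R_NormedModule)).
      replace (S n + k)%nat with (S (n + k)) by lia; eexists; apply is_derive_inputP; lia.
    auto_derive; auto.
  - apply (is_RInt_scal (V := R_NormedModule)); now apply (RInt_correct (V := R_CompleteNormedModule)).
  - intros s Hs; rewrite E.
    assert (exp (s / 2) <= 7 / 4).
      apply Rle_trans with (2 := exp_half_le); left; apply exp_increasing; lra.
    assert (E1 : (-1) ^ n * (-1) ^ n = 1).
      rewrite -Rpow_mult_distr; replace (-1 * -1) with 1 by ring; apply pow1.
    assert (F : INR (fact (2 * n + 1)) <> 0) by apply INR_fact_neq_0.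
    change (exp (s / 2) * ((-1) ^ n / INR (fact (2 * n + 1)) * h (S n - k)%nat s) ^ 2 <=
      7 / 4 / INR (fact (2 * n + 1)) ^ 2 * h (S n - k)%nat s ^ 2).
    generalize dependent (INR (fact (2 * n + 1))); intros F0 _ HF.
    generalize (h (S n - k)%nat s); intros x.
    replace (((-1) ^ n / F0 * x) ^ 2) with (((-1) ^ n * (-1) ^ n) * (x / F0) ^ 2) by (field; exact HF).
    replace (7 / 4 / F0 ^ 2 * x ^ 2) with (7 / 4 * (x / F0) ^ 2) by (field; exact HF).
    rewrite E1 Rmult_1_l; apply Rmult_le_compat_r; [apply pow2_ge_0|assumption].
assert (Hm : (S n - k <= n)%nat) by lia.
specialize (Hn _ Hm); replace (2 * (n - (S n - k)) + 1)%nat with (2 * k - 1)%nat in Hn by lia.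
assert (HI : 0 <= INR (S n) ^ (2 * k - 1)) by (apply pow_le, pos_INR).
apply Rle_trans with (7 / 4 / INR (fact (2 * n + 1)) ^ 2 * (INR (S n) ^ (2 * k - 1) * RInt (fun s => h (S n - k)%nat s ^ 2) 0 1)).
  replace (7 / 4 / INR (fact (2 * n + 1)) ^ 2 * (INR (S n) ^ (2 * k - 1) * RInt (fun s => h (S n - k)%nat s ^ 2) 0 1))
   with (INR (S n) ^ (2 * k - 1) * (7 / 4 / INR (fact (2 * n + 1)) ^ 2 * RInt (fun s => h (S n - k)%nat s ^ 2) 0 1)) by ring.
  now apply Rmult_le_compat_l.
apply Rle_trans with (7 / 4 / INR (fact (2 * n + 1)) ^ 2 * (2 / 3 * INR (fact n) ^ 2)).
  apply Rmult_le_compat_l; [|exact Hn].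
  apply Rdiv_le_0_compat; [lra|apply pow_lt, INR_fact_lt_0].
rewrite coefQ_last; right; field; apply INR_fact_neq_0.
Qed.

(** [Cmod_AMGM] with [theta = (n + 1) ^ (1 / 2 - k)] balances the two terms: they are at
    most [theta] and [7 / 12 theta]. *)
Lemma kernel_L1 (k : nat) (T : R) : (1 <= k <= n)%nat -> 1 <= T ->
  RInt (fun s => Cmod (ker_before n l b k s)) 0 1 + RInt (fun s => Cmod (ker_after n l b k s)) 1 T <=
  2 * Rpower (INR n + 1) (- INR k + 1 / 2).
Proof.
intros Hk HT.
set (theta := Rpower (INR n + 1) (- INR k + 1 / 2)).
assert (Ht : 0 < theta) by (unfold theta, Rpower; apply exp_pos).
assert (Hq := coefQ_pos n (S n)).
assert (H1 := RInt_Cmod_le (ker_before n l b k) 0 1 theta (coefQ n (S n)) Rle_0_1 Ht Hq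
  (fun s => proj1 (continuous_ker_before n l b roots k s)) (fun s => proj2 (continuous_ker_before n l b roots k s))).
assert (H2 := RInt_Cmod_le (ker_after n l b k) 1 T theta (coefQ n (S n)) HT Ht Hq
  (fun s => proj1 (continuous_ker_after n l b roots k s)) (fun s => proj2 (continuous_ker_after n l b roots k s))).
assert (H3 := kernel_energy n l b roots fractions k T Hk HT).
assert (H4 := input_norm k Hk).
assert (HN : 0 < INR n + 1) by (generalize (pos_INR n); lra).
assert (Hth : theta * theta * INR (S n) ^ (2 * k - 1) = 1).
  rewrite S_INR; apply Rpower_half_sq; [exact HN|lia].
generalize dependent (RInt (fun s => exp (s / 2) * inputP n (S n + k) s ^ 2) 0 1 : R); intros I0 H3 H4.
assert (H5 : I0 <= 7 / 6 * coefQ n (S n) ^ 2 * (theta * theta)).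
  apply Rle_trans with ((INR (S n) ^ (2 * k - 1) * I0) * (theta * theta)).
    right; replace (INR (S n) ^ (2 * k - 1) * I0 * (theta * theta)) with
      ((theta * theta * INR (S n) ^ (2 * k - 1)) * I0) by ring; rewrite Hth; ring.
  apply Rmult_le_compat_r; [nra|exact H4].
set (q := coefQ n (S n)) in *.
set (c := / (2 * theta * q ^ 2)) in H1, H2.
assert (Hc : 0 < c) by (apply Rinv_0_lt_compat, Rmult_lt_0_compat; [lra|now apply pow_lt]).
assert (H6 : c * I0 <= 7 / 12 * theta).
  apply Rle_trans with (c * (7 / 6 * q ^ 2 * (theta * theta))); [now apply Rmult_le_compat_l; [lra|]|].
  right; unfold c; field; lra.
assert (H7 := Rmult_le_compat_l c _ _ (Rlt_le _ _ Hc) H3).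
replace (exp (- 0 / 2)) with 1 in H1.
  2: replace (- 0 / 2) with 0 by field; now rewrite exp_0.
assert (H8 := Rmult_lt_0_compat _ _ Ht (exp_pos (- T / 2))).
lra.
Qed.
End KernelL1.

(** * Complex scalars in real calculus *)

Section VectorValued.
Context {X : CompleteNormedModule C_AbsRing}.

(** Reduces complex scalars to real ones and to the fixed real-linear map [scal Ci]. *)
Lemma scal_C_split (c : C) (u : X) :
  scal c u = plus (scal (RtoC (Re c)) u) (scal (RtoC (Im c)) (scal (Ci : C_AbsRing) u)).
Proof.
rewrite scal_assoc -scal_distr_r; f_equal.
unfold plus, mult; simpl; destruct c as [x y]; unfold Cmult, Cplus, RtoC, Ci, Re, Im; simpl.
f_equal; ring.
Qed.

Lemma is_linear_scalC (c : C) :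
  is_linear (U := realify X) (V := realify X) (fun u => scal (c : C_AbsRing) (u : X)).
Proof.
split.
- intros x y; exact (scal_distr_l c x y).
- intros r x; change (scal (c : C_AbsRing) (scal (RtoC r : C_AbsRing) (x : X)) =
    scal (RtoC r : C_AbsRing) (scal (c : C_AbsRing) (x : X))).
  rewrite !scal_assoc; f_equal; exact (Cmult_comm c (RtoC r)).
- exists (Cmod c + 1); split; [generalize (Cmod_ge_0 c); lra|].
  intros x; apply Rle_trans with (Cmod c * norm (x : X)); [exact (norm_scal c (x : X))|].
  apply Rmult_le_compat_r; [apply norm_ge_0|lra].
Qed.

Lemma is_derive_realscal (f : R -> R) (g : R -> X) (s df : R) (dg : X) :
  is_derive f s df -> is_derive (V := realify X) g s dg ->
  is_derive (V := realify X) (fun s => scal (RtoC (f s) : C_AbsRing) (g s)) s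
    (plus (scal (RtoC df : C_AbsRing) (g s)) (scal (RtoC (f s) : C_AbsRing) dg)).
Proof.
intros Hf Hg.
generalize (filterdiff_scal_fct (V := realify X) s f g _ _ Rmult_comm Hf Hg).
intros HD; apply (filterdiff_ext_lin _ _ _ HD); intros y.
change (plus (scal (RtoC (y * df) : C_AbsRing) (g s)) (scal (RtoC (f s) : C_AbsRing) (scal (RtoC y : C_AbsRing) dg)) =
  scal (RtoC y : C_AbsRing) (plus (scal (RtoC df : C_AbsRing) (g s)) (scal (RtoC (f s) : C_AbsRing) dg))).
rewrite scal_distr_l !scal_assoc; f_equal; f_equal.
  exact (RtoC_mult y df).
exact (Cmult_comm _ _).
Qed.

Lemma is_derive_scalC_const (c : C) (g : R -> X) (s : R) (dg : X) :
  is_derive (V := realify X) g s dg ->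
  is_derive (V := realify X) (fun s => scal (c : C_AbsRing) (g s)) s (scal (c : C_AbsRing) dg).
Proof.
intros Hg.
generalize (filterdiff_comp' (V := realify X) (W := realify X) g (fun u => scal (c : C_AbsRing) (u : X)) s _ _ Hg
  (filterdiff_linear (U := realify X) (V := realify X) _ (is_linear_scalC c))).
intros HD; apply (filterdiff_ext_lin _ _ _ HD); intros y.
exact (linear_scal _ (is_linear_scalC c) y dg).
Qed.

Lemma is_derive_scalC (k : R -> C) (g : R -> X) (s : R) (dk : C) (dg : X) :
  is_deriveC k s dk -> is_derive (V := realify X) g s dg ->
  is_derive (V := realify X) (fun s => scal (k s : C_AbsRing) (g s)) s
    (plus (scal (dk : C_AbsRing) (g s)) (scal (k s : C_AbsRing) dg)).
Proof.
intros [H1 H2] Hg.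
assert (HJ : is_derive (V := realify X) (fun s => scal (Ci : C_AbsRing) (g s)) s (scal (Ci : C_AbsRing) dg)).
  now apply is_derive_scalC_const.
apply (is_derive_ext (V := realify X) (fun s => plus (scal (RtoC (Re (k s)) : C_AbsRing) (g s))
   (scal (RtoC (Im (k s)) : C_AbsRing) (scal (Ci : C_AbsRing) (g s))))).
  intros t; symmetry; exact (scal_C_split (k t) (g t)).
evar_last.
  apply (is_derive_plus (V := realify X)).
    apply (is_derive_realscal _ _ _ _ _ H1 Hg).
  apply (is_derive_realscal _ _ _ _ _ H2 HJ).
rewrite (scal_C_split dk) (scal_C_split (k s)).
set (p := scal _ (g s)); set (q := scal _ dg).
change (plus (plus p q) (plus (scal (RtoC (Im dk) : C_AbsRing) (scal (Ci : C_AbsRing) (g s))) (scal (RtoC (Im (k s)) : C_AbsRing) (scal (Ci : C_AbsRing) dg))) = 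
 plus (plus p (scal (RtoC (Im dk) : C_AbsRing) (scal (Ci : C_AbsRing) (g s)))) (plus q (scal (RtoC (Im (k s)) : C_AbsRing) (scal (Ci : C_AbsRing) dg))) :> X).
rewrite -!plus_assoc; f_equal; rewrite !plus_assoc; f_equal; apply plus_comm.
Qed.

Lemma continuous_scalC (k : R -> C) (g : R -> X) (s : R) :
  continuous (fun s => Re (k s)) s -> continuous (fun s => Im (k s)) s ->
  continuous (g : R -> realify X) s ->
  continuous (U := realify X) (fun s => scal (k s : C_AbsRing) (g s)) s.
Proof.
intros H1 H2 Hg.
apply (continuous_ext (U := realify X) (fun s => plus (scal (RtoC (Re (k s)) : C_AbsRing) (g s))
   (scal (RtoC (Im (k s)) : C_AbsRing) (scal (Ci : C_AbsRing) (g s))))).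
  intros t; symmetry; exact (scal_C_split (k t) (g t)).
apply (continuous_plus (V := realify X)).
  exact (continuous_scal (V := realify X) (fun s => Re (k s)) g s H1 Hg).
apply (continuous_scal (V := realify X) (fun s => Im (k s)) (fun s => scal (Ci : C_AbsRing) (g s)) s H2).
exact (continuous_scal_r (V := X) Ci g s Hg).
Qed.
End VectorValued.

(** * Repeated integration by parts *)

Lemma is_deriveC_scale (H : R -> C) (t s : R) (d : C) :
  is_deriveC H (s / t) d -> is_deriveC (fun s => H (s / t)) s (RtoC (/ t) * d)%C.
Proof.
intros [H1 H2].
assert (Hs : is_derive (fun s => s / t) s (/ t)) by (unfold Rdiv; auto_derive; [auto|ring]).
split.
  replace (Re (RtoC (/ t) * d)%C) with (scal (/ t) (Re d)).
    exact (is_derive_comp (fun s => Re (H s)) (fun s => s / t) s _ _ H1 Hs).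
  unfold Re; simpl; unfold scal; simpl; unfold mult; simpl; ring.
replace (Im (RtoC (/ t) * d)%C) with (scal (/ t) (Im d)).
  exact (is_derive_comp (fun s => Im (H s)) (fun s => s / t) s _ _ H2 Hs).
unfold Im; simpl; unfold scal; simpl; unfold mult; simpl; ring.
Qed.

Section Concomitant.
Context {X : CompleteNormedModule C_AbsRing}.

(** The boundary terms of [k] integrations by parts, with the primitives [H i] of the
    kernel at the scale [t]. *)
Fixpoint concomitant (t : R) (H : nat -> R -> C) (phi : nat -> R -> X) (k : nat) (s : R) : X :=
  match k with
  | O => zero
  | S i => plus (concomitant t H phi i s)
             (scal (RtoC ((- t) ^ i) * H (S i) (s / t)%R)%C (phi i s))
  end.

Lemma minus_plus_minus (u v w : X) : plus (minus u v) (minus v w) = minus u w.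
Proof.
unfold minus; rewrite -plus_assoc (plus_assoc (opp v)) plus_opp_l plus_zero_l //.
Qed.

(** The derivatives of consecutive terms cancel in pairs, and only the first and the last
    integrand survive. *)
Lemma is_derive_concomitant (t : R) (H : nat -> R -> C) (phi : nat -> R -> X) (k : nat) (s : R) :
  t <> 0 ->
  (forall i, (i < k)%nat -> is_deriveC (H (S i)) (s / t) (H i (s / t))) ->
  (forall i, (i < k)%nat -> is_derive (V := realify X) (phi i) s (phi (S i) s)) ->
  is_derive (V := realify X) (concomitant t H phi k) s
    (minus (scal (RtoC (/ t) * H O (s / t)%R)%C (phi O s))
           (scal (RtoC ((- t) ^ k / t) * H k (s / t)%R)%C (phi k s))).
Proof.
intros Ht; induction k as [|k IH]; intros HH Hp.
  replace (RtoC ((- t) ^ 0 / t)) with (RtoC (/ t)) by (f_equal; simpl; field; exact Ht).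
  rewrite /minus plus_opp_r; exact (is_derive_const (V := realify X) (zero : X) s).
assert (IH' := IH (fun i Hi => HH i (Nat.lt_lt_succ_r _ _ Hi)) (fun i Hi => Hp i (Nat.lt_lt_succ_r _ _ Hi))).
assert (D := is_derive_scalC _ _ _ _ _
  (is_deriveC_mult_l (RtoC ((- t) ^ k)) _ _ _ (is_deriveC_scale _ _ _ _ (HH k (Nat.lt_succ_diag_r k))))
  (Hp k (Nat.lt_succ_diag_r k))).
evar_last.
  exact (is_derive_plus (V := realify X) _ _ _ _ _ IH' D).
etransitivity; [|apply (minus_plus_minus _ (scal (RtoC ((- t) ^ k / t) * H k (s / t)%R)%C (phi k s)))].
f_equal; unfold minus; f_equal.
  f_equal; unfold Rdiv; rewrite RtoC_mult; ring.
rewrite -scal_opp_l; f_equal.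
replace ((- t) ^ S k / t) with (- (- t) ^ k) by (simpl; field; exact Ht).
rewrite RtoC_opp; unfold opp; simpl; ring.
Qed.

Lemma continuous_scale (f : R -> R) (t s : R) :
  (forall s, continuous f s) -> continuous (fun s => f (s / t)) s.
Proof.
intros Hf; apply (continuous_comp (fun s => s / t) f); [|apply Hf].
apply (ex_derive_continuous (K := R_AbsRing) (V := R_NormedModule)); unfold Rdiv; auto_derive; auto.
Qed.

Lemma is_RInt_scale (f : R -> R) (t a b : R) : 0 < t ->
  (forall s, continuous f s) ->
  is_RInt (fun s => f (s / t)) a b (t * RInt f (a / t) (b / t)).
Proof.
intros Ht Hf.
apply (is_RInt_ext (fun s => scal t (scal (/ t) (f (/ t * s + 0))))).
  intros s _; unfold scal; simpl; unfold mult; simpl.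
  replace (/ t * s + 0) with (s / t) by (unfold Rdiv; ring); field; lra.
apply (is_RInt_scal (V := R_NormedModule)).
apply (is_RInt_comp_lin (V := R_NormedModule)).
replace (/ t * a + 0) with (a / t) by (unfold Rdiv; ring).
replace (/ t * b + 0) with (b / t) by (unfold Rdiv; ring).
apply (RInt_correct (V := R_CompleteNormedModule)).
apply (ex_RInt_continuous (V := R_CompleteNormedModule)); auto.
Qed.

Lemma concomitant_parts (t : R) (H : nat -> R -> C) (phi : nat -> R -> X) (k : nat) (a b L : R) :
  0 < t -> 0 <= a <= b ->
  (forall i s, is_deriveC (H (S i)) s (H i s)) ->
  (forall i s, continuous (fun s => Re (H i s)) s /\ continuous (fun s => Im (H i s)) s) ->
  (forall i s, (i < k)%nat -> 0 <= s -> is_derive (V := realify X) (phi i) s (phi (S i) s)) ->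
  (forall s, 0 <= s -> continuous (phi k : R -> realify X) s) ->
  (forall s, 0 <= s -> norm (phi k s) <= L) ->
  exists W : X,
    is_RInt (V := realify X) (fun s => scal (RtoC (/ t) * H O (s / t)%R)%C (phi O s)) a b
      (plus (minus (concomitant t H phi k b) (concomitant t H phi k a)) W) /\
    norm W <= t ^ k * L * RInt (fun s => Cmod (H k s)) (a / t) (b / t).
Proof.
intros Ht Hab HH Hc Hp Hpk HL.
assert (HcC : forall (c : C) i s, continuous (fun s => Re (c * H i (s / t)%R)%C) s /\
  continuous (fun s => Im (c * H i (s / t)%R)%C) s).
  intros c i s.
  assert (H1 : continuous (fun s => Re (H i (s / t))) s).
    apply (continuous_scale (fun s => Re (H i s))); intros r; apply Hc.
  assert (H2 : continuous (fun s => Im (H i (s / t))) s).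
    apply (continuous_scale (fun s => Im (H i s))); intros r; apply Hc.
  split.
    apply (continuous_minus (V := R_NormedModule) (fun s => Re c * Re (H i (s / t))) (fun s => Im c * Im (H i (s / t))));
      now apply (continuous_scal_r (V := R_NormedModule)).
  apply (continuous_plus (V := R_NormedModule) (fun s => Re c * Im (H i (s / t))) (fun s => Im c * Re (H i (s / t))));
    now apply (continuous_scal_r (V := R_NormedModule)).
assert (Hmm : forall z, Rmin a b <= z <= Rmax a b -> 0 <= z).
  intros z; rewrite Rmin_left; lra.
assert (Hp0 : forall s, 0 <= s -> continuous (phi O : R -> realify X) s).
  intros s Hs; destruct k as [|k]; [now apply Hpk|].
  apply (ex_derive_continuous (V := realify X)); eexists; apply Hp; [lia|exact Hs].
assert (C0 : forall s, 0 <= s -> continuous (U := realify X) (fun s => scal (RtoC (/ t) * H O (s / t)%R)%C (phi O s)) s).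
  intros s Hs; apply continuous_scalC; [apply HcC|apply HcC|now apply Hp0].
assert (Ck : forall s, 0 <= s -> continuous (U := realify X) (fun s => scal (RtoC ((- t) ^ k / t) * H k (s / t)%R)%C (phi k s)) s).
  intros s Hs; apply continuous_scalC; [apply HcC|apply HcC|now apply Hpk].
assert (IW : ex_RInt (V := realify X) (fun s => scal (RtoC ((- t) ^ k / t) * H k (s / t)%R)%C (phi k s)) a b).
  apply (ex_RInt_continuous (V := realify X)); intros z Hz; apply Ck; auto.
destruct IW as [W HW]; exists W; split.
- apply (is_RInt_ext (V := realify X) (fun s => plus
    (minus (scal (RtoC (/ t) * H O (s / t)%R)%C (phi O s)) (scal (RtoC ((- t) ^ k / t) * H k (s / t)%R)%C (phi k s)))
    (scal (RtoC ((- t) ^ k / t) * H k (s / t)%R)%C (phi k s)))).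
    intros s _.
    change (plus (minus (scal (RtoC (/ t) * H O (s / t)%R)%C (phi O s)) (scal (RtoC ((- t) ^ k / t) * H k (s / t)%R)%C (phi k s)))
      (scal (RtoC ((- t) ^ k / t) * H k (s / t)%R)%C (phi k s)) = scal (RtoC (/ t) * H O (s / t)%R)%C (phi O s) :> X).
    by rewrite /minus -plus_assoc plus_opp_l plus_zero_r.
  apply (is_RInt_plus (V := realify X)); [|exact HW].
  apply (is_RInt_derive (V := realify X) (concomitant t H phi k)).
    intros s Hs; apply is_derive_concomitant; [lra|intros; apply HH|intros; apply Hp; auto].
  intros s Hs; apply (continuous_minus (V := realify X)); [apply C0|apply Ck]; auto.
- assert (HL0 : 0 <= L) by (apply Rle_trans with (2 := HL a (proj1 Hab)); apply norm_ge_0).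
  assert (HI := is_RInt_scale (fun s => Cmod (H k s)) t a b Ht
    (fun s => continuous_Cmod_comp (H k) s (proj1 (Hc k s)) (proj2 (Hc k s)))).
  assert (HI2 := is_RInt_scal (V := R_NormedModule) _ _ _ (t ^ k / t * L) _ HI).
  replace (t ^ k * L * RInt (fun s => Cmod (H k s)) (a / t) (b / t)) with
    (scal (t ^ k / t * L) (t * RInt (fun s => Cmod (H k s)) (a / t) (b / t))).
    2: unfold scal; simpl; unfold mult; simpl; field; lra.
  refine (norm_RInt_le (V := realify X) _ _ a b W _ (proj2 Hab) _ HW HI2).
  intros s Hs.
  change (norm (scal (RtoC ((- t) ^ k / t) * H k (s / t)%R)%C (phi k s)) <= t ^ k / t * L * Cmod (H k (s / t))).
  apply Rle_trans with (1 := norm_scal (V := X) (RtoC ((- t) ^ k / t) * H k (s / t)%R)%C (phi k s)).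
  change (Cmod (RtoC ((- t) ^ k / t) * H k (s / t)) * norm (phi k s) <= t ^ k / t * L * Cmod (H k (s / t))).
  rewrite Cmod_mult Cmod_R; unfold Rdiv; rewrite Rabs_mult -RPow_abs Rabs_Ropp.
  rewrite (Rabs_pos_eq t); [|lra]; rewrite (Rabs_pos_eq (/ t)); [|left; now apply Rinv_0_lt_compat].
  replace (t ^ k * / t * L * Cmod (H k (s * / t))) with (t ^ k * / t * Cmod (H k (s * / t)) * L) by ring.
  apply Rmult_le_compat_l; [|apply HL; lra].
  apply Rmult_le_pos; [|apply Cmod_ge_0].
  apply Rmult_le_pos; [apply pow_le; lra|left; now apply Rinv_0_lt_compat].
Qed.
End Concomitant.

(** * The error for smooth functions *)

Lemma plus_minus_regroup (G : AbelianGroup) (p q f u v : G) :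
  plus q (plus u v) = minus (plus (plus (minus (plus p f) zero) u) (plus (minus q p) v)) f.
Proof.
rewrite /minus opp_zero plus_zero_r.
rewrite (plus_comm (plus (plus (plus p f) u) (plus (plus q (opp p)) v)) (opp f)).
rewrite (plus_comm p f) -!plus_assoc (plus_assoc (opp f) f) plus_opp_l plus_zero_l.
rewrite (plus_comm (opp p) v) (plus_comm p) -!plus_assoc.
rewrite plus_opp_l plus_zero_r (plus_assoc q) (plus_comm q u) -plus_assoc //.
Qed.

Section KernelError.
Context {X : CompleteNormedModule C_AbsRing}.
Variables (n : nat) (l b : nat -> C).
Hypothesis roots : padeQ_roots n l.
Hypothesis fractions : pade_partial_fractions n l b.

Lemma norm_triangle_X (u v : X) : norm (plus u v) <= norm u + norm v.
Proof. exact (norm_triangle (V := X) u v). Qed.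

Lemma norm_scal_X (c : C) (u : X) : norm (scal c u) <= Cmod c * norm u.
Proof. exact (norm_scal (V := X) c u). Qed.

Lemma concomitant_zero (t : R) (phi : nat -> R -> X) (k : nat) :
  concomitant t (ker_before n l b) phi k 0 = zero.
Proof.
induction k as [|k IH]; simpl; [reflexivity|].
rewrite IH plus_zero_l; replace (0 / t) with 0 by (unfold Rdiv; ring).
rewrite (ker_before_at_0 n l b roots); replace (RtoC ((- t) ^ k) * 0)%C with (zero : C) by (unfold zero; simpl; ring).
exact (scal_zero_l (V := X) (phi k 0)).
Qed.

(** Only the primitive of order one jumps at [1], by the unit mass. *)
Lemma concomitant_jump (t : R) (phi : nat -> R -> X) (k : nat) : 0 < t ->
  concomitant t (ker_before n l b) phi (S k) t = plus (concomitant t (ker_after n l b) phi (S k) t) (phi O t).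
Proof.
intros Ht; induction k as [|k IH].
  simpl; rewrite !plus_zero_l; replace (t / t) with 1 by (field; lra).
  rewrite (ker_after_1_at_1 n l b).
  rewrite -{3}(scal_one (phi O t)) -scal_distr_r; f_equal.
  unfold plus, one; simpl; ring.
change (plus (concomitant t (ker_before n l b) phi (S k) t) (scal (RtoC ((- t) ^ S k) * ker_before n l b (S (S k)) (t / t)%R)%C (phi (S k) t))
  = plus (plus (concomitant t (ker_after n l b) phi (S k) t) (scal (RtoC ((- t) ^ S k) * ker_after n l b (S (S k)) (t / t)%R)%C (phi (S k) t))) (phi O t)).
rewrite IH; replace (t / t) with 1 by (field; lra); rewrite ker_after_at_1.
generalize (concomitant t (ker_after n l b) phi (S k) t); intros p.
rewrite -!plus_assoc; f_equal; apply plus_comm.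
Qed.

(** Integration by parts on [[0, t]] with [ker_before] and on [[t, T]] with [ker_after]; the
    boundary terms at [t] differ by the value [phi O t] of the function itself. *)
Lemma kernel_error (phi : nat -> R -> X) (k : nat) (t T L : R) :
  0 < t -> t <= T -> (1 <= k <= n)%nat ->
  (forall i s, (i < k)%nat -> 0 <= s -> is_derive (V := realify X) (phi i) s (phi (S i) s)) ->
  (forall s, 0 <= s -> continuous (phi k : R -> realify X) s) ->
  (forall s, 0 <= s -> norm (phi k s) <= L) ->
  exists J : X,
    is_RInt (V := realify X) (fun s => scal (RtoC (/ t) * ker_before n l b O (s / t)%R)%C (phi O s)) 0 T J /\
    norm (minus J (phi O t)) <= norm (concomitant t (ker_after n l b) phi k T) +
      t ^ k * L * (2 * Rpower (INR n + 1) (- INR k + 1 / 2)).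
Proof.
intros Ht HT Hk Hp Hpk HL.
destruct (concomitant_parts t (ker_before n l b) phi k 0 t L) as (W1 & HI1 & HW1); auto; [lra| | |].
  intros i s; now apply is_deriveC_ker_before.
  intros i s; now apply continuous_ker_before.
destruct (concomitant_parts t (ker_after n l b) phi k t T L) as (W2 & HI2 & HW2); auto; [lra| | |].
  intros i s; now apply is_deriveC_ker_after.
  intros i s; now apply continuous_ker_after.
assert (HE : forall s, Rmin t T < s < Rmax t T ->
  scal (RtoC (/ t) * ker_after n l b O (s / t)%R)%C (phi O s) = scal (RtoC (/ t) * ker_before n l b O (s / t)%R)%C (phi O s)).
  intros s _; now rewrite ker_after_0.
assert (HI2' := is_RInt_ext (V := realify X) _ _ _ _ _ HE HI2).
eexists; split; [exact (is_RInt_Chasles (V := realify X) _ 0 t T _ _ HI1 HI2')|].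
rewrite concomitant_zero.
destruct k as [|k]; [lia|].
rewrite concomitant_jump //.
set (p := concomitant t (ker_after n l b) phi (S k) t); set (q := concomitant t (ker_after n l b) phi (S k) T).
set (f := phi O t).
match goal with |- norm ?e <= _ => replace e with (plus q (plus W1 W2)) end.
  apply Rle_trans with (1 := norm_triangle_X _ _).
  apply Rplus_le_compat_l; apply Rle_trans with (1 := norm_triangle_X _ _).
  apply Rle_trans with (t ^ S k * L * (RInt (fun s => Cmod (ker_before n l b (S k) s)) 0 1 + RInt (fun s => Cmod (ker_after n l b (S k) s)) 1 (T / t))).
    replace (0 / t) with 0 in HW1 by (unfold Rdiv; ring).
    replace (t / t) with 1 in HW1 by (field; lra).
    replace (t / t) with 1 in HW2 by (field; lra).
    rewrite Rmult_plus_distr_l; apply Rplus_le_compat; assumption.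
  apply Rmult_le_compat_l.
    apply Rmult_le_pos; [apply pow_le; lra|].
    apply Rle_trans with (2 := HL 0 (Rle_refl 0)); apply norm_ge_0.
  apply (kernel_L1 n l b roots fractions (S k)); [lia|].
  apply Rmult_le_reg_r with t; [exact Ht|]; unfold Rdiv; rewrite Rmult_assoc Rinv_l; lra.
change (plus q (plus W1 W2) = minus (plus (plus (minus (plus p f) zero) W1) (plus (minus q p) W2)) f :> X).
exact (plus_minus_regroup (CompleteNormedModule.AbelianGroup C_AbsRing X) p q f W1 W2).
Qed.

Lemma concomitant_vanish (phi : nat -> R -> X) (k : nat) (t : R) :
  0 < t -> (k <= S n)%nat ->
  (forall i, (i < k)%nat -> exists M, forall s, 0 <= s -> norm (phi i s) <= M) ->
  exists K, 0 <= K /\ forall T, t <= T -> norm (concomitant t (ker_after n l b) phi k T) <= K * exp (- (T / t) / 4).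
Proof.
intros Ht; induction k as [|k IH]; intros Hk Hb.
  exists 0; split; [lra|]; intros T _; simpl; rewrite norm_zero; lra.
destruct IH as (K & HK & HI); [lia|intros; apply Hb; lia|].
destruct (Hb k) as [M HM]; [lia|].
destruct (ker_after_decay n l b roots fractions k) as [D HD]; [lia|].
assert (HM0 : 0 <= M) by (apply Rle_trans with (2 := HM 0 (Rle_refl 0)); apply norm_ge_0).
assert (HD0 : 0 <= D).
  destruct (HD 1 (Rle_refl 1)) as [H _].
  generalize (exp_pos (- (1) / 4)) (Rabs_pos (Re (ker_after n l b (S k) 1))); intros; nra.
exists (K + t ^ k * (2 * D) * M).
assert (Htk : 0 <= t ^ k) by (apply pow_le; lra).
assert (Hpos : 0 <= t ^ k * (2 * D) * M) by (apply Rmult_le_pos; [apply Rmult_le_pos; lra|lra]).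
split; [lra|]; intros T HT; simpl.
apply Rle_trans with (1 := norm_triangle_X _ _).
rewrite Rmult_plus_distr_r; apply Rplus_le_compat; [now apply HI|].
apply Rle_trans with (1 := norm_scal_X _ _).
rewrite Cmod_mult Cmod_R -RPow_abs Rabs_Ropp Rabs_pos_eq; [|lra].
assert (HT1 : 1 <= T / t).
  apply Rmult_le_reg_r with t; [exact Ht|]; unfold Rdiv; rewrite Rmult_assoc Rinv_l; lra.
destruct (HD _ HT1) as [H1 H2].
assert (HC : Cmod (ker_after n l b (S k) (T / t)) <= 2 * D * exp (- (T / t) / 4)).
  apply Rle_trans with (Rabs (Re (ker_after n l b (S k) (T / t))) + Rabs (Im (ker_after n l b (S k) (T / t)))); [|lra].
  set (z := ker_after n l b (S k) (T / t)).
  replace z with (RtoC (Re z) + Ci * RtoC (Im z))%C at 1.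
    apply Rle_trans with (1 := Cmod_triangle _ _).
    rewrite Cmod_mult !Cmod_R; unfold Cmod, Ci; simpl.
    replace (0 * (0 * 1) + 1 * (1 * 1)) with 1 by ring; rewrite sqrt_1; lra.
  destruct z as [x y]; unfold RtoC, Ci, Cplus, Cmult, Re, Im; simpl; f_equal; ring.
replace (t ^ k * (2 * D) * M * exp (- (T / t) / 4)) with ((t ^ k * (2 * D * exp (- (T / t) / 4))) * M) by ring.
apply Rmult_le_compat; [|apply norm_ge_0| |apply HM; lra].
  apply Rmult_le_pos; [exact Htk|apply Cmod_ge_0].
now apply Rmult_le_compat_l.
Qed.
End KernelError.

(** * Laplace transforms as limits *)

Lemma Cmod_Cexp (z : C) : Cmod (Cexp z) = exp (Re z).
Proof.
unfold Cmod, Cexp; simpl.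
replace (exp (Re z) * cos (Im z) * (exp (Re z) * cos (Im z) * 1) + exp (Re z) * sin (Im z) * (exp (Re z) * sin (Im z) * 1))
  with (Rsqr (exp (Re z)) * (Rsqr (sin (Im z)) + Rsqr (cos (Im z)))) by (unfold Rsqr; ring).
rewrite sin2_cos2 Rmult_1_r sqrt_Rsqr //; left; apply exp_pos.
Qed.

Lemma continuous_Cexp_line (l : C) (s : R) :
  continuous (fun s : R => Re (Cexp (- (l * s))%C)) s /\ continuous (fun s : R => Im (Cexp (- (l * s))%C)) s.
Proof.
destruct (is_deriveC_mode0 l s) as [H1 H2]; split;
  apply (ex_derive_continuous (K := R_AbsRing) (V := R_NormedModule)); eexists; eassumption.
Qed.

Section LaplaceTransform.
Context {X : CompleteNormedModule C_AbsRing}.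

(** [scal c] maps a primitive of [f] to a primitive of [scal c f]. *)
Lemma is_RInt_scalC (c : C) (f : R -> X) (a b : R) (J : X) :
  (forall s, continuous (f : R -> realify X) s) ->
  is_RInt (V := realify X) f a b J ->
  is_RInt (V := realify X) (fun s => scal (c : C_AbsRing) (f s)) a b (scal (c : C_AbsRing) J).
Proof.
intros Hf HJ.
set (F := fun s => RInt (V := realify X) f a s).
assert (HF : forall s, is_derive (V := realify X) F s (f s)).
  intros s; apply (is_derive_RInt (V := realify X) f F a); [|apply Hf].
  apply filter_forall; intros r; apply (RInt_correct (V := realify X)).
  apply (ex_RInt_continuous (V := realify X)); intros z _; apply Hf.
assert (HD : forall s, is_derive (V := realify X) (fun s => scal (c : C_AbsRing) (F s)) s (scal (c : C_AbsRing) (f s))).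
  intros s; apply is_derive_scalC_const, HF.
assert (HI := is_RInt_derive (V := realify X) _ _ a b (fun s _ => HD s)
  (fun s _ => continuous_scal_r (V := X) c f s (Hf s))).
replace (scal (c : C_AbsRing) J) with (minus (scal (c : C_AbsRing) (F b)) (scal (c : C_AbsRing) (F a)) : X).
  exact HI.
unfold F; rewrite (RInt_point (V := realify X)) (is_RInt_unique (V := realify X) _ _ _ _ HJ).
rewrite (scal_zero_r (V := X) c) /minus opp_zero; apply (plus_zero_r (G := CompleteNormedModule.AbelianMonoid _ X)).
Qed.

Definition Laplace_cut (f : R -> X) (l : C) (T : R) : X :=
  RInt (V := realify X) (fun s : R => scal (Cexp (- (l * s))%C) (f s)) 0 T.

Lemma continuous_Laplace_integrand (f : R -> X) (l : C) (s : R) :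
  (forall s, continuous (f : R -> realify X) s) ->
  continuous (U := realify X) (fun s : R => scal (Cexp (- (l * s))%C) (f s)) s.
Proof.
intros Hf; exact (continuous_scalC (fun s : R => Cexp (- (l * s))%C) f s
  (proj1 (continuous_Cexp_line l s)) (proj2 (continuous_Cexp_line l s)) (Hf s)).
Qed.

Lemma Laplace_cut_is (f : R -> X) (l : C) (a b : R) :
  (forall s, continuous (f : R -> realify X) s) ->
  is_RInt (V := realify X) (fun s : R => scal (Cexp (- (l * s))%C) (f s)) a b
    (minus (Laplace_cut f l b) (Laplace_cut f l a)).
Proof.
intros Hf.
assert (E : forall a b, ex_RInt (V := realify X) (fun s : R => scal (Cexp (- (l * s))%C) (f s)) a b).
  intros; apply (ex_RInt_continuous (V := realify X)); intros z _; now apply continuous_Laplace_integrand.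
assert (H := is_RInt_Chasles (V := realify X) _ a 0 b _ _
  (is_RInt_swap (V := realify X) _ _ _ _ (RInt_correct (V := realify X) _ _ _ (E 0 a)))
  (RInt_correct (V := realify X) _ _ _ (E 0 b))).
rewrite /minus plus_comm; exact H.
Qed.

Lemma Laplace_cut_tail (f : R -> X) (l : C) (M a b : R) :
  (forall s, continuous (f : R -> realify X) s) ->
  (forall s, 0 <= s -> norm (f s) <= M) -> 0 < Re l -> 0 <= a <= b ->
  norm (minus (Laplace_cut f l b) (Laplace_cut f l a)) <= M / Re l * exp (- Re l * a).
Proof.
intros Hf HM Hl Hab.
assert (HM0 : 0 <= M) by (apply Rle_trans with (2 := HM 0 (Rle_refl 0)); apply norm_ge_0).
apply Rle_trans with (M / Re l * exp (- Re l * a) - M / Re l * exp (- Re l * b)).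
  assert (HI : is_RInt (fun s => exp (- Re l * s) * M) a b (M / Re l * exp (- Re l * a) - M / Re l * exp (- Re l * b))).
    replace (M / Re l * exp (- Re l * a) - M / Re l * exp (- Re l * b)) with
      (minus (- (M / Re l) * exp (- Re l * b)) (- (M / Re l) * exp (- Re l * a))).
      2: unfold minus, plus, opp; simpl; ring.
    apply (is_RInt_derive (V := R_CompleteNormedModule) (fun s => - (M / Re l) * exp (- Re l * s))).
      intros s _; auto_derive; [auto|]; field; lra.
    intros s _; apply (ex_derive_continuous (K := R_AbsRing) (V := R_NormedModule)); auto_derive; auto.
  refine (norm_RInt_le (V := realify X) _ _ a b _ _ (proj2 Hab) _ (Laplace_cut_is f l a b Hf) HI).
  intros s Hs.
  apply Rle_trans with (1 := norm_scal_X _ _).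
  rewrite Cmod_Cexp; replace (Re (- (l * s))%C) with (- Re l * s) by (unfold Re; simpl; ring).
  apply Rmult_le_compat_l; [left; apply exp_pos|apply HM; lra].
assert (0 <= M / Re l * exp (- Re l * b)); [|lra].
apply Rmult_le_pos; [now apply Rdiv_le_0_compat|left; apply exp_pos].
Qed.

Lemma exp_decay_lt (K c eps : R) : 0 < c -> 0 < eps -> 0 <= K ->
  exists T0, 0 < T0 /\ forall T, T0 <= T -> K * exp (- c * T) < eps.
Proof.
intros Hc He HK; exists ((K + 1) / (c * eps)).
assert (Hce : 0 < c * eps) by now apply Rmult_lt_0_compat.
assert (H0 : 0 < (K + 1) / (c * eps)) by (apply Rdiv_lt_0_compat; lra).
split; [exact H0|]; intros T HT.
replace (- c * T) with (- (c * T)) by ring; rewrite exp_Ropp.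
assert (H1 : (K + 1) / eps <= c * T).
  replace ((K + 1) / eps) with (c * ((K + 1) / (c * eps))) by (field; lra).
  apply Rmult_le_compat_l; lra.
assert (H2 : c * T < exp (c * T)) by (generalize (exp_ineq1_le (c * T)); lra).
assert (H3 : 0 < (K + 1) / eps) by (apply Rdiv_lt_0_compat; lra).
apply Rmult_lt_reg_r with (exp (c * T)); [apply exp_pos|].
rewrite Rmult_assoc Rinv_l; [|apply Rgt_not_eq, exp_pos].
assert (H4 : eps * ((K + 1) / eps) = K + 1) by (field; lra).
nra.
Qed.

Lemma norm_minus_sym (u v : X) : norm (minus u v) = norm (minus v u).
Proof. rewrite -(norm_opp (V := X)) opp_minus //. Qed.

Lemma Laplace_cut_lim (f : R -> X) (l : C) (M : R) :
  (forall s, continuous (f : R -> realify X) s) ->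
  (forall s, 0 <= s -> norm (f s) <= M) -> 0 < Re l ->
  exists y : X, filterlim (Laplace_cut f l) (Rbar_locally p_infty) (locally y).
Proof.
intros Hf HM Hl.
assert (HM0 : 0 <= M) by (apply Rle_trans with (2 := HM 0 (Rle_refl 0)); apply norm_ge_0).
apply (filterlim_locally_cauchy (U := CompleteNormedModule.CompleteSpace _ X)); intros eps.
destruct (exp_decay_lt (M / Re l) (Re l) eps) as (T0 & HT0 & HT); [exact Hl|apply cond_pos|now apply Rdiv_le_0_compat|].
exists (fun T => T0 < T); split; [now exists T0|].
intros u v Hu Hv; apply (norm_compat1 (V := X)).
destruct (Rle_lt_dec u v) as [H|H].
  apply Rle_lt_trans with (1 := Laplace_cut_tail f l M u v Hf HM Hl (conj (Rle_trans _ _ _ (Rlt_le _ _ HT0) (Rlt_le _ _ Hu)) H)).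
  apply HT; lra.
change (norm (minus (Laplace_cut f l v) (Laplace_cut f l u) : X) < eps).
rewrite norm_minus_sym.
apply Rle_lt_trans with (1 := Laplace_cut_tail f l M v u Hf HM Hl (conj (Rle_trans _ _ _ (Rlt_le _ _ HT0) (Rlt_le _ _ Hv)) (Rlt_le _ _ H))).
apply HT; lra.
Qed.

(** [g] stands for a continuous extension of [f] to the whole line. *)
Lemma Laplace_of_lim (f g : R -> X) (l : C) (y : X) :
  (forall s, continuous (g : R -> realify X) s) ->
  (forall s, 0 <= s -> f s = g s) ->
  filterlim (Laplace_cut g l) (Rbar_locally p_infty) (locally y) ->
  Laplace f l = y.
Proof.
intros Hg E Hy; apply (is_RInt_gen_unique (V := realify X)); intros P HP.
assert (HQ : Rbar_locally p_infty (fun T => 0 < T /\ P (Laplace_cut g l T))).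
  apply filter_and; [now exists 0|exact (Hy P HP)].
apply (Filter_prod _ _ _ (fun a => a = 0) _ (eq_refl 0) HQ).
intros a T Ha [HT HPT]; simpl in Ha |- *; subst a; exists (Laplace_cut g l T); split; [|exact HPT].
apply (is_RInt_ext (V := realify X) (fun s : R => scal (Cexp (- (l * s))%C) (g s))).
  intros s; rewrite Rmin_left; [|lra]; intros Hs; rewrite E //; lra.
apply (RInt_correct (V := realify X)), (ex_RInt_continuous (V := realify X)).
intros z _; now apply continuous_Laplace_integrand.
Qed.
End LaplaceTransform.

(** * From smooth functions to uniform limits *)

Lemma exp_le_compat (x y : R) : x <= y -> exp x <= exp y.
Proof. intros [H| ->]; [left; now apply exp_increasing|apply Rle_refl]. Qed.

Section Approximation.
Context {X : CompleteNormedModule C_AbsRing}.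

Lemma modes_S (f : nat -> X) (N : nat) : sum_n_m f 1 (S N) = plus (sum_n_m f 1 N) (f (S N)).
Proof. apply (sum_n_Sm f); lia. Qed.

Lemma modes_0 (f : nat -> X) : sum_n_m f 1 0 = zero.
Proof. apply (sum_n_m_zero f); lia. Qed.

Lemma scal_modes (c : nat -> C) (u : X) (N : nat) :
  scal (sum_n_m c 1 N : C_AbsRing) u = sum_n_m (fun j => scal (c j : C_AbsRing) u) 1 N.
Proof.
induction N as [|N IH].
  rewrite Cmodes_0 modes_0; exact (scal_zero_l (V := X) u).
rewrite Cmodes_S modes_S -IH; exact (scal_distr_r (V := X) (sum_n_m c 1 N) (c (S N)) u).
Qed.

Lemma is_RInt_modes (f : nat -> R -> X) (J : nat -> X) (a b : R) (N : nat) :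
  (forall j, is_RInt (V := realify X) (f j) a b (J j)) ->
  is_RInt (V := realify X) (fun s => sum_n_m (fun j => f j s) 1 N) a b (sum_n_m J 1 N).
Proof.
intros H; induction N as [|N IH].
  rewrite modes_0; apply (is_RInt_ext (V := realify X) (fun _ => zero)).
    intros s _; symmetry; exact (modes_0 (fun j => f j s)).
  assert (H0 := is_RInt_const (V := realify X) a b zero).
  rewrite (scal_zero_r (V := realify X)) in H0; exact H0.
rewrite modes_S; apply (is_RInt_ext (V := realify X) (fun s => plus (sum_n_m (fun j => f j s) 1 N) (f (S N) s))).
  intros s _; symmetry; exact (modes_S (fun j => f j s) N).
exact (is_RInt_plus (V := realify X) _ _ _ _ _ _ IH (H (S N))).
Qed.

Lemma filterlim_modes (c : nat -> C) (F : nat -> R -> X) (y : nat -> X)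
  (G : (R -> Prop) -> Prop) (HG : Filter G) (N : nat) :
  (forall j, (1 <= j <= N)%nat -> filterlim (F j) G (locally (y j))) ->
  filterlim (fun T => sum_n_m (fun j => scal (c j : C_AbsRing) (F j T)) 1 N) G
    (locally (sum_n_m (fun j => scal (c j : C_AbsRing) (y j)) 1 N)).
Proof.
induction N as [|N IH]; intros H.
  rewrite modes_0; apply (filterlim_ext (fun _ => zero)); [intros; now rewrite modes_0|].
  apply filterlim_const.
rewrite modes_S.
apply (filterlim_ext (fun T => plus (sum_n_m (fun j => scal (c j : C_AbsRing) (F j T)) 1 N) (scal (c (S N) : C_AbsRing) (F (S N) T)))).
  intros; now rewrite modes_S.
eapply filterlim_comp_2.
- apply IH; intros j Hj; apply H; lia.
- eapply filterlim_comp; [apply H; lia|].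
  exact (filterlim_scal_r (V := X) (c (S N)) (y (S N))).
- exact (filterlim_plus (V := X) _ _).
Qed.

Lemma modes_ext (f g : nat -> X) (N : nat) :
  (forall j, (1 <= j <= N)%nat -> f j = g j) -> sum_n_m f 1 N = sum_n_m g 1 N.
Proof. intros H; apply sum_n_m_ext_loc; intros; apply H; lia. Qed.

Section Fixed.
Variables (lambda bb : nat -> nat -> C) (n : nat).
Hypothesis roots : padeQ_roots n (lambda n).
Hypothesis fractions : pade_partial_fractions n (lambda n) (bb n).

(** The approximation is the limit of the integrals over [[0, T]] of [f] against [g]
    at the scale [t]. *)
Lemma Laplace_inv_cut (f g : R -> X) (M t : R) : 0 < t ->
  (forall s, continuous (g : R -> realify X) s) ->
  (forall s, 0 <= s -> norm (g s) <= M) ->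
  (forall s, 0 <= s -> f s = g s) ->
  exists J : R -> X,
    (forall T, is_RInt (V := realify X)
       (fun s => scal (RtoC (/ t) * ker_before n (lambda n) (bb n) O (s / t)%R)%C (g s)) 0 T (J T)) /\
    filterlim J (Rbar_locally p_infty) (locally (Laplace_inv_approx lambda bb f n t)).
Proof.
intros Ht Hg HM E.
assert (Htn : t <> 0) by lra.
assert (Ht' : RtoC t <> 0%C) by (intros H; apply RtoC_inj in H; lra).
exists (fun T => sum_n_m (fun j => scal (bb n j / t)%C (Laplace_cut g (lambda n j / t)%C T)) 1 (n + 1)); split.
- intros T.
  apply (is_RInt_ext (V := realify X) (fun s => sum_n_m (fun j => scal (bb n j / t)%C (scal (Cexp (- ((lambda n j / t) * s))%C) (g s))) 1 (n + 1))).
    intros s _; symmetry; unfold ker_before; rewrite -Cmodes_mult_l scal_modes.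
    apply modes_ext; intros j _; unfold mode; rewrite scal_assoc; f_equal; unfold mult; simpl.
    rewrite (RtoC_div s t) // (RtoC_inv t) //.
    replace (lambda n j * (s / t))%C with (lambda n j / t * s)%C by (field; exact Ht').
    field; exact Ht'.
  apply (is_RInt_modes (fun j s => scal (bb n j / t)%C (scal (Cexp (- ((lambda n j / t) * s))%C) (g s)))
    (fun j => scal (bb n j / t)%C (Laplace_cut g (lambda n j / t)%C T))); intros j.
  apply (is_RInt_scalC (bb n j / t)%C (fun s : R => scal (Cexp (- ((lambda n j / t) * s))%C) (g s))).
    intros s; now apply continuous_Laplace_integrand.
  apply (RInt_correct (V := realify X)), (ex_RInt_continuous (V := realify X)).
  intros z _; now apply continuous_Laplace_integrand.
- unfold Laplace_inv_approx.
  apply (filterlim_modes (fun j => (bb n j / t)%C) (fun j => Laplace_cut g (lambda n j / t)%C)).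
    apply _.
  intros j Hj.
  assert (Hl : 0 < Re (lambda n j / t)%C).
    assert (Hr := root_Re n (lambda n j) (root_padeQ n (lambda n) roots j Hj)).
    replace (Re (lambda n j / t)%C) with (Re (lambda n j) / t).
      apply Rdiv_lt_0_compat; lra.
    unfold Cdiv; rewrite -(RtoC_inv t) //; unfold Re; simpl; unfold Rdiv; ring.
  destruct (Laplace_cut_lim g (lambda n j / t)%C M Hg HM Hl) as [y Hy].
  now rewrite (Laplace_of_lim f g _ y Hg E Hy).
Qed.

Lemma ker_before0_bound : exists G, 0 <= G /\ forall s, 0 <= s ->
  Cmod (ker_before n (lambda n) (bb n) 0 s) <= G * exp (- s / 4).
Proof.
unfold ker_before.
assert (H : forall N, (N <= n + 1)%nat -> exists G, 0 <= G /\ forall s, 0 <= s ->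
  Cmod (sum_n_m (fun j => (bb n j * mode (lambda n j) 0 s)%C) 1 N) <= G * exp (- s / 4)).
  induction N as [|N IH]; intros HN.
    exists 0; split; [lra|]; intros s Hs; rewrite Cmodes_0 Cmod_0; lra.
  destruct IH as (G & HG & HI); [lia|].
  exists (G + Cmod (bb n (S N))); split; [generalize (Cmod_ge_0 (bb n (S N))); lra|].
  intros s Hs; rewrite Cmodes_S; apply Rle_trans with (1 := Cmod_triangle _ _).
  rewrite Rmult_plus_distr_r; apply Rplus_le_compat; [now apply HI|].
  rewrite Cmod_mult; apply Rmult_le_compat_l; [apply Cmod_ge_0|].
  unfold mode; rewrite Cmod_Cexp.
  assert (Hr := root_Re n (lambda n (S N)) (root_padeQ n (lambda n) roots (S N) ltac:(lia))).
  replace (Re (- (lambda n (S N) * s))%C) with (- (Re (lambda n (S N)) * s)) by (unfold Re; simpl; ring).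
  apply exp_le_compat; nra.
apply H; lia.
Qed.

(** Both sides of the bound for smooth functions depend continuously on the function in
    the supremum norm, since [g] is integrable; so it is enough to approximate [f]
    uniformly by smooth functions with nearly the same bound [L]. *)
Lemma approx_error (f : R -> X) (M t L : R) (k : nat) :
  0 < t -> (1 <= k <= n)%nat ->
  (forall s, continuous ((fun s => f (Rmax 0 s)) : R -> realify X) s) ->
  (forall s, 0 <= s -> norm (f s) <= M) ->
  (forall eta, 0 < eta -> exists phi : nat -> R -> X,
     (forall i s, (i < k)%nat -> 0 <= s -> is_derive (V := realify X) (phi i) s (phi (S i) s)) /\
     (forall s, 0 <= s -> continuous (phi k : R -> realify X) s) /\
     (forall s, 0 <= s -> norm (phi k s) <= L + eta) /\
     (forall i, (i < k)%nat -> exists B, forall s, 0 <= s -> norm (phi i s) <= B) /\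
     (forall s, 0 <= s -> norm (minus (f s) (phi O s)) <= eta)) ->
  norm (minus (Laplace_inv_approx lambda bb f n t) (f t)) <=
    t ^ k * L * (2 * Rpower (INR n + 1) (- INR k + 1 / 2)).
Proof.
intros Ht Hk Hf HM Happ.
set (theta := 2 * Rpower (INR n + 1) (- INR k + 1 / 2)).
assert (Hth : 0 < theta) by (unfold theta; apply Rmult_lt_0_compat; [lra|apply exp_pos]).
destruct ker_before0_bound as (G & HG & HGb).
set (g := fun s => f (Rmax 0 s)).
assert (Eg : forall s, 0 <= s -> f s = g s) by (intros s Hs; unfold g; now rewrite Rmax_right).
assert (HMg : forall s, 0 <= s -> norm (g s) <= M) by (intros s Hs; rewrite -Eg //; now apply HM).
destruct (Laplace_inv_cut f g M t Ht Hf HMg Eg) as (J & HJ & HJl).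
apply le_epsilon; intros del Hdel.
set (c := 4 * G + t ^ k * theta + 1).
assert (Htk : 0 < t ^ k) by now apply pow_lt.
assert (Hc : 0 < c) by (unfold c; generalize (Rmult_lt_0_compat _ _ Htk Hth); lra).
(* the total error is [eta * c], plus twice [del / 4] for the truncation at [T] *)
set (eta := del / (2 * c)).
assert (Heta : 0 < eta) by (apply Rdiv_lt_0_compat; lra).
destruct (Happ eta Heta) as (phi & Hd & Hpk & HL & Hb & H0).
destruct (concomitant_vanish n (lambda n) (bb n) roots fractions phi k t Ht) as (K & HK & Hvan); [lia|exact Hb|].
destruct (exp_decay_lt K (/ (4 * t)) (del / 4)) as (T1 & HT1 & Hexp).
  apply Rinv_0_lt_compat; lra. lra. exact HK.
assert (HT : exists T, t <= T /\ T1 <= T /\ norm (minus (J T) (Laplace_inv_approx lambda bb f n t)) < del / 4).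
  set (e4 := mkposreal (del / 4) ltac:(lra)).
  assert (HQ := HJl _ (locally_le_locally_norm (V := X) _ _ (locally_norm_ball_norm (V := X) _ e4))).
  destruct HQ as [T2 HT2].
  set (T := Rmax t (Rmax T1 (T2 + 1))).
  assert (HA := Rmax_l t (Rmax T1 (T2 + 1))); assert (HB := Rmax_r t (Rmax T1 (T2 + 1))).
  assert (HC := Rmax_l T1 (T2 + 1)); assert (HD := Rmax_r T1 (T2 + 1)).
  exists T; split; [|split]; [unfold T; lra|unfold T; lra|].
  apply HT2; unfold T; lra.
destruct HT as (T & HtT & HT1T & HJT).
destruct (kernel_error n (lambda n) (bb n) roots fractions phi k t T (L + eta) Ht HtT Hk Hd Hpk HL)
  as (I & HI & HIe).
assert (HDiff : norm (minus (J T) I) <= 4 * G * eta).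
  assert (HJI := is_RInt_minus (V := realify X) _ _ _ _ _ _ (HJ T) HI).
  assert (HS : is_RInt (fun s => eta * (G * (/ t * exp (- (s / t) / 4)))) 0 T (eta * (4 * G) - eta * (4 * G) * exp (- (T / t) / 4))).
    replace (eta * (4 * G) - eta * (4 * G) * exp (- (T / t) / 4)) with
      (minus (- (eta * (4 * G)) * exp (- (T / t) / 4)) (- (eta * (4 * G)) * exp (- (0 / t) / 4))).
      2: replace (- (0 / t) / 4) with 0 by (field; lra); rewrite exp_0; unfold minus, plus, opp; simpl; ring.
    apply (is_RInt_derive (V := R_CompleteNormedModule) (fun s => - (eta * (4 * G)) * exp (- (s / t) / 4))).
      intros s _; unfold Rdiv; auto_derive; [auto|]; field; lra.
    intros s _; apply (ex_derive_continuous (K := R_AbsRing) (V := R_NormedModule)); unfold Rdiv; auto_derive; auto.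
  apply Rle_trans with (eta * (4 * G) - eta * (4 * G) * exp (- (T / t) / 4)).
    refine (norm_RInt_le (V := realify X) _ _ 0 T _ _ _ _ HJI HS); [lra|].
    intros s Hs.
    change (norm (minus (scal (RtoC (/ t) * ker_before n (lambda n) (bb n) 0 (s / t)%R)%C (g s))
      (scal (RtoC (/ t) * ker_before n (lambda n) (bb n) 0 (s / t)%R)%C (phi O s)) : X) <= eta * (G * (/ t * exp (- (s / t) / 4)))).
    rewrite -(scal_minus_distr_l (V := X)).
    apply Rle_trans with (1 := norm_scal_X _ _).
    rewrite Cmod_mult Cmod_R Rabs_pos_eq; [|left; now apply Rinv_0_lt_compat].
    rewrite -Eg; [|lra].
    replace (eta * (G * (/ t * exp (- (s / t) / 4)))) with ((/ t * (G * exp (- (s / t) / 4))) * eta) by ring.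
    assert (0 < / t) by now apply Rinv_0_lt_compat.
    apply Rmult_le_compat; [|apply norm_ge_0| |apply H0; lra].
      apply Rmult_le_pos; [lra|apply Cmod_ge_0].
    apply Rmult_le_compat_l; [lra|]; apply HGb; apply Rmult_le_pos; lra.
  assert (0 <= eta * (4 * G) * exp (- (T / t) / 4)); [|lra].
  apply Rmult_le_pos; [apply Rmult_le_pos; lra|left; apply exp_pos].
assert (HV : norm (concomitant t (ker_after n (lambda n) (bb n)) phi k T) < del / 4).
  apply Rle_lt_trans with (1 := Hvan T HtT).
  replace (- (T / t) / 4) with (- / (4 * t) * T) by (field; lra); now apply Hexp.
assert (HP := H0 t (Rlt_le _ _ Ht)).
assert (Hc2 : eta * c = del / 2) by (unfold eta; field; lra).
set (A := Laplace_inv_approx lambda bb f n t) in *.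
replace (minus A (f t)) with (plus (minus A (J T)) (plus (minus (J T) I) (plus (minus I (phi O t)) (minus (phi O t) (f t))))).
  2: now rewrite !minus_plus_minus.
apply Rle_trans with (1 := norm_triangle_X _ _).
assert (HA1 : norm (minus A (J T)) < del / 4) by now rewrite norm_minus_sym.
assert (HA2 : norm (minus (phi O t) (f t)) <= eta) by now rewrite norm_minus_sym.
assert (HA3 := norm_triangle_X (minus (J T) I) (plus (minus I (phi O t)) (minus (phi O t) (f t)))).
assert (HA4 := norm_triangle_X (minus I (phi O t)) (minus (phi O t) (f t))).
fold theta in HIe.
replace (t ^ k * (L + eta) * theta) with (t ^ k * L * theta + eta * (t ^ k * theta)) in HIe by ring.
assert (Hc3 : eta * c = 4 * G * eta + eta * (t ^ k * theta) + eta) by (unfold c; ring).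
assert (HB4 := Rle_trans _ _ _ HA4 (Rplus_le_compat _ _ _ _ HIe HA2)).
assert (HB3 := Rle_trans _ _ _ HA3 (Rplus_le_compat _ _ _ _ HDiff HB4)).
apply Rle_trans with (1 := Rplus_le_compat _ _ _ _ (Rlt_le _ _ HA1) HB3).
lra.
Qed.
End Fixed.
End Approximation.

(** * Functions on the half line *)

Lemma minus_minus_cancel (G : AbelianGroup) (q d e : G) :
  minus (minus q e) (minus q d) = minus d e.
Proof.
rewrite /minus opp_plus opp_opp (plus_comm q (opp e)) -plus_assoc (plus_assoc q).
by rewrite plus_opp_r plus_zero_l plus_comm.
Qed.

Section HalfLineFunctions.
Context {X : CompleteNormedModule C_AbsRing}.

Lemma is_derive_hl_interior (f : R -> X) (s : R) (d : X) : 0 < s ->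
  is_derive_hl f s d -> is_derive (V := realify X) f s d.
Proof.
intros Hs [Hlin Hd]; split; [exact Hlin|]; intros x Hx eps.
assert (Hpos : locally s (fun y => 0 <= y)).
  exists (mkposreal s Hs); intros y Hy.
  change (Rabs (y - s) < s) in Hy; apply Rabs_def2 in Hy; lra.
assert (Hx' : is_filter_lim (within (Rle 0) (locally s)) x).
  intros P HP; unfold within; generalize (Hx P HP); apply filter_imp; auto.
generalize (filter_and _ _ Hpos (Hd x Hx' eps)); apply filter_imp; intros y [H1 H2]; now apply H2.
Qed.

(** Two derivatives differ by at most [eps] in norm: compare the two first order
    expansions at the point [s + h] for a small [h]. *)
Lemma is_derive_norm_unique (f : R -> X) (s : R) (d e : X) :
  is_derive (V := realify X) f s d -> is_derive (V := realify X) f s e -> d = e.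
Proof.
intros [_ Hd] [_ He].
assert (Hs : is_filter_lim (locally s) s) by (intros P HP; exact HP).
cut (minus d e = zero).
  intros H; replace d with (plus (minus d e) e).
    rewrite H; apply plus_zero_l.
  unfold minus; rewrite -plus_assoc plus_opp_l; apply plus_zero_r.
apply (norm_eq_zero (V := X)).
apply Rle_antisym; [|apply norm_ge_0].
apply le_epsilon; intros eps Heps.
set (e2 := mkposreal (eps / 2) ltac:(lra)).
destruct (filter_and _ _ (Hd s Hs e2) (He s Hs e2)) as [del Hdel].
specialize (Hdel (s + del / 2)).
assert (Hb : ball s del (s + del / 2)).
  change (Rabs (s + del / 2 - s) < del); generalize (cond_pos del); intros.
  rewrite Rabs_pos_eq; lra.
destruct (Hdel Hb) as [H1 H2]; clear Hdel Hb.
set (h := del / 2) in H1, H2.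
assert (Hh : 0 < h) by (unfold h; generalize (cond_pos del); lra).
assert (Hmh : minus (s + h) s = h :> R) by (unfold minus, plus, opp; simpl; ring).
rewrite Hmh in H1, H2.
set (q := minus (f (s + h)) (f s)).
change (norm (minus q (scal (RtoC h : C_AbsRing) d)) <= eps / 2 * Rabs h) in H1.
change (norm (minus q (scal (RtoC h : C_AbsRing) e)) <= eps / 2 * Rabs h) in H2.
rewrite (Rabs_pos_eq h) in H1, H2; try lra.
assert (E : minus d e = scal (RtoC (/ h) : C_AbsRing) (minus (minus q (scal (RtoC h : C_AbsRing) e)) (minus q (scal (RtoC h : C_AbsRing) d)))).
  replace (minus (minus q (scal (RtoC h : C_AbsRing) e)) (minus q (scal (RtoC h : C_AbsRing) d)))
    with (scal (RtoC h : C_AbsRing) (minus d e)).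
    rewrite scal_assoc; replace (mult (RtoC (/ h) : C_AbsRing) (RtoC h)) with (one : C_AbsRing).
      symmetry; apply (scal_one (V := X)).
    unfold mult, one; simpl; rewrite -RtoC_mult; f_equal; field; lra.
  rewrite (scal_minus_distr_l (V := X)); symmetry.
  exact (minus_minus_cancel (CompleteNormedModule.AbelianGroup _ X) q _ _).
rewrite E; apply Rle_trans with (1 := norm_scal_X _ _).
rewrite Cmod_R Rabs_pos_eq; [|left; now apply Rinv_0_lt_compat].
apply Rle_trans with (/ h * (eps / 2 * h + eps / 2 * h)).
  apply Rmult_le_compat_l; [left; now apply Rinv_0_lt_compat|].
  rewrite /minus -/(minus q _); apply Rle_trans with (1 := norm_triangle_X _ _).
  apply Rplus_le_compat; [exact H2|]; rewrite (norm_opp (V := X)); exact H1.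
right; field; lra.
Qed.

Lemma Derive_hl_interior (f : R -> X) (s : R) : 0 < s ->
  ex_derive_hl f s -> is_derive (V := realify X) f s (Derive_hl f s).
Proof.
intros Hs [d Hd].
assert (E : Derive_hl f s = d).
  apply (iota_unique (V := X)); [|exact Hd].
  intros e He; apply (is_derive_norm_unique f s); now apply is_derive_hl_interior.
rewrite E; now apply is_derive_hl_interior.
Qed.

Lemma uniformly_continuous_hl_extension (f : R -> X) (s : R) :
  uniformly_continuous_hl f -> continuous ((fun s => f (Rmax 0 s)) : R -> realify X) s.
Proof.
intros Hu; apply (filterlim_locally (U := realify X)); intros eps.
destruct (Hu eps) as [del Hdel]; exists del; intros r Hr.
change (Rabs (r - s) < del) in Hr.
apply (norm_compat1 (V := X)); apply Hdel; try apply Rmax_l.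
apply Rle_lt_trans with (2 := Hr).
unfold Rmax; destruct (Rle_dec 0 r); destruct (Rle_dec 0 s); unfold Rabs;
  repeat destruct Rcase_abs; lra.
Qed.

Lemma uniformly_continuous_hl_interior (f : R -> X) (s : R) : 0 < s ->
  uniformly_continuous_hl f -> continuous (f : R -> realify X) s.
Proof.
intros Hs Hu.
apply (continuous_ext_loc (U := realify X) f (fun s => f (Rmax 0 s)) s).
  exists (mkposreal s Hs); intros y Hy.
  change (Rabs (y - s) < s) in Hy; apply Rabs_def2 in Hy.
  rewrite Rmax_right //; lra.
now apply uniformly_continuous_hl_extension.
Qed.

Lemma sup_norm_hl_bounds (g : R -> X) (M : R) :
  (forall s, 0 <= s -> norm (g s) <= M) ->
  exists S, sup_norm_hl g = Finite S /\ 0 <= S <= M /\ forall s, 0 <= s -> norm (g s) <= S.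
Proof.
intros HM; unfold sup_norm_hl.
destruct (Lub_Rbar_correct (fun r => exists s, 0 <= s /\ r = norm (g s))) as [Hub Hlub].
assert (H1 : Rbar_le (Lub_Rbar (fun r => exists s, 0 <= s /\ r = norm (g s))) M).
  apply Hlub; intros r (s & Hs & ->); now apply HM.
destruct (Lub_Rbar (fun r => exists s, 0 <= s /\ r = norm (g s))) as [S| |].
- exists S; split; [reflexivity|]; split; [split|].
  + apply Rle_trans with (norm (g 0)); [apply norm_ge_0|].
    apply Hub; exists 0; split; [lra|reflexivity].
  + exact H1.
  + intros s Hs; apply Hub; now exists s.
- destruct H1.
- destruct (Hub (norm (g 0))); exists 0; split; [lra|reflexivity].
Qed.

(** The quotients in the definition of [Lconst] lie between [0] and a Lipschitz constant,
    so that the upper limit is a real number [L]; for small steps they are at most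
    [L + eta]. *)
Lemma Lconst_Lipschitz (g : R -> X) : Lipschitz_hl g ->
  exists L, Lconst g = Finite L /\ 0 <= L /\
    forall eta, 0 < eta -> exists del, 0 < del /\
      forall h r, 0 < h < del -> 0 <= r -> norm (minus (g (h + r)) (g r)) <= (L + eta) * h.
Proof.
intros [M HM].
assert (HS : forall h, 0 < h -> exists S,
  sup_norm_hl (fun s => minus (g (h + s)) (g s)) = Finite S /\ 0 <= S <= M * h /\
  forall s, 0 <= s -> norm (minus (g (h + s)) (g s)) <= S).
  intros h Hh; apply (sup_norm_hl_bounds (fun s => minus (g (h + s)) (g s))).
  intros s Hs; apply Rle_trans with (1 := HM (h + s) s ltac:(lra) Hs).
  replace (h + s - s) with h by ring; rewrite Rabs_pos_eq; lra.
set (phi := fun t => Rbar_mult (/ t) (sup_norm_hl (fun s => minus (g (t + s)) (g s)))).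
assert (Hphi : forall h, 0 < h -> exists q, phi h = Finite q /\ 0 <= q <= M /\
  forall s, 0 <= s -> norm (minus (g (h + s)) (g s)) <= q * h).
  intros h Hh; destruct (HS h Hh) as (S & E & HSb & HSs); exists (/ h * S); split; [|split].
  - unfold phi; rewrite E; reflexivity.
  - assert (0 < / h) by now apply Rinv_0_lt_compat.
    split; [apply Rmult_le_pos; lra|].
    apply Rle_trans with (/ h * (M * h)); [apply Rmult_le_compat_l; lra|right; field; lra].
  - intros s Hs; replace (/ h * S * h) with S by (field; lra); now apply HSs.
set (Y := fun y : Rbar => exists delta : R, 0 < delta /\
    y = Rbar_lub (fun z : Rbar => exists t : R, 0 < t < delta /\ z = phi t)).
assert (HE : Lconst g = Rbar_glb Y) by reflexivity; rewrite HE; clear HE.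
destruct (proj2_sig (Rbar_ex_glb Y) : Rbar_is_glb Y (Rbar_glb Y)) as [Hlb Hglb].
assert (H0 : Rbar_le 0 (Rbar_glb Y)).
  apply Hglb; intros y (del & Hdel & ->).
  destruct (Hphi (del / 2)) as (q & E & Hq & _); [lra|].
  apply Rbar_le_trans with (Finite q); [exact (proj1 Hq)|].
  apply (proj1 (proj2_sig (Rbar_ex_lub _))); exists (del / 2); split; [lra|now symmetry].
assert (H1 : Rbar_le (Rbar_glb Y) M).
  apply Rbar_le_trans with (Rbar_lub (fun z : Rbar => exists t : R, 0 < t < 1 /\ z = phi t)).
    apply Hlb; exists 1; split; [lra|reflexivity].
  apply (proj2 (proj2_sig (Rbar_ex_lub _))); intros z (t & Ht & ->).
  destruct (Hphi t) as (q & -> & Hq & _); [lra|exact (proj2 Hq)].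
destruct (Rbar_glb Y) as [L| |]; [|destruct H1|destruct H0].
exists L; split; [reflexivity|]; split; [exact H0|]; intros eta Heta.
assert (Hex : exists y, Y y /\ Rbar_lt y (L + eta)).
  apply NNPP; intros Hn.
  assert (Rbar_le (L + eta) L).
    apply Hglb; intros y Hy; apply Rbar_not_lt_le; intros Hlt; apply Hn; now exists y.
  simpl in H; lra.
destruct Hex as (y & (del & Hdel & ->) & Hlt); exists del; split; [exact Hdel|].
intros h r Hh Hr; destruct (Hphi h) as (q & E & Hq & Hqs); [lra|].
apply Rle_trans with (1 := Hqs r Hr); apply Rmult_le_compat_r; [lra|].
change (Rbar_le q (L + eta)).
apply Rbar_le_trans with (2 := Rbar_lt_le _ _ Hlt).
apply (proj1 (proj2_sig (Rbar_ex_lub _))); now exists h.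
Qed.
End HalfLineFunctions.

(** * Smoothing, and the size of the constant *)

Section Mollify.
Context {X : CompleteNormedModule C_AbsRing}.

(** The arguments are moved into the open half line, where one-sided derivatives are
    two-sided. *)
Definition shift_quotient (h : R -> X) (e s : R) : X :=
  scal (RtoC (/ e) : C_AbsRing) (minus (h (s + 2 * e)) (h (s + e))).

Lemma is_derive_shift (h : R -> X) (c s : R) (d : X) :
  is_derive (V := realify X) h (s + c) d ->
  is_derive (V := realify X) (fun s => h (s + c)) s d.
Proof.
intros H.
evar_last.
  apply (is_derive_comp (V := realify X) h (fun s => s + c) s d 1 H).
  auto_derive; [auto|ring].
exact (scal_one (V := realify X) d).
Qed.

Lemma is_derive_shift_quotient (h dh : R -> X) (e s : R) : 0 < e -> 0 <= s ->
  (forall r, 0 < r -> is_derive (V := realify X) h r (dh r)) ->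
  is_derive (V := realify X) (shift_quotient h e) s (shift_quotient dh e s).
Proof.
intros He Hs Hd; unfold shift_quotient.
apply (is_derive_scalC_const (RtoC (/ e)) (fun s => minus (h (s + 2 * e)) (h (s + e)))).
apply (is_derive_minus (V := realify X) (fun s => h (s + 2 * e)) (fun s => h (s + e)));
  apply is_derive_shift; apply Hd; lra.
Qed.

Lemma continuous_shift_quotient (h : R -> X) (e s : R) : 0 < e -> 0 <= s ->
  (forall r, 0 < r -> continuous (h : R -> realify X) r) ->
  continuous (shift_quotient h e : R -> realify X) s.
Proof.
intros He Hs Hc; unfold shift_quotient.
assert (HS : forall c, 0 < c -> continuous ((fun s => h (s + c)) : R -> realify X) s).
  intros c Hc0; apply (continuous_comp (U := R_UniformSpace) (V := R_UniformSpace) (W := realify X) (fun s => s + c) h).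
    apply (ex_derive_continuous (K := R_AbsRing) (V := R_NormedModule)); auto_derive; auto.
  apply Hc; lra.
apply (continuous_scal_r (V := realify X) (/ e) (fun s => minus (h (s + 2 * e)) (h (s + e)))).
apply (continuous_minus (V := realify X) (fun s => h (s + 2 * e)) (fun s => h (s + e))); apply HS; lra.
Qed.

Lemma norm_shift_quotient (h : R -> X) (e s B : R) : 0 < e ->
  norm (minus (h (s + 2 * e)) (h (s + e))) <= B * e ->
  norm (shift_quotient h e s) <= B.
Proof.
intros He H; unfold shift_quotient; apply Rle_trans with (1 := norm_scal_X _ _).
assert (0 < / e) by now apply Rinv_0_lt_compat.
rewrite Cmod_R Rabs_pos_eq; [|lra].
apply Rle_trans with (/ e * (B * e)); [apply Rmult_le_compat_l; [lra|exact H]|].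
right; field; lra.
Qed.

(** The quotient of a primitive of [g] is the mean of [g] over [[s + e, s + 2 e]]. *)
Lemma shift_quotient_primitive (g : R -> X) (e eta s : R) :
  (forall r, continuous (g : R -> realify X) r) -> 0 < e ->
  (forall r, s <= r <= s + 2 * e -> norm (minus (g s) (g r)) <= eta) ->
  norm (minus (g s) (shift_quotient (fun r => RInt (V := realify X) g 0 r) e s)) <= eta.
Proof.
intros Hg He H.
assert (E : forall a b, is_RInt (V := realify X) g a b (RInt (V := realify X) g a b)).
  intros a b; apply (RInt_correct (V := realify X)), (ex_RInt_continuous (V := realify X)); auto.
assert (Hc := is_RInt_const (V := realify X) (s + e) (s + 2 * e) (g s)).
assert (Hm := is_RInt_minus (V := realify X) _ _ _ _ _ _ Hc (E (s + e) (s + 2 * e))).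
assert (Hab : s + e <= s + 2 * e) by lra.
assert (Hr : forall r, s + e <= r <= s + 2 * e -> norm (minus (g s) (g r)) <= eta) by (intros r Hr; apply H; lra).
assert (Hn := norm_RInt_le_const (V := realify X) _ _ _ _ eta Hab Hr Hm).
set (D := RInt (V := realify X) g (s + e) (s + 2 * e)) in *.
assert (HD : minus (RInt (V := realify X) g 0 (s + 2 * e)) (RInt (V := realify X) g 0 (s + e)) = D :> X).
  assert (HCh := RInt_Chasles (V := realify X) g 0 (s + e) (s + 2 * e)
    (ex_intro _ _ (E _ _)) (ex_intro _ _ (E _ _))).
  fold D in HCh; rewrite -HCh.
  change (minus (plus (RInt (V := realify X) g 0 (s + e) : X) D) (RInt (V := realify X) g 0 (s + e)) = D).
  rewrite /minus plus_comm plus_assoc plus_opp_l; apply plus_zero_l.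
unfold shift_quotient; rewrite HD.
replace (minus (g s) (scal (RtoC (/ e) : C_AbsRing) D)) with
  (scal (RtoC (/ e) : C_AbsRing) (minus (scal (RtoC (s + 2 * e - (s + e)) : C_AbsRing) (g s)) D)).
  apply Rle_trans with (1 := norm_scal_X _ _).
  assert (0 < / e) by now apply Rinv_0_lt_compat.
  rewrite Cmod_R Rabs_pos_eq; [|lra].
  apply Rle_trans with (/ e * ((s + 2 * e - (s + e)) * eta)); [apply Rmult_le_compat_l; [lra|exact Hn]|].
  right; field; lra.
rewrite (scal_minus_distr_l (V := X)); f_equal.
rewrite scal_assoc.
replace (mult (RtoC (/ e) : C_AbsRing) (RtoC (s + 2 * e - (s + e)))) with (one : C_AbsRing).
  apply (scal_one (V := X)).
unfold mult, one; simpl; rewrite -RtoC_mult; f_equal; field; lra.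
Qed.

(** [phi i] is the quotient of the [i]-th term of the sequence that starts with a
    primitive of [f] and goes on with [f] and its derivatives.  So [phi O] is a mean of
    [f], while [phi k] is a difference quotient of the derivative of order [k - 1], which
    is bounded by the Lipschitz property alone. *)
Lemma Cub1_smoothing (f : R -> X) (k : nat) (L : R) : (1 <= k)%nat ->
  Cub (k - 1) f ->
  (forall eta, 0 < eta -> exists del, 0 < del /\
      forall h r, 0 < h < del -> 0 <= r ->
      norm (minus (Derive_hl_n f (k - 1) (h + r)) (Derive_hl_n f (k - 1) r)) <= (L + eta) * h) ->
  forall eta, 0 < eta -> exists phi : nat -> R -> X,
     (forall i s, (i < k)%nat -> 0 <= s -> is_derive (V := realify X) (phi i) s (phi (S i) s)) /\
     (forall s, 0 <= s -> continuous (phi k : R -> realify X) s) /\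
     (forall s, 0 <= s -> norm (phi k s) <= L + eta) /\
     (forall i, (i < k)%nat -> exists B, forall s, 0 <= s -> norm (phi i s) <= B) /\
     (forall s, 0 <= s -> norm (minus (f s) (phi O s)) <= eta).
Proof.
intros Hk [Hder Hbu] HL eta Heta.
set (g := fun s => f (Rmax 0 s)).
assert (Eg : forall s, 0 <= s -> g s = f s) by (intros s Hs; unfold g; now rewrite Rmax_right).
destruct (Hbu O ltac:(lia)) as [[M HM] Hu]; simpl in HM, Hu.
assert (Hg : forall s, continuous (g : R -> realify X) s).
  intros s; now apply uniformly_continuous_hl_extension.
set (P := fun r => RInt (V := realify X) g 0 r).
set (h := fun i => match i with O => P | S i => Derive_hl_n f i end).
assert (Hh : forall i r, (i < k)%nat -> 0 < r -> is_derive (V := realify X) (h i) r (h (S i) r)).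
  intros i r Hi Hr; destruct i as [|i]; simpl.
    rewrite -Eg; [|lra].
    apply (is_derive_RInt (V := realify X) g P 0); [|apply Hg].
    apply filter_forall; intros b; apply (RInt_correct (V := realify X)), (ex_RInt_continuous (V := realify X)); auto.
  apply Derive_hl_interior; [exact Hr|apply Hder; [lia|lra]].
destruct (HL eta Heta) as (d1 & Hd1 & HLd).
destruct (Hu (mkposreal eta Heta)) as [d2 Hd2].
(* the step of the difference quotient is [e], the farthest argument of the mean is [s + 2 e] *)
set (e := Rmin (d1 / 2) (d2 / 4)).
assert (He : 0 < e) by (apply Rmin_glb_lt; generalize (cond_pos d2); lra).
assert (He1 : e < d1) by (apply Rle_lt_trans with (1 := Rmin_l _ _); lra).
assert (He2 : 2 * e < d2).
  assert (e <= d2 / 4) by apply Rmin_r; generalize (cond_pos d2); lra.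
assert (Hclose : forall s, 0 <= s -> norm (minus (f s) (shift_quotient (h O) e s)) <= eta).
  intros s Hs; rewrite -Eg //; apply shift_quotient_primitive; [exact Hg|exact He|].
  intros r Hr; rewrite !Eg; try lra; left; apply (Hd2 s r); try lra.
  replace (s - r) with (- (r - s)) by ring; rewrite Rabs_Ropp Rabs_pos_eq; lra.
exists (fun i => shift_quotient (h i) e); split; [|split; [|split; [|split]]].
- intros i s Hi Hs; apply is_derive_shift_quotient; auto.
- intros s Hs; apply continuous_shift_quotient; auto; intros r Hr.
  replace k with (S (k - 1)) by lia; simpl.
  apply uniformly_continuous_hl_interior; [exact Hr|apply Hbu; lia].
- intros s Hs; apply norm_shift_quotient; [exact He|].
  replace k with (S (k - 1)) by lia; simpl.
  replace (s + 2 * e) with (e + (s + e)) by ring; apply HLd; lra.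
- intros i Hi; destruct i as [|i].
    exists (M + eta); intros s Hs.
    replace (shift_quotient (h O) e s) with (plus (f s) (opp (minus (f s) (shift_quotient (h O) e s)))).
      apply Rle_trans with (1 := norm_triangle_X _ _); apply Rplus_le_compat; [now apply HM|].
      rewrite (norm_opp (V := X)); now apply Hclose.
    rewrite opp_minus /minus plus_comm -plus_assoc plus_opp_l; apply plus_zero_r.
  destruct (Hbu i ltac:(lia)) as [[B HB] _]; exists (2 * B / e); intros s Hs.
  apply norm_shift_quotient; [exact He|]; simpl.
  apply Rle_trans with (1 := norm_triangle_X _ _); rewrite (norm_opp (V := X)).
  replace (2 * B / e * e) with (B + B) by (field; lra).
  apply Rplus_le_compat; apply HB; lra.
- exact Hclose.
Qed.
End Mollify.

(** By induction from [k = 5] on, where the factor [13 / 10] exceeds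
    [(2 k + 1) / (2 k - 1)]; the margin is smallest at [k = 4]. *)
Lemma pow_13_10 (k : nat) : (1 <= k)%nat -> 2 * INR k - 1 <= 26 / 10 * (13 / 10) ^ k.
Proof.
intros Hk.
destruct (Nat.le_gt_cases 5 k) as [H5|H5].
  induction H5 as [|k H5 IH]; [simpl; lra|].
  assert (IH' := IH ltac:(lia)); rewrite S_INR; simpl pow.
  assert (5 <= INR k) by (replace 5 with (INR 5) by (simpl; lra); now apply le_INR).
  nra.
do 5 (destruct k as [|k]; [simpl; try lra; lia|]); lia.
Qed.

(** The summand with [360 / (13 (2 k - 1))] is enough: its root is at least
    [5.2 / sqrt (2 k - 1)], and [pow_13_10] does the rest. *)
Lemma Cbound_ge_2 (k : nat) : (1 <= k)%nat -> 2 <= Cbound k.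
Proof.
intros Hk; unfold Cbound.
assert (Hk1 : 1 <= INR k) by (replace 1 with (INR 1) by reflexivity; now apply le_INR).
set (m := 2 * INR k - 1); assert (Hm : 0 < m) by (unfold m; lra).
assert (HR : Rpower m (1 / 4) = sqrt (sqrt m)).
  replace (1 / 4) with (/ 2 * / 2) by field.
  rewrite -Rpower_mult !Rpower_sqrt //; now apply sqrt_lt_R0.
rewrite HR.
set (D := 5 ^ (2 * k) / (6 * 13 ^ (2 * k)) + 360 / (13 * m)).
assert (HsD : 52 / 10 / sqrt m <= sqrt D).
  assert (Hsm : 0 < sqrt m) by now apply sqrt_lt_R0.
  apply Rsqr_incr_0; [|left; apply Rdiv_lt_0_compat; lra|apply sqrt_pos].
  assert (H1 : 0 < 5 ^ (2 * k) / (6 * 13 ^ (2 * k))).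
    apply Rdiv_lt_0_compat; [apply pow_lt; lra|]; apply Rmult_lt_0_compat; [lra|apply pow_lt; lra].
  assert (H2 : 0 < 360 / (13 * m)) by (apply Rdiv_lt_0_compat; lra).
  rewrite Rsqr_sqrt; [|unfold D; lra].
  rewrite Rsqr_div'; rewrite Rsqr_sqrt; [|lra].
  apply Rle_trans with (360 / (13 * m)); [|unfold D; lra].
  replace (360 / (13 * m)) with (360 / 13 / m) by (field; lra).
  apply Rmult_le_compat_r; [left; now apply Rinv_0_lt_compat|unfold Rsqr; lra].
set (S := 8 * INR k / Rpower (2 * INR k + 1) (3 / 2) + 13 ^ k / 10 ^ k * sqrt D).
assert (HS : 2 * sqrt m <= S).
  assert (H1 : 0 < 8 * INR k / Rpower (2 * INR k + 1) (3 / 2)).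
    apply Rdiv_lt_0_compat; [lra|apply exp_pos].
  assert (Hp : 13 ^ k / 10 ^ k = (13 / 10) ^ k).
    unfold Rdiv; rewrite Rpow_mult_distr pow_inv //.
  assert (Hp0 : 0 < (13 / 10) ^ k) by (apply pow_lt; lra).
  assert (Hsm : 0 < sqrt m) by now apply sqrt_lt_R0.
  assert (H2 : (13 / 10) ^ k * (52 / 10 / sqrt m) <= (13 / 10) ^ k * sqrt D).
    apply Rmult_le_compat_l; lra.
  assert (H3 : 2 * sqrt m <= (13 / 10) ^ k * (52 / 10 / sqrt m)).
    apply Rmult_le_reg_r with (sqrt m); [exact Hsm|].
    replace ((13 / 10) ^ k * (52 / 10 / sqrt m) * sqrt m) with (2 * (26 / 10 * (13 / 10) ^ k)) by (field; lra).
    rewrite Rmult_assoc sqrt_sqrt; [|lra].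
    generalize (pow_13_10 k Hk); unfold m; lra.
  unfold S; rewrite Hp; lra.
assert (Hsm : 0 < sqrt m) by now apply sqrt_lt_R0.
assert (Hssm : 0 < sqrt (sqrt m)) by now apply sqrt_lt_R0.
apply Rle_trans with (sqrt 2 / sqrt (sqrt m) * sqrt (2 * sqrt m)).
  rewrite sqrt_mult; [|lra|lra].
  replace (sqrt 2 / sqrt (sqrt m) * (sqrt 2 * sqrt (sqrt m))) with (sqrt 2 * sqrt 2) by (field; lra).
  rewrite sqrt_sqrt; lra.
apply Rmult_le_compat_l; [|now apply sqrt_le_1_alt].
apply Rdiv_le_0_compat; [apply sqrt_pos|exact Hssm].
Qed.

(** * The rate of convergence *)

Theorem corollary5p1 :
  forall (lambda b : nat -> nat -> C),
  (forall n : nat, (1 <= n)%nat -> padeQ_roots n (lambda n)) ->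
  (forall n : nat, (1 <= n)%nat ->
     pade_partial_fractions n (lambda n) (b n)) ->
  forall (X : CompleteNormedModule C_AbsRing) (k : nat) (f : R -> X),
  (1 <= k)%nat ->
  Cub1 (k - 1) f ->
  (forall (t : R) (n : nat), 0 < t -> (1 <= n)%nat -> INR n >= INR k - 1 / 2 ->
     Rbar_le
       (norm (minus (Laplace_inv_approx lambda b f n t) (f t)))
       (Rbar_mult
          (Cbound k * t ^ k * Rpower (INR n + 1) (- INR k + 1 / 2))
          (Lconst (Derive_hl_n f (k - 1))))) /\
  (forall t : R, 0 < t ->
     filterlim (fun n : nat => Laplace_inv_approx lambda b f n t)
       eventually (locally (f t))) /\
  (forall t0 : R, 0 < t0 ->
     exists (M : R) (N : nat),
     locally t0 (fun t : R => 0 < t ->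
       forall n : nat, (N <= n)%nat ->
       norm (minus (Laplace_inv_approx lambda b f n t) (f t))
         <= M * Rpower (INR n) (- INR k + 1 / 2))).
Proof.
intros lambda b roots fractions X k f Hk [HC HLip].
destruct (Lconst_Lipschitz _ HLip) as (L & HL & HL0 & Hstep).
assert (HCb := Cbound_ge_2 k Hk).
assert (Hcont : forall s, continuous ((fun s => f (Rmax 0 s)) : R -> realify X) s).
  intros s; apply uniformly_continuous_hl_extension; exact (proj2 (proj2 HC O (Nat.le_0_l _))).
destruct (proj1 (proj2 HC O (Nat.le_0_l _))) as [M HM]; simpl in HM.
assert (Hsm := Cub1_smoothing f k L Hk HC Hstep).
assert (Hmain : forall t n, 0 < t -> (k <= n)%nat ->
  norm (minus (Laplace_inv_approx lambda b f n t) (f t)) <=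
  Cbound k * t ^ k * Rpower (INR n + 1) (- INR k + 1 / 2) * L).
  intros t n Ht Hn.
  apply Rle_trans with (1 := approx_error lambda b n (roots n ltac:(lia)) (fractions n ltac:(lia))
    f M t L k Ht (conj Hk Hn) Hcont HM Hsm).
  replace (t ^ k * L * (2 * Rpower (INR n + 1) (- INR k + 1 / 2))) with
    (2 * (t ^ k * Rpower (INR n + 1) (- INR k + 1 / 2) * L)) by ring.
  replace (Cbound k * t ^ k * Rpower (INR n + 1) (- INR k + 1 / 2) * L) with
    (Cbound k * (t ^ k * Rpower (INR n + 1) (- INR k + 1 / 2) * L)) by ring.
  apply Rmult_le_compat_r; [|exact HCb].
  apply Rmult_le_pos; [|exact HL0]; apply Rmult_le_pos; [apply pow_le; lra|left; apply exp_pos].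
assert (Hrate : forall t n, 0 < t -> (k <= n)%nat ->
  norm (minus (Laplace_inv_approx lambda b f n t) (f t)) <=
  Cbound k * t ^ k * L * Rpower (INR n) (- INR k + 1 / 2)).
  intros t n Ht Hn; apply Rle_trans with (1 := Hmain t n Ht Hn).
  assert (Hn0 : 0 < INR n) by (apply lt_0_INR; lia).
  replace (Cbound k * t ^ k * Rpower (INR n + 1) (- INR k + 1 / 2) * L) with
    (Cbound k * t ^ k * L * Rpower (INR n + 1) (- INR k + 1 / 2)) by ring.
  apply Rmult_le_compat_l.
    apply Rmult_le_pos; [|exact HL0]; apply Rmult_le_pos; [lra|apply pow_le; lra].
  assert (Hk1 : 1 <= INR k) by (replace 1 with (INR 1) by reflexivity; now apply le_INR).
  unfold Rpower; apply exp_le_compat.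
  assert (Hln : ln (INR n) <= ln (INR n + 1)) by (left; apply ln_increasing; lra).
  nra.
split; [|split].
- intros t n Ht Hn Hkn; rewrite HL; apply Hmain; [exact Ht|].
  destruct (Nat.le_gt_cases k n) as [H|H]; [exact H|].
  apply le_INR in H; rewrite S_INR in H; lra.
- intros t Ht; apply (filterlim_locally (U := CompleteNormedModule.UniformSpace _ X)); intros eps.
  assert (HA : 0 <= Cbound k * t ^ k * L).
    apply Rmult_le_pos; [|exact HL0]; apply Rmult_le_pos; [lra|apply pow_le; lra].
  set (A := Cbound k * t ^ k * L) in *.
  (* [n > ((A + 1) / eps) ^ 2] suffices, as the rate is at least that of [n ^ (- 1 / 2)] *)
  assert (He : 0 < (eps / (A + 1)) ^ 2).
    apply pow_lt, Rdiv_lt_0_compat; [apply cond_pos|lra].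
  destruct (archimed_cor1 _ He) as (N0 & HN0 & HN0p).
  exists (Nat.max k N0); intros n Hn; apply (norm_compat1 (V := X)).
  apply Rle_lt_trans with (1 := Hrate t n Ht ltac:(lia)); fold A.
  assert (Hn1 : 1 <= INR n) by (replace 1 with (INR 1) by reflexivity; apply le_INR; lia).
  assert (Hk1 : 1 <= INR k) by (replace 1 with (INR 1) by reflexivity; now apply le_INR).
  assert (H1 : Rpower (INR n) (- INR k + 1 / 2) <= / sqrt (INR n)).
    rewrite -Rpower_sqrt; [|lra]; rewrite -Rpower_Ropp; apply Rle_Rpower; lra.
  assert (H2 : / sqrt (INR n) < eps / (A + 1)).
    apply Rsqr_incrst_0; [|left; apply Rinv_0_lt_compat, sqrt_lt_R0; lra|
      left; apply Rdiv_lt_0_compat; [apply cond_pos|lra]].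
    rewrite Rsqr_inv' Rsqr_sqrt; [|lra].
    replace (Rsqr (eps / (A + 1))) with ((eps / (A + 1)) ^ 2) by (unfold Rsqr; ring).
    apply Rle_lt_trans with (2 := HN0); apply Rinv_le_contravar; [now apply lt_0_INR|].
    apply le_INR; lia.
  apply Rle_lt_trans with (A * (eps / (A + 1))).
    apply Rmult_le_compat_l; lra.
  apply Rlt_le_trans with ((A + 1) * (eps / (A + 1))); [|right; field; lra].
  apply Rmult_lt_compat_r; [apply Rdiv_lt_0_compat; [apply cond_pos|lra]|lra].
- intros t0 Ht0; exists (Cbound k * (t0 + 1) ^ k * L), k.
  exists (mkposreal 1 Rlt_0_1); intros t Htt Ht n Hn.
  change (Rabs (t - t0) < 1) in Htt; apply Rabs_def2 in Htt.
  apply Rle_trans with (1 := Hrate t n Ht Hn).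
  apply Rmult_le_compat_r; [left; apply exp_pos|].
  apply Rmult_le_compat_r; [exact HL0|]; apply Rmult_le_compat_l; [lra|].
  apply pow_incr; lra.
Qed.
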